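(* Let $1<p<\infty$, let $q=p/(p-1)$, and let $\widehat{p}=\max(p-1,1)$. Let $\omega$ be a real function analytic in a (complex) neighborhood of $[0,\infty)$ that is positive, non-increasing and non-constant on $[0,\infty)$. Suppose that $\lim_{r\to\infty}r^n\omega(r^2)=\lim_{r\to\infty}r^n\omega'(r^2)=0$ for all integers $n$, and that the polynomials are dense in $A^p_\infty(\omega(|z|^2))$ and in $A^q_\infty(\omega(|z|^2)-|z|^2\omega'(|z|^2))$. Let $k\in A^q_\infty(\omega(|z|^2))$ be nonzero and let $f$ be the extremal function in $A^p_\infty(\omega(|z|^2))$ for the integral kernel $k$. Then \[ D_p(\infty,f)\le\left[\frac{\widehat{p}}{\|k\|^*}\,D_q(\infty,k)\right]^{1/(p-1)} . \]
   Context: $dA$ is area measure on $\mathbb{C}$. For a nonnegative weight $\nu$ on $\mathbb{C}$, $A^p_\infty(\nu)$ is the space of entire functions $g$ with $\|g\|=\left(\int_{\mathbb{C}}|g|^p\nu\,dA\right)^{1/p}<\infty$. For $k\in A^q_\infty(\nu)$, $\Phi_k(g)=\int_{\mathbb{C}}g\,\overline{k}\,\nu\,dA$ is a bounded linear functional on $A^p_\infty(\nu)$, and $\|k\|^*$ is its operator norm. The extremal function for the kernel $k$ is the (unique) $f\in A^p_\infty(\nu)$ with $\|f\|=1$ and $\operatorname{Re}\Phi_k(f)=\sup\{\operatorname{Re}\Phi_k(g):\|g\|=1\}$. For an entire function $g$, $D_p(\infty,g)=\left(-\int_{\mathbb{C}}|z|^2|g(z)|^p\,\omega'(|z|^2)\,dA(z)\right)^{1/p}$.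 *)

(* Defs.v *)
From HB Require Import structures.
From mathcomp Require Import all_boot all_order all_algebra.
From mathcomp Require Import all_classical all_reals all_analysis.
From mathcomp Require Import complex.
Set Implicit Arguments. Unset Strict Implicit. Unset Printing Implicit Defensive.
Import Order.TTheory GRing.Theory Num.Theory.
Import numFieldNormedType.Exports.
Local Open Scope classical_set_scope.
Local Open Scope ring_scope.

Section Defs.
Context {R : realType}.

Definition csq (z : R[i]) : R := complex.Re z ^+ 2 + complex.Im z ^+ 2.
Definition cabs (z : R[i]) : R := Num.sqrt (csq z).
Definition cconj (z : R[i]) : R[i] := Complex (complex.Re z) (- complex.Im z).
Definition RtoC (x : R) : R[i] := Complex x 0.

Definition cdiff (f : R[i] -> R[i]) (z : R[i]) : Prop :=
  exists l : R[i], forall e : R, 0 < e -> exists2 d : R, 0 < d &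
    forall h : R[i], h != 0 -> cabs h < d -> cabs ((f (z + h) - f z) / h - l) < e.

Definition entire (f : R[i] -> R[i]) : Prop := forall z, cdiff f z.

Definition toC (x : R * R) : R[i] := Complex x.1 x.2.
Definition area : set (R * R) -> \bar R :=
  (@lebesgue_measure R \x @lebesgue_measure R)%E.

Definition aint (F : R[i] -> R) : \bar R :=
  (\int[area]_(x in [set: R * R]) (F (toC x))%:E)%E.

Definition rint (F : R[i] -> R) : R := Rintegral area [set: R * R] (F \o toC).

Definition cint (F : R[i] -> R[i]) : R[i] :=
  Complex (rint (fun z => complex.Re (F z))) (rint (fun z => complex.Im (F z))).

Definition pint (p : R) (nu : R[i] -> R) (g : R[i] -> R[i]) : \bar R :=
  aint (fun z => cabs (g z) `^ p * nu z).

Definition Ap (p : R) (nu : R[i] -> R) (g : R[i] -> R[i]) : Prop :=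
  entire g /\ (pint p nu g < +oo)%E.

Definition Anorm (p : R) (nu : R[i] -> R) (g : R[i] -> R[i]) : R :=
  fine (pint p nu g) `^ p^-1.

Definition Phi (nu : R[i] -> R) (k g : R[i] -> R[i]) : R[i] :=
  cint (fun z => g z * cconj (k z) * RtoC (nu z)).

Definition dualnorm (p : R) (nu : R[i] -> R) (k : R[i] -> R[i]) : R :=
  sup [set cabs (Phi nu k g) | g in [set g | Ap p nu g /\ Anorm p nu g = 1]].

Definition extremal (p : R) (nu : R[i] -> R) (k f : R[i] -> R[i]) : Prop :=
  Ap p nu f /\ Anorm p nu f = 1 /\
  forall g, Ap p nu g -> Anorm p nu g = 1 ->
    complex.Re (Phi nu k g) <= complex.Re (Phi nu k f).

Definition poly_dense (p : R) (nu : R[i] -> R) : Prop :=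
  forall g, Ap p nu g -> forall e : R, 0 < e ->
    exists P : {poly R[i]}, (pint p nu (fun z => (g z - P.[z])%R) < +oo)%E /\
      Anorm p nu (fun z => g z - P.[z]) < e.

(* omega is a real function analytic in a complex neighborhood of [0,oo):
   there is Omega, complex differentiable on a union of discs centered at the
   points of [0,oo), agreeing with omega on the real points of those discs *)
Definition analytic_near_halfline (omega : R -> R) : Prop :=
  exists Omega : R[i] -> R[i], forall x : R, 0 <= x ->
    exists2 r : R, 0 < r &
      (forall w : R[i], cabs (w - RtoC x) < r -> cdiff Omega w) /\
      (forall t : R, `|t - x| < r -> Omega (RtoC t) = RtoC (omega t)).

Definition nu_p (omega : R -> R) (z : R[i]) : R := omega (csq z).
Definition nu_q (omega : R -> R) (z : R[i]) : R :=
  omega (csq z) - csq z * derive1 omega (csq z).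

Definition Dinf (omega : R -> R) (p : R) (g : R[i] -> R[i]) : \bar R :=
  poweR (aint (fun z => - (csq z * cabs (g z) `^ p * derive1 omega (csq z)))) p^-1.

End Defs.

(* Main.v *)
(* Write w = omega, t = |z|^2, q = p / (p - 1) and L = ||k||^*. For u > 1 let
   e(u) = int |f|^p (w(t) - w(ut)) dA and x(u) = e(u) / (u - 1); by Fatou's lemma,
   D_p(f)^p is at most the lower limit of x(u) as u tends to 1. Since monomials are
   orthogonal for every radial weight, testing the extremality of f on its dilation f(z/s) gives
     L (s - N^(1/p)) <= s int |f| |k| (w(t) - w(st)) dA,  N = ||f(z/s)||^p = s^2 (1 - e(s^2)).
   The right-hand side is at most s (s - 1) x(s)^(1/p) D_q(k) by Hoelder and by
   int |k|^q (w(t) - w(st)) dA <= (s - 1) D_q(k)^q, while N <= 1 and Bernoulli bound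
   the left-hand side below by L (s - 1) s^2 x(s^2) / max(p - 1, 1). Hence
   x(s^2) <= c x(s)^(1/p) with c = max(p - 1, 1) D_q(k) / L, which forces x <= c^q.
   Both N <= 1 and the bound on k say that dilating by rho < 1 decreases weighted
   L^r norms. This is proved for polynomials, on which the dilation is a limit of
   convex combinations of rotations, and extended by density. *)
Require Import Defs.
From HB Require Import structures.
From mathcomp Require Import all_boot all_order all_algebra.
From mathcomp Require Import all_classical all_reals all_analysis.
From mathcomp Require Import measurable_realfun complex ring lra.
Set Implicit Arguments.
Unset Strict Implicit.
Unset Printing Implicit Defensive.
Import Order.TTheory GRing.Theory Num.Theory.
Import numFieldNormedType.Exports.
Local Open Scope classical_set_scope.
Local Open Scope ring_scope.

(** * Area measure and linear changes of variable *)

(** Pairing and norm rescale t differently. In int |f(z/s)|^p w dA the variable t is rescaled by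
    s^2; in the pairing only one of the two factors is dilated, and matching monomials shows that t
    is rescaled by s. Hence the recursion links x(s^2) to x(s), and an a priori bound on x is needed
    before it can be closed. Nothing says beforehand that D_p(f) is finite, so the estimates concern
    the quotients x(u), never the derivative itself. The other obstacle is k. Density for the
    exponent q is assumed for [nu_q], while k is only known to lie in the space of [nu_p]. When
    D_q(k) is infinite the claim is trivial only if L > 0, and proving L > 0 requires approximating
    k by polynomials. The way out: int |k|^q w(vt) dA is finite and monotone in v, so its slope
    cannot be infinite at every v in [1, 2]; for a good v a dilation of k lies in the space of
    [nu_q], and k is approximated for the smaller weight w(vt). Truncation to discs, where w(t) and
    w(vt) are comparable, carries vanishing pairings from w(vt) back to w(t). *)

Lemma pushforward_affine (R : realType) (a b : R) (A : set R) : a != 0 ->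
  measurable A ->
  (`|a|%:E * lebesgue_measure ((fun x : R => (a * x + b)%R) @^-1` A) = lebesgue_measure A)%E.
Proof.
move=> a0 mA.
have mf : measurable_fun [set: R] (fun x : R => a * x + b).
  by apply: measurable_funD => //; exact: measurable_funM.
pose phi : R -> measurableTypeR R := fun x => a * x + b.
have a1 : 0 <= `|a| by [].
(* Lebesgue measure is determined by its values on half-open intervals. For a < 0 the preimage of
   ]x, y] is closed on the left instead of on the right, which does not change its length. *)
suff -> : @lebesgue_measure R A = mscale (NngNum a1) (pushforward (@lebesgue_measure R) phi) A => //.
move=> m; apply: lebesgue_measure_unique => //= _ [[x y] _ <-].
rewrite /mscale /= /pushforward.
have -> : (phi @^-1` `]x, y]) = if 0 < a then `](x - b) / a, (y - b) / a]%classic else `[(y - b) / a, (x - b) / a[%classic.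
  apply/seteqP; case: ltP => a2; split => z /=; rewrite !in_itv/= /phi.
  - by rewrite ltr_pdivrMr// ler_pdivlMr// ltrBlDr lerBrDr mulrC.
  - by rewrite ltr_pdivrMr// ler_pdivlMr// ltrBlDr lerBrDr mulrC.
  - have a3 : a < 0 by rewrite lt_neqAle a0.
    by rewrite ltr_ndivlMr// ler_ndivrMr// ltrBlDr lerBrDr mulrC andbC.
  - have a3 : a < 0 by rewrite lt_neqAle a0.
    by rewrite ltr_ndivlMr// ler_ndivrMr// ltrBlDr lerBrDr mulrC andbC.
case: ltP => a2.
  rewrite !lebesgue_measure_itv/= !lte_fin ltr_pM2r ?invr_gt0// ltrD2r.
  case: ltP => xy; last by rewrite mule0.
  by rewrite -!EFinD -EFinM; congr EFin; rewrite gtr0_norm//; field; rewrite gt_eqF.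
have a3 : a < 0 by rewrite lt_neqAle a0.
rewrite !lebesgue_measure_itv/= !lte_fin ltr_nM2r ?invr_lt0// ltrD2r.
case: ltP => xy; last by rewrite mule0.
by rewrite -!EFinD -EFinM; congr EFin; rewrite ltr0_norm//; field; rewrite lt_eqF.
Qed.

Lemma ge0_integral_affine (R : realType) (a b : R) (G : R -> \bar R) : a != 0 ->
  measurable_fun [set: R] G -> (forall x, 0 <= G x)%E ->
  (\int[lebesgue_measure]_(x in [set: R]) G (a * x + b)%R =
   `|a|^-1%:E * \int[lebesgue_measure]_(x in [set: R]) G x)%E.
Proof.
move=> a0 mG G0.
have mf : measurable_fun [set: R] (fun x : R => a * x + b).
  by apply: measurable_funD => //; exact: measurable_funM.
pose phi : R -> measurableTypeR R := fun x => a * x + b.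
have a1 : 0 <= `|a| by [].
have -> : (\int[lebesgue_measure]_(x in [set: R]) G x =
  \int[mscale (NngNum a1) (pushforward (@lebesgue_measure R) phi)]_(x in [set: R]) G x)%E => //.
  by move=> m; apply: eq_measure_integral => //= A mA _; rewrite -(@pushforward_affine _ a b).
rewrite ge0_integral_mscale//= muleA -EFinM mulVf ?normr_eq0// mul1e.
by rewrite ge0_integral_pushforward.
Qed.

(** [area] is a bare set function; the measure and sigma-finiteness structures are attached to that
    name so that integration theorems apply to [\int[area]] directly. Squares of an exhaustion of
    the line exhaust the plane. *)
Section area_measure.
Context {R : realType}.
Let area0 : @area R set0 = 0%E. Proof. exact: measure0. Qed.
Let area_ge0 (A : set (R * R)) : (0 <= @area R A)%E. Proof. exact: measure_ge0. Qed.
Let area_sa : semi_sigma_additive (@area R : set (R * R)%type -> \bar R).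
Proof.
exact: (@measure_semi_sigma_additive _ _ _ (@lebesgue_measure R \x @lebesgue_measure R)%E). Qed.
HB.instance Definition _ := isMeasure.Build _ (R * R)%type R area area0 area_ge0 area_sa.
Let area_sf : sigma_finite [set: (R * R)] (@area R).
Proof.
have /sigma_finiteP[F [TF ndF Foo]] := sigma_finiteT (@lebesgue_measure R).
exists (fun n => F n `*` F n).
  rewrite -setXTT TF predeqE => -[x y]; split.
    move=> [/= [n _ Fnx] [k _ Fky]]; exists (maxn n k) => //; split.
    - by move: x Fnx; exact/subsetPset/ndF/leq_maxl.
    - by move: y Fky; exact/subsetPset/ndF/leq_maxr.
  by move=> [n _ []/= ? ?]; split; exists n.
move=> k; have [mF Fk] := Foo k; split; first exact: measurableX.
by rewrite /area product_measure1E// lte_mul_pinfty// ge0_fin_numE.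
Qed.
HB.instance Definition _ := @Measure_isSigmaFinite.Build _ (R * R)%type R area area_sf.
End area_measure.

(** The two integrals live on [R * R] and on [measurableTypeR R * measurableTypeR R], the same set
    reached through different types; pushing forward along the identity passes from one to the
    other. *)
Lemma area_prod (R : realType) (f : R * R -> \bar R) :
  measurable_fun [set: R * R] f -> (forall x, 0 <= f x)%E ->
  (\int[area]_(x in [set: R * R]) f x = \int[lebesgue_measure \x lebesgue_measure]_(x in setT) f x)%E.
Proof.
move=> mf f0.
pose phi (x : measurableTypeR R * measurableTypeR R) : R * R := x.
have mphi : measurable_fun setT phi by exact: (@measurable_id _ _ setT).

have := @ge0_integral_pushforward _ _ _ _ _ phi mphi (@lebesgue_measure R \x @lebesgue_measure R)%E setT f measurableT mf.
by rewrite preimage_setT => <-.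
Qed.
Lemma area_tonelli1 (R : realType) (f : R * R -> \bar R) :
  measurable_fun [set: R * R] f -> (forall x, 0 <= f x)%E ->
  (\int[area]_(x in [set: R * R]) f x = \int[lebesgue_measure]_x \int[lebesgue_measure]_y f (x, y))%E.
Proof. by move=> mf f0; rewrite area_prod// fubini_tonelli1. Qed.

Lemma area_tonelli2 (R : realType) (f : R * R -> \bar R) :
  measurable_fun [set: R * R] f -> (forall x, 0 <= f x)%E ->
  (\int[area]_(x in [set: R * R]) f x = \int[lebesgue_measure]_y \int[lebesgue_measure]_x f (x, y))%E.
Proof. by move=> mf f0; rewrite area_prod// fubini_tonelli2. Qed.

Lemma measurable_integral_snd (R : realType) (f : R * R -> \bar R) :
  measurable_fun [set: R * R] f -> (forall x, 0 <= f x)%E ->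
  measurable_fun [set: R] (fun x => \int[lebesgue_measure]_y f (x, y))%E.
Proof. by move=> mf f0; have := @measurable_fun_fubini_tonelli_F _ _ (measurableTypeR R) (measurableTypeR R) R (@lebesgue_measure R) f mf f0. Qed.

Lemma measurable_integral_fst (R : realType) (f : R * R -> \bar R) :
  measurable_fun [set: R * R] f -> (forall x, 0 <= f x)%E ->
  measurable_fun [set: R] (fun y => \int[lebesgue_measure]_x f (x, y))%E.
Proof. by move=> mf f0; have := @measurable_fun_fubini_tonelli_G _ _ (measurableTypeR R) (measurableTypeR R) R (@lebesgue_measure R) f mf f0. Qed.

(** Multiplication by a + ib is handled one coordinate at a time. For fixed y put X = a x - b y;
    then a y + b x = c y + (b / a) X with c = (a^2 + b^2) / a. Two affine substitutions, of slopes a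
    and c, suffice, and a c = a^2 + b^2. *)
Lemma ge0_integral_area_cmul0 (R : realType) (a b : R) (f : R * R -> \bar R) : a != 0 ->
  measurable_fun [set: R * R] f -> (forall x, 0 <= f x)%E ->
  (\int[area]_(x in [set: R * R]) f (a * x.1 - b * x.2, a * x.2 + b * x.1)%R =
   (a ^+ 2 + b ^+ 2)^-1%:E * \int[area]_(x in [set: R * R]) f x)%E.
Proof.
move=> a0 mf f0.
have ab0 : 0 < a ^+ 2 + b ^+ 2 by rewrite ltr_pwDl ?sqr_ge0// exprn_even_gt0.
have mf1 : measurable_fun [set: R * R]
    (fun x : R * R => f (a * x.1 - b * x.2, a * x.2 + b * x.1)%R).
  apply: (measurableT_comp mf); apply: measurable_fun_pair => /=.
    by apply: measurable_funB; apply: measurable_funM.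
  by apply: measurable_funD; apply: measurable_funM.
pose c := (a ^+ 2 + b ^+ 2) / a.
have c0 : c != 0 by rewrite mulf_neq0 ?invr_neq0// gt_eqF.
pose g (x : R * R) := f (x.1, c * x.2 + (b / a) * x.1)%R.
have mg : measurable_fun [set: R * R] g.
  apply: (measurableT_comp mf); apply: measurable_fun_pair => //=.
  by apply: measurable_funD; apply: measurable_funM.
rewrite area_tonelli2//=.
transitivity (\int[lebesgue_measure]_y (`|a|^-1%:E * \int[lebesgue_measure]_x g (x, y)))%E.
  apply: eq_integral => y _.
  rewrite -(@ge0_integral_affine _ a (- (b * y)) (fun x => g (x, y)))//.
  - apply: eq_integral => x _; rewrite /g /=; congr (f (_, _)).
    by rewrite /c; field.
  - exact: measurableT_comp.
  - by move=> x; exact: f0.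
rewrite ge0_integralZl//; [|by apply: measurable_integral_fst => // x; exact: f0|by move=> y _; apply: integral_ge0 => x _; exact: f0].
rewrite (_ : (\int[lebesgue_measure]_y _)%E = \int[lebesgue_measure]_x \int[lebesgue_measure]_y g (x, y))%E; last first.
  by rewrite -area_tonelli1 -?area_tonelli2//; move=> x; exact: f0.
rewrite area_tonelli1//.
under eq_integral => x _.
  rewrite /g /= (@ge0_integral_affine _ c (b / a * x) (fun y => f (x, y)))//; last first.
    exact: measurableT_comp.
  over.
rewrite ge0_integralZl//; [|exact: measurable_integral_snd|by move=> y _; apply: integral_ge0 => x _; exact: f0].
rewrite muleA -EFinM; congr (_%:E * _)%E.
by rewrite -invfM -normrM (_ : a * c = a ^+ 2 + b ^+ 2) ?gtr0_norm// /c; field.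
Qed.

Lemma measurable_cmul d (U : measurableType d) (R : realType) (v : R[i]) (G : R[i] -> U) :
  measurable_fun [set: R * R] (G \o toC) ->
  measurable_fun [set: R * R] ((fun z => G (v * z)) \o toC).
Proof.
move=> mG; case: v => a b.
have -> : (fun z => G ((a +i* b)%C * z)) \o toC =
  (G \o toC) \o (fun x : R * R => (a * x.1 - b * x.2, a * x.2 + b * x.1)) by [].
apply: (measurableT_comp mG); apply: measurable_fun_pair => /=.
  by apply: measurable_funB; apply: measurable_funM.
by apply: measurable_funD; apply: measurable_funM.
Qed.

Lemma ge0_integral_area_cmul (R : realType) (w : R[i]) (F : R[i] -> \bar R) : w != 0 ->
  measurable_fun [set: R * R] (F \o toC) -> (forall z, 0 <= F z)%E ->
  (\int[area]_(x in [set: R * R]) F (w * toC x)%R =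
   (csq w)^-1%:E * \int[area]_(x in [set: R * R]) F (toC x))%E.
Proof.
have main (v : R[i]) (G : R[i] -> \bar R) : complex.Re v != 0 ->
    measurable_fun [set: R * R] (G \o toC) -> (forall z, 0 <= G z)%E ->
    (\int[area]_(x in [set: R * R]) G (v * toC x)%R =
     (csq v)^-1%:E * \int[area]_(x in [set: R * R]) G (toC x))%E.
  case: v => a b /= a0 mG G0; rewrite /csq /= -ge0_integral_area_cmul0//.
move=> w0 mF F0; have [Rw0|] := eqVneq (complex.Re w) 0; last by move=> Rw0; apply: (main w F).
case: w w0 Rw0 => a b /= w0 a0; rewrite a0 in w0 *.
have b0 : b != 0 by apply: contra w0 => /eqP ->.
(* A purely imaginary factor offers no nonzero real part to divide by, so ib is split as (1 + i)(b/2
   + ib/2), where both factors have one. *)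
pose v : R[i] := Complex 1 1; pose u : R[i] := Complex (b / 2) (b / 2).
have -> : Complex 0 b = v * u.
  by apply/eqP; rewrite eq_complex /=; apply/andP; split; apply/eqP; field.
under eq_integral do rewrite -mulrA.
rewrite (main u (fun z => F (v * z))) //=; last 2 first.
- by rewrite mulf_neq0// invr_neq0.
- exact: measurable_cmul.
rewrite (main v F)//=.
rewrite muleA -EFinM; congr (_%:E * _)%E; rewrite /csq /=; field.
by rewrite subrr expr0n add0r -!mulr2n exprMn_n !mulrn_eq0 !expf_eq0 b0.
Qed.

Lemma aint_cmul (R : realType) (w : R[i]) (F : R[i] -> R) : w != 0 ->
  measurable_fun [set: R * R] (F \o toC) -> (forall z, 0 <= F z) ->
  (aint (fun z => F (w * z)%R) = (csq w)^-1%:E * aint F)%E.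
Proof.
move=> w0 mF F0; rewrite /aint (@ge0_integral_area_cmul _ w (EFin \o F))//.
exact/measurable_EFinP.
Qed.

Lemma integral_area_cmul (R : realType) (w : R[i]) (F : R[i] -> R) : w != 0 ->
  area.-integrable [set: R * R] (EFin \o (F \o toC)) -> 
  (aint (fun z => F (w * z)%R) = (csq w)^-1%:E * aint F)%E.
Proof.
move=> w0 iF; rewrite /aint.
have mF : measurable_fun [set: R * R] (EFin \o F \o toC) by exact: measurable_int iF.
rewrite integralE [in RHS]integralE muleBr//; last exact: integrable_add_def.
congr (_ - _)%E.
  have /= := ge0_integral_area_cmul (F := fun z => maxe (F z)%:E 0%E) w0.
  have -> : (fun z => maxe (F z)%:E 0%E) \o toC = ((EFin \o F \o toC)^\+)%E.
    by apply/funext => x; rewrite funeposE.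
  move=> /(_ (measurable_funepos mF)) H.
  under eq_integral do rewrite funeposE; under [in RHS]eq_integral do rewrite funeposE.
  by apply: H => z; rewrite le_max lexx orbT.
have /= := ge0_integral_area_cmul (F := fun z => maxe (- (F z)%:E)%E 0%E) w0.
have -> : (fun z => maxe (- (F z)%:E)%E 0%E) \o toC = ((EFin \o F \o toC)^\-)%E.
  by apply/funext => x; rewrite funenegE.
move=> /(_ (measurable_funeneg mF)) H.
under eq_integral do rewrite funenegE; under [in RHS]eq_integral do rewrite funenegE.
by apply: H => z; rewrite le_max lexx orbT.
Qed.

(** * Modulus and entire functions *)

Lemma csqE (R : realType) (z : R[i]) : csq z = cabs z ^+ 2.
Proof. by rewrite /cabs sqr_sqrtr// addr_ge0 ?sqr_ge0. Qed.

Lemma cabs_normc (R : realType) (z : R[i]) : cabs z = ComplexField.Normc.normc z.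
Proof. by case: z. Qed.

Lemma cabs_ge0 (R : realType) (z : R[i]) : 0 <= cabs z.
Proof. exact: sqrtr_ge0. Qed.

Lemma csq_ge0 (R : realType) (z : R[i]) : 0 <= csq z.
Proof. by rewrite csqE exprn_ge0 ?cabs_ge0. Qed.

Lemma cabsM (R : realType) (x y : R[i]) : cabs (x * y) = cabs x * cabs y.
Proof. by rewrite !cabs_normc ComplexField.Normc.normcM. Qed.

Lemma csqM (R : realType) (x y : R[i]) : csq (x * y) = csq x * csq y.
Proof. by rewrite !csqE cabsM exprMn. Qed.

Lemma cabsD (R : realType) (x y : R[i]) : cabs (x + y) <= cabs x + cabs y.
Proof. by rewrite !cabs_normc le_normcD. Qed.

Lemma cabsN (R : realType) (x : R[i]) : cabs (- x) = cabs x.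
Proof. by rewrite !cabs_normc normcN. Qed.

Lemma cabs0 (R : realType) : cabs (0 : R[i]) = 0.
Proof. by rewrite cabs_normc ComplexField.Normc.normc0. Qed.

Lemma cabs1 (R : realType) : cabs (1 : R[i]) = 1.
Proof. by rewrite cabs_normc ComplexField.Normc.normc1. Qed.

Lemma cabs_eq0 (R : realType) (x : R[i]) : (cabs x == 0) = (x == 0).
Proof.
apply/eqP/eqP => [|->]; last exact: cabs0.
by rewrite cabs_normc => /ComplexField.Normc.eq0_normc.
Qed.

Lemma cabs_gt0 (R : realType) (x : R[i]) : (0 < cabs x) = (x != 0).
Proof. by rewrite lt_neqAle cabs_ge0 andbT eq_sym cabs_eq0. Qed.

Lemma cabsX (R : realType) (x : R[i]) n : cabs (x ^+ n) = cabs x ^+ n.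
Proof. by elim: n => [|n IH]; rewrite ?expr0 ?cabs1// !exprS cabsM IH. Qed.

Lemma cabs_real (R : realType) (x : R) : cabs (RtoC x) = `|x|.
Proof. by rewrite /cabs /csq /= expr0n addr0 sqrtr_sqr. Qed.

Lemma cabs_conj (R : realType) (x : R[i]) : cabs (cconj x) = cabs x.
Proof. by rewrite /cabs /csq /= sqrrN. Qed.

Lemma Re_le_cabs (R : realType) (z : R[i]) : `|complex.Re z| <= cabs z.
Proof. by rewrite -sqrtr_sqr ler_wsqrtr// lerDl sqr_ge0. Qed.

Lemma Im_le_cabs (R : realType) (z : R[i]) : `|complex.Im z| <= cabs z.
Proof. by rewrite -sqrtr_sqr ler_wsqrtr// lerDr sqr_ge0. Qed.

Lemma cdiff_cont (R : realType) (f : R[i] -> R[i]) (z : R[i]) : cdiff f z ->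
  forall e : R, 0 < e -> exists2 d : R, 0 < d &
    forall h, cabs h < d -> cabs (f (z + h) - f z) < e.
Proof.
move=> [l fl] e e0; have [d d0 fd] := fl 1 ltr01.
have c0 : 0 < 1 + cabs l by rewrite ltr_pwDl// cabs_ge0.
exists (Num.min d (e / (1 + cabs l))); first by rewrite lt_min d0 divr_gt0.
move=> h; rewrite lt_min => /andP[hd he].
have [->|h0] := eqVneq h 0; first by rewrite addr0 subrr cabs0.
have -> : f (z + h) - f z = (((f (z + h) - f z) / h - l) + l) * h.
  by rewrite subrK divfK.
rewrite cabsM (@le_lt_trans _ _ ((1 + cabs l) * cabs h))//.
  rewrite ler_wpM2r ?cabs_ge0// (le_trans (cabsD _ _))// lerD2r ltW//; exact: fd.
by rewrite mulrC -ltr_pdivlMr.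
Qed.

Lemma exists_invS_lt (R : realType) (d : R) : 0 < d -> exists m : nat, m.+1%:R^-1 < d.
Proof.
move=> d0; exists (Num.bound d^-1).
by rewrite invf_plt ?posrE// (lt_trans (archi_boundP _)) ?ltr_nat// invr_ge0 ltW.
Qed.

(** A superlevel set is open, hence the union of the countably many boxes with rational centre and
    half-width 1 / (m + 1) that it contains. *)
Lemma continuous2_measurable (R : realType) (h : R * R -> R) :
  (forall x (e : R), 0 < e -> exists2 d : R, 0 < d &
    forall y : R * R, `|y.1 - x.1| < d -> `|y.2 - x.2| < d -> `|h y - h x| < e) ->
  measurable_fun [set: R * R] h.
Proof.
move=> ch; apply: (measurability (@RGenOInfty.G R)).
  exact: RGenOInfty.measurableE.
move=> _ [_] [r] -> <-.
pose box (k : rat * rat * nat) : set (R * R) :=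
  `](ratr k.1.1 - k.2.+1%:R^-1), (ratr k.1.1 + k.2.+1%:R^-1)[%classic `*`
  `](ratr k.1.2 - k.2.+1%:R^-1), (ratr k.1.2 + k.2.+1%:R^-1)[%classic.
pose P (k : rat * rat * nat) := `[< box k `<=` h @^-1` `]r, +oo[%classic >].
have -> : [set: R * R] `&` h @^-1` `]r, +oo[ = \bigcup_(k in [set k | P k]) box k.
  rewrite setTI; apply/seteqP; split => [x /=|x [k /asboolP Pk xk]]; last exact: Pk.
  rewrite in_itv/= andbT => rx.
  have [d d0 hd] := ch x (h x - r) (ltac:(by rewrite subr_gt0)).
  have [m md] : exists m : nat, m.+1%:R^-1 < d / 2 :> R by apply: exists_invS_lt; rewrite divr_gt0.
  have m0 : 0 < m.+1%:R^-1 :> R by rewrite invr_gt0.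
  have [q1 /itvP q1x] := @rat_in_itvoo R (x.1 - m.+1%:R^-1) (x.1 + m.+1%:R^-1) (ltac:(by rewrite ltrD2l gtrN)).
  have [q2 /itvP q2x] := @rat_in_itvoo R (x.2 - m.+1%:R^-1) (x.2 + m.+1%:R^-1) (ltac:(by rewrite ltrD2l gtrN)).
  have [l1 u1] : x.1 - m.+1%:R^-1 < ratr q1 /\ ratr q1 < x.1 + m.+1%:R^-1 by rewrite !q1x.
  have [l2 u2] : x.2 - m.+1%:R^-1 < ratr q2 /\ ratr q2 < x.2 + m.+1%:R^-1 by rewrite !q2x.
  exists (q1, q2, m); rewrite /P /box /=; move: (m.+1%:R^-1) md m0 l1 l2 u1 u2 => i md i0 l1 l2 u1 u2.
    apply/asboolP => y [] /=; rewrite !in_itv/= andbT => /andP[y1 y1'] /andP[y2 y2'].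
    have Y1 : `|y.1 - x.1| < d by rewrite ltr_norml; apply/andP; split; lra.
    have Y2 : `|y.2 - x.2| < d by rewrite ltr_norml; apply/andP; split; lra.
    by have := hd y Y1 Y2; rewrite ltr_norml => /andP[]; lra.
  by split; rewrite /= in_itv/=; apply/andP; split; lra.
rewrite bigcup_mkcond; apply: countable_bigcupT_measurable; first exact: countableP.
move=> k; case: ifP => _ //; apply: measurableX; exact: measurable_itv.
Qed.

Lemma measurable_entire (R : realType) (g : R[i] -> R[i]) : entire g ->
  measurable_fun [set: R * R] ((fun z => complex.Re (g z)) \o toC) /\
  measurable_fun [set: R * R] ((fun z => complex.Im (g z)) \o toC).
Proof.
move=> eg.
have key : forall x (e : R), 0 < e -> exists2 d : R, 0 < d &
    forall y : R * R, `|y.1 - x.1| < d -> `|y.2 - x.2| < d -> cabs (g (toC y) - g (toC x)) < e.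
  move=> x e e0; have [d d0 gd] := cdiff_cont (eg (toC x)) e0.
  exists (d / 2); first by rewrite divr_gt0.
  move=> y y1 y2; have -> : toC y = toC x + (toC y - toC x) by rewrite addrC subrK.
  apply: gd; rewrite (@le_lt_trans _ _ (`|y.1 - x.1| + `|y.2 - x.2|))//; last by lra.
  rewrite -(@ler_pXn2r _ 2) ?nnegrE ?cabs_ge0 ?addr_ge0// -csqE /csq /= [leRHS]sqrrD !real_normK ?num_real//.
  by rewrite addrAC lerDl mulrn_wge0// mulr_ge0.
split; apply: continuous2_measurable => x e e0; have [d d0 gd] := key x e e0.
- exists d => // y y1 y2; apply: le_lt_trans (gd y y1 y2).
  apply: le_trans (Re_le_cabs _); rewrite /=.
  by case: (g (toC y)) (g (toC x)) => [a b] [c e'].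
- exists d => // y y1 y2; apply: le_lt_trans (gd y y1 y2).
  apply: le_trans (Im_le_cabs _); rewrite /=.
  by case: (g (toC y)) (g (toC x)) => [a b] [c e'].
Qed.

Lemma entire_cst (R : realType) (c : R[i]) : entire (fun=> c).
Proof.
move=> z; exists 0 => e e0; exists 1 => // h _ _.
by rewrite subrr mul0r subrr cabs0.
Qed.

Lemma entire_id (R : realType) : entire (fun z : R[i] => z).
Proof.
move=> z; exists 1 => e e0; exists 1 => // h h0 _.
by rewrite [z + h]addrC addrK divff// subrr cabs0.
Qed.

Lemma entireD (R : realType) (f g : R[i] -> R[i]) : entire f -> entire g ->
  entire (fun z => f z + g z).
Proof.
move=> ef eg z; have [l fl] := ef z; have [m gm] := eg z; exists (l + m) => e e0.
have [d d0 fd] := fl (e / 2) (ltac:(by rewrite divr_gt0)).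
have [d' d0' gd] := gm (e / 2) (ltac:(by rewrite divr_gt0)).
exists (Num.min d d'); first by rewrite lt_min d0.
move=> h h0; rewrite lt_min => /andP[hd hd'].
have -> : (f (z + h) + g (z + h) - (f z + g z)) / h - (l + m) =
  ((f (z + h) - f z) / h - l) + ((g (z + h) - g z) / h - m) by field.
rewrite (le_lt_trans (cabsD _ _))// (splitr e) ltrD//; [exact: fd|exact: gd].
Qed.

Lemma entireM (R : realType) (f g : R[i] -> R[i]) : entire f -> entire g ->
  entire (fun z => f z * g z).
Proof.
move=> ef eg z; have [l fl] := ef z; have [m gm] := eg z; exists (l * g z + f z * m) => e e0.
pose A := cabs l + 1; pose B := cabs (g z) + cabs (f z) + 1.
have A0 : 0 < A by rewrite ltr_wpDl ?cabs_ge0.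
have B0 : 0 < B by rewrite ltr_wpDl ?addr_ge0 ?cabs_ge0.
(* The bound 1 keeps |X + l| below [A]; the other bounds give e / 3 for each of the three terms into
   which the quotient of the product is split. *)
have [d d0 fd] := fl (Num.min 1 (e / 3 / B)) (ltac:(by rewrite lt_min ltr01 !divr_gt0)).
have [d' d0' gd] := gm (e / 3 / B) (ltac:(by rewrite !divr_gt0)).
have eA : 0 < e / 3 / A by rewrite !divr_gt0.
have [d'' d0'' gc] := cdiff_cont (eg z) eA.
exists (Num.min d (Num.min d' d'')); first by rewrite !lt_min d0 d0'.
move=> h h0; rewrite !lt_min => /and3P[hd hd' hd''].
pose X := (f (z + h) - f z) / h - l; pose Y := (g (z + h) - g z) / h - m.
have -> : (f (z + h) * g (z + h) - f z * g z) / h - (l * g z + f z * m) =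
  X * g z + (X + l) * (g (z + h) - g z) + f z * Y by rewrite /X /Y; field.
have := fd h h0 hd; rewrite -/X lt_min => /andP[X1 X2].
have Y1 : cabs Y < e / 3 / B by exact: gd.
have G1 := gc h hd''.
have X3 : cabs (X + l) <= A by rewrite (le_trans (cabsD _ _))// addrC lerD2l ltW.
rewrite (le_lt_trans (cabsD _ _))// (le_lt_trans (lerD (cabsD _ _) (lexx _)))// !cabsM.
have gB : cabs (g z) <= B by rewrite /B -addrA lerDl addr_ge0 ?cabs_ge0.
have fB : cabs (f z) <= B by rewrite /B addrAC lerDr addr_ge0 ?cabs_ge0.
have e1 : cabs X * cabs (g z) <= e / 3.
  by rewrite -[leRHS](@divfK _ B) ?gt_eqF// ler_pM ?cabs_ge0// ltW.
have e2 : cabs (f z) * cabs Y <= e / 3.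
  by rewrite mulrC -[leRHS](@divfK _ B) ?gt_eqF// ler_pM ?cabs_ge0// ltW.
have e3 : cabs (X + l) * cabs (g (z + h) - g z) < e / 3.
  rewrite -[ltRHS](@divfK _ A) ?gt_eqF// mulrC.
  by rewrite (@le_lt_trans _ _ (cabs (g (z + h) - g z) * A)) ?ler_wpM2l ?cabs_ge0// ltr_pM2r.
by move: e1 e2 e3; lra.
Qed.

Lemma entireZ (R : realType) (c : R[i]) (f : R[i] -> R[i]) : entire f -> entire (fun z => c * f z).
Proof. by move=> ef; apply: entireM => //; exact: entire_cst. Qed.

Lemma entireX (R : realType) n : entire (fun z : R[i] => z ^+ n).
Proof.
elim: n => [|n IH]; first exact: entire_cst.
rewrite (_ : (fun z => _) = (fun z : R[i] => z * z ^+ n)).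
  by apply: entireM => //; exact: entire_id.
by apply/funext => z; rewrite exprS.
Qed.

Lemma entire_poly (R : realType) (P : {poly R[i]}) : entire (horner P).
Proof.
elim/poly_ind: P => [|P c IH].
  by rewrite (_ : horner 0 = fun=> 0); [exact: entire_cst|apply/funext => z; rewrite horner0].
rewrite (_ : horner _ = fun z => P.[z] * z + c).
  by apply: entireD; [apply: entireM => //; exact: entire_id|exact: entire_cst].
by apply/funext => z; rewrite hornerMXaddC.
Qed.

Lemma entire_dil (R : realType) (w : R[i]) (f : R[i] -> R[i]) : w != 0 -> entire f ->
  entire (fun z => f (w * z)).
Proof.
move=> w0 ef z; have [l fl] := ef (w * z); exists (w * l) => e e0.
have w1 : 0 < cabs w by rewrite cabs_gt0.
have [d d0 fd] := fl (e / cabs w) (ltac:(by rewrite divr_gt0)).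
exists (d / cabs w); first by rewrite divr_gt0.
move=> h h0 hd.
have -> : (f (w * (z + h)) - f (w * z)) / h - w * l =
   w * ((f (w * z + w * h) - f (w * z)) / (w * h) - l).
  by rewrite mulrDr; field; rewrite ?w0 ?h0.
rewrite cabsM mulrC -ltr_pdivlMr//; apply: fd; first by rewrite mulf_neq0.
by rewrite cabsM mulrC -ltr_pdivlMr.
Qed.

(** * Weighted integrals *)

Definition measC (R : realType) (g : R[i] -> R[i]) : Prop :=
  measurable_fun [set: R * R] (fun x => complex.Re (g (toC x))) /\
  measurable_fun [set: R * R] (fun x => complex.Im (g (toC x))).

Definition measR (R : realType) (W : R[i] -> R) : Prop :=
  measurable_fun [set: R * R] (fun x => W (toC x)).

Lemma measC_entire (R : realType) (g : R[i] -> R[i]) : entire g -> measC g.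
Proof. exact: measurable_entire. Qed.

Lemma measCD (R : realType) (f g : R[i] -> R[i]) : measC f -> measC g -> measC (fun z => f z + g z).
Proof.
move=> [f1 f2] [g1 g2]; split.
  rewrite (_ : (fun x => _) = (fun x => complex.Re (f (toC x)) + complex.Re (g (toC x)))).
    exact: measurable_funD.
  by apply/funext => x; case: (f _) (g _) => [a b] [c d].
rewrite (_ : (fun x => _) = (fun x => complex.Im (f (toC x)) + complex.Im (g (toC x)))).
  exact: measurable_funD.
by apply/funext => x; case: (f _) (g _) => [a b] [c d].
Qed.

Lemma measCM (R : realType) (f g : R[i] -> R[i]) : measC f -> measC g -> measC (fun z => f z * g z).
Proof.
move=> [f1 f2] [g1 g2]; split.
  rewrite (_ : (fun x => _) = (fun x => complex.Re (f (toC x)) * complex.Re (g (toC x)) -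
     complex.Im (f (toC x)) * complex.Im (g (toC x)))).
    by apply: measurable_funB; exact: measurable_funM.
  by apply/funext => x; case: (f _) (g _) => [a b] [c d].
rewrite (_ : (fun x => _) = (fun x => complex.Re (f (toC x)) * complex.Im (g (toC x)) +
     complex.Im (f (toC x)) * complex.Re (g (toC x)))).
  by apply: measurable_funD; exact: measurable_funM.
by apply/funext => x; case: (f _) (g _) => [a b] [c d].
Qed.

Lemma measC_cst (R : realType) (c : R[i]) : measC (fun=> c).
Proof. by split; exact: measurable_cst. Qed.

Lemma measCB (R : realType) (f g : R[i] -> R[i]) : measC f -> measC g -> measC (fun z => f z - g z).
Proof.
move=> mf mg; rewrite (_ : (fun z => _) = (fun z => f z + (-1) * g z)).
  by apply: measCD => //; apply: measCM => //; exact: measC_cst.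
by apply/funext => z; rewrite mulN1r.
Qed.

Lemma measC_conj (R : realType) (f : R[i] -> R[i]) : measC f -> measC (fun z => cconj (f z)).
Proof. by move=> [f1 f2]; split => //=; exact: measurable_funN. Qed.

Lemma measC_real (R : realType) (W : R[i] -> R) : measR W -> measC (fun z => RtoC (W z)).
Proof. by move=> mW; split => //=; exact: measurable_cst. Qed.

Lemma measC_cmul (R : realType) (w : R[i]) (f : R[i] -> R[i]) : measC f -> measC (fun z => f (w * z)).
Proof.
move=> [f1 f2]; split.
  exact: (@measurable_cmul _ _ R w (fun z => complex.Re (f z)) f1).
exact: (@measurable_cmul _ _ R w (fun z => complex.Im (f z)) f2).
Qed.

Lemma measR_cmul (R : realType) (w : R[i]) (W : R[i] -> R) : measR W -> measR (fun z => W (w * z)).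
Proof. by move=> mW; exact: (@measurable_cmul _ _ R w W mW). Qed.

Lemma measR_csq (R : realType) (g : R[i] -> R[i]) : measC g -> measR (fun z => csq (g z)).
Proof. by move=> [g1 g2]; apply: measurable_funD; exact: measurable_funX. Qed.

Lemma measR_cabs (R : realType) (g : R[i] -> R[i]) : measC g -> measR (fun z => cabs (g z)).
Proof.
move=> /measR_csq; apply: measurableT_comp.
by apply: nondecreasing_measurable => // x y; exact: ler_wsqrtr.
Qed.

Lemma measR_powR (R : realType) (r : R) (W : R[i] -> R) : measR W -> measR (fun z => W z `^ r).
Proof. by move=> mW; exact: (measurableT_comp (measurable_powR r) mW). Qed.

Lemma measRM (R : realType) (V W : R[i] -> R) : measR V -> measR W -> measR (fun z => V z * W z).
Proof. exact: measurable_funM. Qed.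

Lemma measRD (R : realType) (V W : R[i] -> R) : measR V -> measR W -> measR (fun z => V z + W z).
Proof. exact: measurable_funD. Qed.

Lemma measRB (R : realType) (V W : R[i] -> R) : measR V -> measR W -> measR (fun z => V z - W z).
Proof. exact: measurable_funB. Qed.

Lemma measR_pint (R : realType) (r : R) (W : R[i] -> R) (g : R[i] -> R[i]) : measC g -> measR W ->
  measR (fun z => cabs (g z) `^ r * W z).
Proof. by move=> mg mW; apply: measRM => //; apply: measR_powR; exact: measR_cabs. Qed.

Lemma aint_ge0 (R : realType) (F : R[i] -> R) : (forall z, 0 <= F z) -> (0 <= aint F)%E.
Proof. by move=> F0; apply: integral_ge0 => x _; rewrite lee_fin. Qed.

Lemma le_aint (R : realType) (F G : R[i] -> R) : measR F -> measR G -> (forall z, 0 <= F z) ->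
  (forall z, F z <= G z) -> (aint F <= aint G)%E.
Proof.
move=> mF mG F0 FG; apply: ge0_le_integral => //.
- by move=> x _; rewrite lee_fin.
- exact/measurable_EFinP.
- exact/measurable_EFinP.
- by move=> x _; rewrite lee_fin.
Qed.

Lemma eq_aint (R : realType) (F G : R[i] -> R) : (forall z, F z = G z) -> aint F = aint G.
Proof. by move=> FG; apply: eq_integral => x _; rewrite FG. Qed.

Lemma aintZ (R : realType) (c : R) (F : R[i] -> R) : 0 <= c -> measR F -> (forall z, 0 <= F z) ->
  (aint (fun z => c * F z)%R = c%:E * aint F)%E.
Proof.
move=> c0 mF F0; rewrite /aint -ge0_integralZl//.
- exact/measurable_EFinP.
- by move=> x _; rewrite lee_fin.
Qed.

Lemma aintD (R : realType) (F G : R[i] -> R) : measR F -> measR G -> (forall z, 0 <= F z) ->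
  (forall z, 0 <= G z) -> (aint (fun z => F z + G z)%R = aint F + aint G)%E.
Proof.
move=> mF mG F0 G0; rewrite /aint -ge0_integralD//.
- by move=> x _; rewrite lee_fin.
- exact/measurable_EFinP.
- by move=> x _; rewrite lee_fin.
- exact/measurable_EFinP.
Qed.

Lemma aint_sum (R : realType) (I : finType) (F : I -> R[i] -> R) :
  (forall i, measR (F i)) -> (forall i z, 0 <= F i z) ->
  (aint (fun z => \sum_i F i z)%R = \sum_i aint (F i))%E.
Proof.
move=> mF F0; rewrite /aint -ge0_integral_sum//.
- by apply: eq_integral => x _; rewrite sumEFin.
- by move=> i; apply/measurable_EFinP; exact: mF.
- by move=> i x _; rewrite lee_fin.
Qed.

Lemma aint_fatou (R : realType) (F : nat -> R[i] -> R) (G : R[i] -> R) (C : \bar R) :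
  (forall n, measR (F n)) -> (forall n z, 0 <= F n z) ->
  (forall z, F ^~ z @ \oo --> G z) -> (forall n, aint (F n) <= C)%E ->
  (aint G <= C)%E.
Proof.
move=> mF F0 FG FC.
have := @fatou _ _ _ (@area R) setT measurableT (fun n x => (F n (toC x))%:E)
  (fun n => ltac:(apply/measurable_EFinP; exact: mF)) (fun n x _ => ltac:(by rewrite lee_fin)).
have -> : (\int[area]_(x in [set: R * R]) limn_einf (fun n => (F n (toC x))%:E) = aint G)%E.
  apply: eq_integral => x _.
  have h : (F n (toC x))%:E @[n --> \oo] --> (G (toC x))%:E.
    by apply/fine_cvgP; split; [exact: nearW|exact: FG].
  by rewrite (cvg_limn_einf_sup h).1.
move=> /le_trans; apply; rewrite limn_einf_lim; apply: lime_le.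
  exact: is_cvg_einfs.
apply: nearW => n; apply: le_trans (FC n); apply: ereal_inf_lbound; exists n => //=.
Qed.

Lemma cabs_pow_ge0 (R : realType) (r : R) (g : R[i] -> R[i]) (W : R[i] -> R) :
  (forall z, 0 <= W z) -> forall z, 0 <= cabs (g z) `^ r * W z.
Proof. by move=> W0 z; rewrite mulr_ge0// powR_ge0. Qed.

Lemma pint_ge0 (R : realType) (r : R) (W : R[i] -> R) g : (forall z, 0 <= W z) ->
  (0 <= pint r W g)%E.
Proof. by move=> W0; apply: aint_ge0; exact: cabs_pow_ge0. Qed.

Lemma le_pint (R : realType) (r : R) (V W : R[i] -> R) g : measC g -> measR V -> measR W ->
  (forall z, 0 <= V z) -> (forall z, V z <= W z) -> (pint r V g <= pint r W g)%E.
Proof.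
move=> mg mV mW V0 VW; apply: le_aint; [exact: measR_pint|exact: measR_pint|exact: cabs_pow_ge0|].
by move=> z; rewrite ler_wpM2l// powR_ge0.
Qed.

(** Unlike [Anorm], it keeps the value +oo; there [fine] turns a divergent integral into 0. *)
Definition wnorm (R : realType) (r : R) (W : R[i] -> R) (g : R[i] -> R[i]) : \bar R :=
  poweR (pint r W g) r^-1.

(** The weight is absorbed into the function as the factor W^(1/r), so that Minkowski's and
    Hoelder's inequalities for plain area measure become weighted ones. *)
Lemma wnorm_Lnorm (R : realType) (r : R) (W : R[i] -> R) g : 0 < r -> (forall z, 0 <= W z) ->
  wnorm r W g = Lnorm area r%:E (EFin \o (fun x => cabs (g (toC x)) * W (toC x) `^ r^-1)).
Proof.
move=> r0 W0; rewrite unlock /wnorm /pint /aint; congr poweR.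
apply: eq_integral => x _ /=; rewrite ger0_norm ?mulr_ge0 ?cabs_ge0 ?powR_ge0//.
by rewrite powRM ?cabs_ge0 ?powR_ge0// -powRrM mulVf ?gt_eqF// powRr1.
Qed.

Lemma wnormD (R : realType) (r : R) (W : R[i] -> R) f g : 1 <= r -> (forall z, 0 <= W z) ->
  measC f -> measC g -> measR W ->
  (wnorm r W (fun z => f z + g z)%R <= wnorm r W f + wnorm r W g)%E.
Proof.
move=> r1 W0 mf mg mW; have r0 : 0 < r by exact: lt_le_trans r1.
have mWr : measR (fun z => W z `^ r^-1) by exact: measR_powR.
rewrite [X in (_ <= X + _)%E]wnorm_Lnorm// [X in (_ <= _ + X)%E]wnorm_Lnorm//.
have mF : measurable_fun [set: R * R] (fun x => cabs (f (toC x)) * W (toC x) `^ r^-1).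
  exact: (measRM (measR_cabs mf) mWr).
have mG : measurable_fun [set: R * R] (fun x => cabs (g (toC x)) * W (toC x) `^ r^-1).
  exact: (measRM (measR_cabs mg) mWr).
apply: le_trans (@minkowski_EFin _ _ _ (@area R) _ _ r mF mG r1).
rewrite unlock /=.
have -> : (\int[area]_x `|(cabs (f (toC x)) * W (toC x) `^ r^-1 +
    cabs (g (toC x)) * W (toC x) `^ r^-1)%:E| `^ r =
    aint (fun z => (cabs (f z) + cabs (g z)) `^ r * W z)%R)%E.
  apply: eq_integral => x _ /=; rewrite -mulrDl ger0_norm; last first.
    by rewrite mulr_ge0 ?powR_ge0 ?addr_ge0 ?cabs_ge0.
  by rewrite powRM ?powR_ge0 ?addr_ge0 ?cabs_ge0// -powRrM mulVf ?gt_eqF// powRr1.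
have H0 z : 0 <= (cabs (f z) + cabs (g z)) `^ r * W z by rewrite mulr_ge0// powR_ge0.
apply: gt0_ler_poweR.
- by rewrite invr_ge0 ltW.
- by rewrite in_itv/= leey andbT pint_ge0.
- by rewrite in_itv/= leey andbT aint_ge0.
apply: le_aint.
- exact: (measR_pint r (measCD mf mg) mW).
- exact: (measRM (measR_powR r (measRD (measR_cabs mf) (measR_cabs mg))) mW).
- exact: cabs_pow_ge0.
move=> z; rewrite ler_wpM2r// ge0_ler_powR// ?nnegrE ?addr_ge0 ?cabs_ge0//; first exact: ltW.
exact: cabsD.
Qed.

Lemma aint_hoelder (R : realType) (p q : R) (W : R[i] -> R) f g : 0 < p -> 0 < q ->
  p^-1 + q^-1 = 1 -> (forall z, 0 <= W z) -> measC f -> measC g -> measR W ->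
  (aint (fun z => cabs (f z) * cabs (g z) * W z)%R <= wnorm p W f * wnorm q W g)%E.
Proof.
move=> p0 q0 pq W0 mf mg mW.
rewrite !wnorm_Lnorm//; 
have mF : measurable_fun [set: R * R] (fun x => cabs (f (toC x)) * W (toC x) `^ p^-1).
  exact: (measRM (measR_cabs mf) (measR_powR _ mW)).
have mG : measurable_fun [set: R * R] (fun x => cabs (g (toC x)) * W (toC x) `^ q^-1).
  exact: (measRM (measR_cabs mg) (measR_powR _ mW)).
apply: le_trans (@hoelder _ _ _ (@area R) _ _ p q mF mG p0 q0 pq).
rewrite Lnorm1 le_eqVlt; apply/orP; left; apply/eqP; apply: eq_integral => x _ /=; congr EFin.
rewrite ger0_norm; last by rewrite !mulr_ge0 ?cabs_ge0 ?powR_ge0.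
rewrite mulrACA -powRD; last by rewrite pq oner_eq0.
by rewrite pq powRr1.
Qed.

(** * Dilations of polynomials as averages of rotations *)

(** This is Young's inequality for the product of x and 1, with conjugate exponents r and r / (r -
    1). *)
Lemma powR_tangent (R : realType) (x r : R) : 1 < r -> 0 <= x -> 1 + r * (x - 1) <= x `^ r.
Proof.
move=> r1 x0; have r0 : 0 < r by exact: lt_trans r1.
have q0 : 0 < r / (r - 1) by rewrite divr_gt0// subr_gt0.
have rr : r != 0 by rewrite gt_eqF.
have rr1 : r - 1 != 0 by rewrite subr_eq0 gt_eqF.
have rq : r^-1 + (r / (r - 1))^-1 = 1 by field; rewrite rr rr1.
have := conjugate_powR x0 (@ler01 R) r0 q0 rq.
rewrite mulr1 powR1 mul1r (_ : (r / (r - 1))^-1 = 1 - r^-1); last by field; rewrite ?rr ?rr1.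
move: (x `^ r) => y /(ler_wpM2l (ltW r0)).
rewrite (_ : r * (y / r + (1 - r^-1)) = y + r - 1); last by field.
by move=> h; rewrite mulrBr mulr1; lra.
Qed.

(** The tangent-line bound at the mean a is averaged with the weights; the linear terms cancel. The
    mean 0 is treated apart because the argument divides by a. *)
Lemma jensen_powR (R : realType) (I : finType) (w x : I -> R) (r : R) : 1 < r ->
  (forall i, 0 <= w i) -> \sum_i w i = 1 -> (forall i, 0 <= x i) ->
  (\sum_i w i * x i) `^ r <= \sum_i w i * x i `^ r.
Proof.
move=> r1 w0 w1 x0; set a := \sum_i w i * x i.
have r0 : 0 < r by exact: lt_trans r1.
have a0 : 0 <= a by apply: sumr_ge0 => i _; rewrite mulr_ge0.
have [->|aN0] := eqVneq a 0.
  by rewrite powR0 ?gt_eqF// sumr_ge0// => i _; rewrite mulr_ge0// powR_ge0.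
have a1 : 0 < a by rewrite lt_neqAle eq_sym aN0.
have -> : a `^ r = \sum_i w i * (a `^ r * (1 + r * (x i / a - 1))).
  under eq_bigr => i _.
    rewrite (_ : _ * _ = a `^ r * (1 - r) * w i + a `^ r * r / a * (w i * x i)); last by field.
    over.
  rewrite big_split/= -!mulr_sumr w1 -/a; field.
  exact: aN0.
apply: ler_sum => i _; rewrite ler_wpM2l//.
have -> : x i `^ r = a `^ r * (x i / a) `^ r.
  by rewrite -powRM ?divr_ge0// mulrC divfK.
by rewrite ler_wpM2l ?powR_ge0// powR_tangent// divr_ge0.
Qed.

Definition expi (R : realType) (x : R) : R[i] := Complex (cos x) (sin x).

Lemma expi_csq (R : realType) (x : R) : csq (expi x) = 1.
Proof. by rewrite /csq /= cos2Dsin2. Qed.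

Lemma expi_cabs (R : realType) (x : R) : cabs (expi x) = 1.
Proof. by rewrite /cabs expi_csq sqrtr1. Qed.

Lemma expi_neq0 (R : realType) (x : R) : expi x != 0.
Proof. by rewrite -cabs_gt0 expi_cabs. Qed.

Lemma expiD (R : realType) (x y : R) : expi (x + y) = expi x * expi y.
Proof.
by apply/eqP; rewrite eq_complex /= cosD sinD eqxx /= [cos x * sin y + _]addrC.
Qed.

Lemma expi0 (R : realType) : expi (0 : R) = 1.
Proof. by rewrite /expi cos0 sin0. Qed.

Lemma expiX (R : realType) (x : R) n : expi x ^+ n = expi (x * n%:R).
Proof.
elim: n => [|n IH]; first by rewrite mulr0 expi0.
by rewrite exprS IH -expiD -[in RHS]natr1 mulrDr mulr1 addrC.
Qed.

Lemma expi_pi (R : realType) : expi (pi : R) = -1.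
Proof. by rewrite /expi cospi sinpi; apply/eqP; rewrite eq_complex /= oppr0 !eqxx. Qed.

Lemma expi_2pi (R : realType) : expi (pi *+ 2 : R) = 1.
Proof. by rewrite mulr2n expiD expi_pi mulrNN mulr1. Qed.

Lemma expi_neq1 (R : realType) (x : R) : 0 < x -> x < pi *+ 2 -> expi x != 1.
Proof.
move=> x0 x2; have s0 : 0 < sin (x / 2).
  by rewrite sin_gt0_pi//; apply/andP; split; [rewrite divr_gt0|rewrite ltr_pdivrMr// mulr_natr].
apply/eqP => /(congr1 (@complex.Re R)) /= c1.
have := cosD (x / 2) (x / 2); rewrite -splitr c1 -!expr2.
have := cos2Dsin2 (x / 2).
have : 0 < sin (x / 2) ^+ 2 by rewrite exprn_gt0.
lra.
Qed.

Lemma sum_expr_unity (F : fieldType) (y : F) (M : nat) : y ^+ M = 1 -> y != 1 ->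
  \sum_(m < M) y ^+ m = 0.
Proof.
move=> yM y1; apply/eqP; have := subrX1 y M; rewrite yM subrr => /esym/eqP.
by rewrite mulf_eq0 subr_eq0 (negbTE y1).
Qed.

Lemma mul_conj_csq (R : realType) (z : R[i]) : z * cconj z = RtoC (csq z).
Proof.
case: z => a b; apply/eqP; rewrite eq_complex /csq /=; apply/andP; split; apply/eqP; ring.
Qed.

(* A closed form of the Poisson kernel restricted to the M-th roots of unity. *)
Lemma poisson_kernel_unity (R : realType) (rho : R) (M : nat) (x : R[i]) :
  0 < rho -> rho < 1 -> x ^+ M = 1 -> cabs x = 1 ->
  RtoC ((1 - rho ^+ M) * (1 - rho ^+ 2) / csq (1 - RtoC rho * x)) =
  \sum_(i < M) RtoC (rho ^+ i + rho ^+ (M - i)) * x ^+ i.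
Proof.
move=> r0 r1 xM x1; pose r := RtoC rho.
have x0 : x != 0 by rewrite -cabs_gt0 x1.
have xx : x * cconj x = 1 by rewrite mul_conj_csq csqE x1 expr1n.
have cx : cconj x = x^-1 by rewrite -[RHS]mulr1 -xx mulKf.
(* The sum has two geometric halves: [G] in powers of rho x, and [H] in powers of rho / x, since x^M
   = 1 turns rho^(M-i) x^i into (rho / x)^(M-i). *)
pose G := \sum_(i < M) (r * x) ^+ i.
pose H := \sum_(i < M) (r * x^-1) ^+ i.+1.
have rM : r ^+ M = RtoC (rho ^+ M) by rewrite -[RtoC (rho ^+ M)]/(real_complex R (rho ^+ M)) rmorphXn.
have EG : (1 - r * x) * G = 1 - r ^+ M.
  have := subrX1 (r * x) M; rewrite exprMn xM mulr1 -/G => h.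
  by rewrite -opprB mulNr -h opprB.
have EH : (1 - r * x^-1) * H = r * x^-1 * (1 - r ^+ M).
  have := subrX1 (r * x^-1) M; rewrite exprMn exprVn xM invr1 mulr1 => h.
  rewrite /H; under eq_bigr do rewrite exprS.
  by rewrite -mulr_sumr mulrCA -opprB mulNr -h opprB.
have -> : \sum_(i < M) RtoC (rho ^+ i + rho ^+ (M - i)) * x ^+ i = G + H.
  have -> : H = \sum_(i < M) r ^+ (M - i) * x ^+ i.
    rewrite /H [RHS](reindex_inj rev_ord_inj) /=; apply: eq_bigr => i _.
    have iM : (i.+1 <= M)%N by exact: ltn_ord.
    rewrite subKn// exprMn; congr (_ * _).
    by rewrite exprVn -[RHS]mul1r -[X in _ = X * _]invr1 -xM -{2}(subnK iM) addnC exprD invfM mulfVK ?expf_neq0.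
  rewrite /G -big_split/=; apply: eq_bigr => i _.
  rewrite exprMn -mulrDl; congr (_ * _).
  by rewrite /r -[RtoC rho]/(real_complex R rho) -!rmorphXn -rmorphD.
have den0 : csq (1 - r * x) != 0.
  rewrite csqE expf_eq0 /= cabs_eq0 subr_eq0; apply/eqP => h.
  have : cabs (r * x) = 1 by rewrite -h cabs1.
  by rewrite cabsM x1 mulr1 cabs_real gtr0_norm// => h1; move: r1; rewrite h1 ltxx.
have denC : RtoC (csq (1 - r * x)) = (1 - r * x) * (1 - r * x^-1).
  rewrite -mul_conj_csq -cx; congr (_ * _).
  by rewrite /r; case: (x) => a b; apply/eqP; rewrite eq_complex /=; apply/andP; split; apply/eqP; ring.
have den1 : RtoC (csq (1 - r * x)) != 0 by rewrite eq_complex /= negb_and den0.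
apply: (mulIf den1).
have -> : RtoC ((1 - rho ^+ M) * (1 - rho ^+ 2) / csq (1 - r * x)) * RtoC (csq (1 - r * x)) =
   (1 - r ^+ M) * (1 - r ^+ 2).
  rewrite rM /r -[RtoC (_ / _)]/(real_complex R _) -[RtoC (csq _)]/(real_complex R _) -rmorphM divfK//.
  by rewrite rmorphM !rmorphB !rmorph1; congr (_ * (_ - _)); exact: (rmorphXn (real_complex R)).
rewrite denC; have -> : (G + H) * ((1 - r * x) * (1 - r / x)) =
    ((1 - r * x) * G) * (1 - r / x) + ((1 - r / x) * H) * (1 - r * x) by ring.
by rewrite EG EH; field.
Qed.

(** The weights are the normalised kernel values at the M-th roots of unity, nonnegative by the
    closed form, and the [u m] are the inverse roots. Orthogonality of the roots reads off the j-th
    coefficient rho^j + rho^(M-j); the one for j = 0 is 1 + rho^M, whence the normalisation. *)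
Lemma poisson_weights (R : realType) (rho : R) (M : nat) : (0 < M)%N -> 0 < rho -> rho < 1 ->
  exists (c : 'I_M -> R) (u : 'I_M -> R[i]),
  [/\ forall m, 0 <= c m, \sum_m c m = 1, forall m, cabs (u m) = 1 &
   forall j, (j < M)%N -> \sum_m RtoC (c m) * u m ^+ j =
     RtoC ((rho ^+ j + rho ^+ (M - j)) / (1 + rho ^+ M))].
Proof.
move=> M0 r0 r1; have MR : 0 < M%:R :> R by rewrite ltr0n.
have p2 : 0 < pi *+ 2 :> R by rewrite mulr2n addr_gt0 ?pi_gt0.
pose z : R[i] := expi (pi *+ 2 / M%:R).
have zM : z ^+ M = 1 by rewrite expiX divfK ?gt_eqF// expi_2pi.
have zc : cabs z = 1 by exact: expi_cabs.
have z0 : z != 0 by exact: expi_neq0.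
have rM1 : rho ^+ M < 1 by rewrite exprn_ilt1// ?ltW// -lt0n.
have rM0 : 0 < rho ^+ M by rewrite exprn_gt0.
pose k (m : 'I_M) := (1 - rho ^+ M) * (1 - rho ^+ 2) / csq (1 - RtoC rho * z ^+ m).
pose c m := k m / (M%:R * (1 + rho ^+ M)).
have kE m : RtoC (k m) = \sum_(i < M) RtoC (rho ^+ i + rho ^+ (M - i)) * (z ^+ m) ^+ i.
  by apply: poisson_kernel_unity => //; rewrite ?cabsX ?zc ?expr1n// -exprM mulnC exprM zM expr1n.
have main j : (j < M)%N -> \sum_m RtoC (c m) * ((z ^+ m)^-1) ^+ j =
     RtoC ((rho ^+ j + rho ^+ (M - j)) / (1 + rho ^+ M)).
  move=> jM.
  pose a (i : nat) := RtoC (rho ^+ i + rho ^+ (M - i)).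
  have -> : \sum_m RtoC (c m) * (z ^+ m)^-1 ^+ j =
     RtoC ((M%:R * (1 + rho ^+ M))^-1) * \sum_(i < M) a i * \sum_(m < M) (z ^+ i / z ^+ j) ^+ m.
    under [X in _ = _ * X]eq_bigr do rewrite mulr_sumr.
    rewrite exchange_big /= mulr_sumr; apply: eq_bigr => m _.
    have -> : RtoC (c m) = RtoC ((M%:R * (1 + rho ^+ M))^-1) * RtoC (k m).
      by rewrite /c -[RtoC (_ / _)]/(real_complex R _) rmorphM mulrC.
    rewrite -mulrA kE mulr_suml; congr (_ * _); apply: eq_bigr => i _.
    rewrite -mulrA; congr (_ * _).
    by rewrite exprMn !exprVn -!exprM ![(m * _)%N]mulnC.
  (* Only i = j survives: otherwise z^i / z^j is an M-th root of unity other than 1, and its powers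
     sum to 0. *)
  rewrite (bigD1 (Ordinal jM))//= [X in RtoC _ * (_ + X)]big1 ?addr0; last first.
    move=> i ij; rewrite sum_expr_unity ?mulr0//.
      by rewrite exprMn exprVn -!exprM ![(_ * M)%N]mulnC !exprM zM !expr1n invr1 mulr1.
    have zn1 n : (0 < n)%N -> (n < M)%N -> z ^+ n != 1.
      move=> n0 nM; rewrite expiX expi_neq1//.
        by rewrite mulr_gt0 ?divr_gt0 ?ltr0n.
      by rewrite mulrAC ltr_pdivrMr// ltr_pM2l// ltr_nat.
    have : (i : nat) != j by apply: contra ij => /eqP ij; apply/eqP/val_inj.
    rewrite neq_ltn => /orP[h|h].
    - apply: contra (zn1 (j - i)%N _ _); rewrite ?subn_gt0// ?(leq_ltn_trans (leq_subr _ _))//.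
      move=> /eqP e; rewrite -[z ^+ (j - i)](mulfK (expf_neq0 i z0)) -exprD subnK ?(ltnW h)//.
      by rewrite -[X in _ / X]mulr1 -(divfK (expf_neq0 j z0) (z ^+ i)) e mul1r mulr1 divff// expf_neq0.
    - apply: contra (zn1 (i - j)%N _ _); rewrite ?subn_gt0// ?(leq_ltn_trans (leq_subr _ _))//.
      move=> /eqP e; rewrite -[z ^+ (i - j)](mulfK (expf_neq0 j z0)) -exprD subnK ?(ltnW h)//.
      by rewrite e.
  rewrite divff ?expf_neq0//; under [X in RtoC _ * (_ * X)]eq_bigr do rewrite expr1n.
  rewrite sumr_const card_ord /a -[RtoC (_^-1)]/(real_complex R _) -[RtoC (_ + _)]/(real_complex R _).
  rewrite -(rmorph_nat (real_complex R) M) -!rmorphM -[RHS]/(real_complex R _).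
  congr (real_complex R _); field.
  by rewrite !gt_eqF// addr_gt0.
exists c, (fun m => (z ^+ m)^-1); split => //.
- move=> m; rewrite /c /k divr_ge0//; last by rewrite mulr_ge0// ltW// addr_gt0.
  by rewrite divr_ge0 ?csq_ge0// mulr_ge0// subr_ge0 ?ltW// exprn_ilt1// ltW.
- have := main 0%N M0; rewrite subn0 expr0 divff ?gt_eqF ?addr_gt0//.
  under eq_bigr do rewrite expr0 mulr1.
  rewrite -[RtoC 1]/(real_complex R 1) => h; apply: (@complexI R).
  by rewrite -h rmorph_sum.
- move=> m; have : cabs (z ^+ m * (z ^+ m)^-1) = 1 by rewrite divff ?expf_neq0// cabs1.
  by rewrite cabsM cabsX zc expr1n mul1r.
Qed.

Lemma cabs_dist (R : realType) (a b : R[i]) : `|cabs a - cabs b| <= cabs (b - a).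
Proof.
have h1 : cabs b <= cabs (b - a) + cabs a by rewrite -{1}(subrK a b) cabsD.
have h2 : cabs a <= cabs (b - a) + cabs b by rewrite -[cabs (b - a)]cabsN opprB -{1}(subrK b a) cabsD.
by rewrite ler_norml; apply/andP; split; lra.
Qed.

Lemma cvg_powR (R : realType) (u : nat -> R) (x r : R) : 0 < r -> 0 <= x -> (forall n, 0 <= u n) ->
  u @ \oo --> x -> u n `^ r @[n --> \oo] --> x `^ r.
Proof.
move=> r0 x0 u0 ux.
have [x00|xN0] := eqVneq x 0.
  rewrite x00 powR0 ?gt_eqF//; rewrite x00 in ux.
  apply/cvgrPdist_lt => e e0.
  have er : 0 < e `^ r^-1 by rewrite powR_gt0.
  move/cvgrPdist_lt : ux => /(_ _ er); apply: filterS => n.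
  rewrite !sub0r !normrN ger0_norm// ger0_norm ?powR_ge0// => h.
  have := gt0_ltr_powR r0 (u0 n) (ltW er) h.
  by rewrite -powRrM mulVf ?gt_eqF// powRr1// ltW.
have x1 : 0 < x by rewrite lt_neqAle eq_sym xN0.
have c : {for x, continuous (fun a : R => a `^ r)}.
  by apply: differentiable_continuous; apply/derivable1_diffP; apply: derivable_powR; rewrite in_itv/= x1.
move: c; rewrite /prop_for /continuous_at => c.
exact: (cvg_comp _ _ ux c).
Qed.

Lemma pint_rot (R : realType) (r : R) (W : R[i] -> R) g (u : R[i]) : cabs u = 1 ->
  measC g -> measR W -> (forall z, 0 <= W z) -> (forall z, W (u * z) = W z) ->
  pint r W (fun z => g (u * z)) = pint r W g.
Proof.
move=> u1 mg mW W0 Wu; have u0 : u != 0 by rewrite -cabs_gt0 u1.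
rewrite /pint; under eq_aint => z do rewrite -(Wu z).
have := @aint_cmul _ u (fun z => cabs (g z) `^ r * W z) u0 (measR_pint r mg mW).
by rewrite csqE u1 expr1n invr1 mul1e => ->//; exact: cabs_pow_ge0.
Qed.

Lemma cabs_sum (R : realType) (I : finType) (F : I -> R[i]) :
  cabs (\sum_i F i) <= \sum_i cabs (F i).
Proof.
elim/big_ind2 : _ => [|x a y b xa yb|//]; first by rewrite cabs0.
by rewrite (le_trans (cabsD _ _))// lerD.
Qed.

(* With M large, (P(rho z) + rho^M P(z / rho)) / (1 + rho^M) is a convex combination of
   rotations of P, so Jensen bounds its norm; Fatou then lets M tend to infinity. *)
Lemma pint_dilation_poly (R : realType) (r rho : R) (W : R[i] -> R) (P : {poly R[i]}) : 1 < r ->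
  0 < rho -> rho < 1 -> measR W -> (forall z, 0 <= W z) ->
  (forall u z, cabs u = 1 -> W (u * z) = W z) ->
  (pint r W (fun z => P.[RtoC rho * z]) <= pint r W (horner P))%E.
Proof.
move=> r1 rho0 rho1 mW W0 Wu; have r0 : 0 < r by exact: lt_trans r1.
have mP : measC (horner P) by apply: measC_entire; exact: entire_poly.
(* [M n] tends to infinity and exceeds every exponent in P, as the moment formula of
   [poisson_weights] holds only for j < M. *)
pose M n := (n + size P).+1.
pose A n z := (P.[RtoC rho * z] + RtoC (rho ^+ M n) * P.[(RtoC rho)^-1 * z]) * RtoC ((1 + rho ^+ M n)^-1).
have rhoC0 : RtoC rho != 0 by rewrite eq_complex /= negb_and gt_eqF.
have mA n : measC (A n).
  apply: measCM; last exact: measC_cst.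
  by apply: measCD; [exact: measC_cmul|apply: measCM; [exact: measC_cst|exact: measC_cmul]].
apply: (@aint_fatou _ (fun n z => cabs (A n z) `^ r * W z)).
- by move=> n; exact: measR_pint.
- by move=> n; exact: cabs_pow_ge0.
- move=> z; apply: cvgMr_tmp.
  apply: cvg_powR => //; [exact: cabs_ge0|by move=> n; exact: cabs_ge0|].
  pose a := P.[RtoC rho * z]; pose b := P.[(RtoC rho)^-1 * z].
  have h n : `|cabs a - cabs (A n z)| <= rho ^+ M n * cabs (b - a).
    have M0 : 0 < rho ^+ M n by rewrite exprn_gt0.
    have E : A n z - a = RtoC (rho ^+ M n) * (b - a) * RtoC ((1 + rho ^+ M n)^-1).
      rewrite /A -/a -/b; have -> : RtoC ((1 + rho ^+ M n)^-1) = (1 + RtoC (rho ^+ M n))^-1.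
        by rewrite -[RtoC _]/(real_complex R _) fmorphV rmorphD rmorph1.
      field; rewrite -[RtoC _]/(real_complex R _) -(rmorph1 (real_complex R)) -rmorphD.
      by rewrite eq_complex /= negb_and gt_eqF// addr_gt0.
    have h1 : cabs (A n z - a) <= rho ^+ M n * cabs (b - a).
      rewrite E !cabsM !cabs_real !ger0_norm ?invr_ge0 ?addr_ge0 ?(ltW M0)//.
      by rewrite ler_piMr ?mulr_ge0 ?cabs_ge0 ?(ltW M0)// invf_le1 ?lerDl ?addr_gt0 ?(ltW M0).
    exact: le_trans (cabs_dist _ _) h1.
  apply/cvgrPdist_le => e e0.
  have : (rho ^+ M n * cabs (b - a)) @[n --> \oo] --> 0 * cabs (b - a).
    apply: cvgMr_tmp; rewrite /M.
    have -> : (fun n => rho ^+ (n + size P).+1) = (fun n => rho ^+ (n + (size P).+1)).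
      by apply/funext => n; rewrite addnS.
    rewrite (@cvg_shiftn _ _ (fun n => rho ^+ n)); apply: cvg_expr.
    by rewrite ger0_norm// ltW.
  rewrite mul0r => /cvgrPdist_le /(_ e e0); apply: filterS => n.
  rewrite sub0r normrN; apply: le_trans; apply: le_trans (h n) _; exact: ler_norm.
move=> n; have [c [u [c0 c1 u1 cu]]] := @poisson_weights R rho (M n) isT rho0 rho1.
have AE z : A n z = \sum_m RtoC (c m) * P.[u m * z].
  under eq_bigr do rewrite horner_coef mulr_sumr.
  rewrite exchange_big /= /A !horner_coef mulr_sumr -big_split /= mulr_suml.
  apply: eq_bigr => i _.
  have iM : (i < M n)%N by rewrite ltnW// ltnS (leq_trans (ltn_ord i))// leq_addl.
  have -> : \sum_m RtoC (c m) * (P`_i * (u m * z) ^+ i) =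
    (\sum_m RtoC (c m) * u m ^+ i) * (P`_i * z ^+ i).
    by rewrite mulr_suml; apply: eq_bigr => m _; rewrite exprMn; ring.
  rewrite cu//.
  have -> : RtoC ((rho ^+ i + rho ^+ (M n - i)) / (1 + rho ^+ M n)) =
     (RtoC rho ^+ i + RtoC (rho ^+ M n) * (RtoC rho)^-1 ^+ i) * RtoC ((1 + rho ^+ M n)^-1).
    have -> : rho ^+ (M n - i) = rho ^+ M n * rho^-1 ^+ i.
      by rewrite -{2}(subnK (ltnW iM)) exprD exprVn mulfK// expf_neq0// gt_eqF.
    by rewrite -![RtoC _]/(real_complex R _) -fmorphV -!rmorphXn -!rmorphM -rmorphD -rmorphM.
  by rewrite !exprMn; ring.
have step z : cabs (A n z) `^ r * W z <= \sum_m c m * (cabs P.[u m * z] `^ r * W z).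
  under eq_bigr do rewrite mulrA; rewrite -mulr_suml ler_wpM2r//.
  apply: le_trans (jensen_powR r1 c0 c1 (fun m => cabs_ge0 P.[u m * z])).
  rewrite ge0_ler_powR ?nnegrE ?cabs_ge0 ?(ltW r0)//.
    by apply: sumr_ge0 => m _; rewrite mulr_ge0 ?cabs_ge0.
  rewrite AE (le_trans (cabs_sum _))//; apply: ler_sum => m _.
  by rewrite cabsM cabs_real ger0_norm.
have mPu m : measC (fun z => P.[u m * z]) by exact: measC_cmul.
have mc m : measR (fun z => c m * (cabs P.[u m * z] `^ r * W z)).
  exact: (@measRM _ (fun=> c m) _ (measurable_cst _) (measR_pint r (mPu m) mW)).
apply: (@le_trans _ _ (aint (fun z => \sum_m c m * (cabs P.[u m * z] `^ r * W z)))).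
  apply: le_aint => //.
  - exact: measR_pint.
  - by apply: measurable_sum => m; exact: mc.
  - exact: cabs_pow_ge0.
rewrite (@aint_sum _ _ (fun m z => c m * (cabs P.[u m * z] `^ r * W z))); last 2 first.
- exact: mc.
- by move=> m z; rewrite !mulr_ge0// powR_ge0.
under eq_bigr => m _.
  rewrite aintZ//; last 2 first.
    exact: (measR_pint r (mPu m) mW).
    exact: cabs_pow_ge0.
  rewrite -/(pint r W (fun z => P.[u m * z])) pint_rot//; last by move=> z; exact: Wu.
  over.
rewrite /= -ge0_sume_distrl; last by move=> m _; rewrite lee_fin.
rewrite sumEFin.
by rewrite c1 mul1e.
Qed.

(** * A fundamental theorem of calculus for monotone functions *)

(** The supremum c of the points v with [Q a v] is itself such a point, because the local property
    at c joins it to points close on its left; were c < b, the same property would reach past c. *)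
Lemma cousin_interval (R : realType) (a b : R) (Q : R -> R -> Prop) : a <= b ->
  (forall u v w, a <= u -> u <= v -> v <= w -> w <= b -> Q u v -> Q v w -> Q u w) ->
  (forall x, a <= x -> x <= b -> exists2 d : R, 0 < d & forall u v, a <= u -> v <= b ->
     x - d < u -> u <= x -> x <= v -> v < x + d -> Q u v) ->
  Q a b.
Proof.
move=> ab Qadd Qloc.
pose S := [set x | [/\ a <= x, x <= b & Q a x]].
have Sa : S a.
  split => //; have [d d0 h] := Qloc a (lexx _) ab; apply: h => //.
    by rewrite gtrBl.
  by rewrite ltrDl.
have hS : has_sup S by split; [exists a|exists b => x []].
pose c := sup S.
have ac : a <= c by apply: ub_le_sup => //; exact: hS.2.
have cb : c <= b by apply: ge_sup; [exists a|move=> x []].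
have [d d0 h] := Qloc c ac cb.
have [x [ax xb Qx] cx] := sup_adherent d0 hS.
have xc : x <= c by apply: ub_le_sup => //; exact: hS.2.
have Qac : Q a c.
  apply: (Qadd a x c) => //; apply: h => //.
  by rewrite ltrDl.
have [->//|cNb] := eqVneq b c.
have cb' : c < b by rewrite lt_neqAle eq_sym cNb.
pose v := Num.min b (c + d / 2).
have cv : c < v by rewrite lt_min cb' ltrDl divr_gt0.
have Sv : S v.
  split; [exact: (le_trans ac (ltW cv))|by rewrite ge_min lexx|].
  apply: (Qadd a c v) => //; [exact: ltW|by rewrite ge_min lexx|].
  apply: h => //; [by rewrite ge_min lexx|by rewrite gtrBl|exact: ltW|].
  by rewrite gt_min ltrD2l ltr_pdivrMr// ltr_pMr// ltr1n orbT.
by have := ub_le_sup hS.2 Sv; rewrite leNgt cv.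
Qed.

(* The hard half of the fundamental theorem of calculus for a function that is
   differentiable at every point, without continuity of the derivative: the level
   sets of the derivative are covered by open sets of nearly the same measure,
   which gives a majorant of the derivative dominating all short increments. *)
Lemma increment_le_integral_derivative (R : realType) (a b : R) (G g : R -> R) : a <= b ->
  measurable_fun `[a, b]%classic g -> (forall x, a <= x -> x <= b -> 0 <= g x) ->
  (forall x, a <= x -> x <= b -> forall e, 0 < e -> exists2 d : R, 0 < d &
     forall y, `|y - x| < d -> `|G y - G x - g x * (y - x)| <= e * `|y - x|) ->
  ((G b - G a)%:E <= \int[lebesgue_measure]_(x in `[a, b]) (g x)%:E)%E.
Proof.
move=> ab mg g0 Gg.
apply/lee_addgt0Pr => e0 e00.
(* The error has two sources: rounding g up to multiples of e costs e (b - a) in total, and the open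
   covers of the level sets cost at most e. *)
pose e := e0 / (1 + (b - a)).
have ba1 : 0 < 1 + (b - a) by rewrite ltr_pwDl// subr_ge0.
have e_gt0 : 0 < e by rewrite divr_gt0.
pose E (j : nat) := `[a, b]%classic `&` [set x | j%:R * e <= g x < j.+1%:R * e].
have mE j : measurable (E j).
  rewrite (_ : E j = `[a, b]%classic `&` (g @^-1` `[j%:R * e, j.+1%:R * e[%classic)).
    by apply: mg => //; exact: measurable_itv.
  by apply/seteqP; split => x [h1 h2]; split => //; move: h2; rewrite /= in_itv.
have muE j : (lebesgue_measure (E j) < +oo)%E.
  apply: (@le_lt_trans _ _ (lebesgue_measure `[a, b]%classic)).
    by apply: le_measure; rewrite ?inE; [exact: mE|exact: measurable_itv|exact: subIsetl].
  by rewrite lebesgue_measure_itv/=; case: ifP; rewrite ?ltry// -EFinB ltry.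
(* With this excess measure, the level (j + 1) e loses e / 2^(j+1) on [U j], and these losses sum to
   e. *)
pose eta (j : nat) : R := (j.+1%:R * (2 ^ j.+1)%:R)^-1.
have eta0 j : 0 < eta j by rewrite invr_gt0 mulr_gt0 ?ltr0n ?expn_gt0.
have /choice[U HU] := fun j => lebesgue_regularity_outer (mE j) (muE j) (eta0 j).
have mU j : measurable (U j) by have [oU _ _] := HU j; exact: open_measurable.
pose t (j : nat) (x : R) : \bar R := (j.+1%:R * e * \1_(U j) x)%:E.
have t0 j x : (0 <= t j x)%E by rewrite lee_fin mulr_ge0 ?indicE ?ler0n// mulr_ge0 ?ler0n ?(ltW e_gt0).
have mt j : measurable_fun [set: R] (t j).
  apply/measurable_EFinP; apply: measurable_funM => //.
pose phi (x : R) : \bar R := (\sum_(0 <= j <oo) t j x)%E.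
have phi0 x : (0 <= phi x)%E by exact: nneseries_ge0.
have mphi : measurable_fun [set: R] phi by apply: ge0_emeasurable_sum => //.
pose I (u v : R) := (\int[lebesgue_measure]_(x in `]u, v]) phi x)%E.
have key : ((G b - G a)%:E <= I a b)%E.
  apply: (@cousin_interval _ a b (fun u v => (G v - G u)%:E <= I u v)%E) => //.
  - move=> u v w au uv vw wb uvI vwI.
    have -> : I u w = (I u v + I v w)%E.
      rewrite /I -ge0_integral_setU//=.
      + by rewrite -itv_bndbnd_setU// bnd_simp.
      + exact: measurable_funTS.
      + rewrite disj_set2E; apply/eqP/seteqP; split => // x [] /=; rewrite !in_itv/=.
        by move=> /andP[_ xv] /andP[/lt_le_trans/(_ xv)]; rewrite ltxx.
    have -> : (G w - G u)%:E = ((G v - G u)%:E + (G w - G v)%:E)%E.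
      by rewrite -EFinD; congr EFin; ring.
    exact: leeD.
  - move=> x ax xb.
    pose j := Num.truncn (g x / e).
    have jx : E j x.
      split; first by rewrite /= in_itv/= ax.
      have /andP[h1 h2] := truncn_itv (divr_ge0 (g0 x ax xb) (ltW e_gt0)).
      by rewrite /= -ler_pdivlMr// h1 -ltr_pdivrMr.
    have [oU EU _] := HU j.
    have /(open_subball (oU)) : U j x by exact: EU.
    move=> [d' /= d'0 hd'].
    (* The level lies strictly above g x, and this gap is the error allowed in the derivative at x:
       short increments around x then have slope at most (j + 1) e, while [phi] is at least that on
       a ball inside [U j]. *)
    have c0 : 0 < j.+1%:R * e - g x by rewrite subr_gt0; case: jx => _ /andP[].
    have [d d0 hd] := Gg x ax xb _ c0.
    exists (Num.min d (d' / 2)); first by rewrite lt_min d0 divr_gt0.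
    move=> u v au vb xu ux xv vx.
    have hinc y : `|y - x| < d -> `|G y - G x - g x * (y - x)| <= (j.+1%:R * e - g x) * `|y - x| by exact: hd.
    have xud : x - u < Num.min d (d' / 2) by lra.
    have vxd : v - x < Num.min d (d' / 2) by lra.
    move: xud vxd; rewrite !lt_min => /andP[xud xud'] /andP[vxd vxd'].
    have Gu : G x - G u <= j.+1%:R * e * (x - u).
      have : `|u - x| < d by rewrite distrC ger0_norm// subr_ge0.
      move=> /hinc; rewrite [`|u - x|]distrC [`|x - u|]ger0_norm ?subr_ge0// ler_norml => /andP[h _].
      by nra.
    have Gv : G v - G x <= j.+1%:R * e * (v - x).
      have : `|v - x| < d by rewrite ger0_norm// subr_ge0.
      move=> /hinc; rewrite [`|v - x|]ger0_norm ?subr_ge0// ler_norml => /andP[_ h].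
      by nra.
    apply: (@le_trans _ _ (\int[lebesgue_measure]_(y in `]u, v]) (cst (j.+1%:R * e)%:E y))%E).
      rewrite integral_cst//= lebesgue_measure_itv/= lte_fin.
      case: ltP => uv.
        by rewrite -EFinB -EFinM lee_fin; nra.
      have -> : v = u by apply/eqP; rewrite eq_le uv (le_trans ux xv).
      by rewrite subrr mule0.
    apply: ge0_le_integral => //.
    - by move=> y _; rewrite lee_fin mulr_ge0// ltW.
    - exact: measurable_funTS.
    move=> y /=; rewrite in_itv/= => /andP[uy yv].
    have Uy : U j y.
      apply: (hd' (d' / 2)) => //=; rewrite ?divr_gt0// ?sub0r ?normrN ?ger0_norm ?divr_ge0 ?(ltW d'0)//.
        by rewrite ltr_pdivrMr// ltr_pMr// ltr1n.
      by rewrite /ball /= ltr_norml; apply/andP; split; lra.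
    apply: (@le_trans _ _ (t j y)); first by rewrite /t indicE mem_set// mulr1.
    rewrite /phi (nneseriesD1 (n := j) (fun k _ => t0 k y))//.
    by rewrite leeDl// nneseries_ge0.
apply: (le_trans key).
have sumE : (\sum_(0 <= j <oo) \int[lebesgue_measure]_(x in E j) (g x + e)%:E <=
    \int[lebesgue_measure]_(x in `[a, b]) (g x)%:E + (e * (b - a))%:E)%E.
  rewrite -ge0_integral_bigcup//; last 3 first.
  - apply/measurable_EFinP; apply: measurable_funD => //.
    apply: measurable_funS mg => //; apply: bigcup_sub => j _; exact: subIsetl.
  - move=> x [j _ [xab _]]; rewrite lee_fin addr_ge0 ?(ltW e_gt0)//.
    by move: xab; rewrite /= in_itv/= => /andP[ax xb]; exact: g0.
  - apply/trivIsetP => i j _ _ ij; apply/seteqP; split => // x [[_ /andP[h1 h2]] [_ /andP[h3 h4]]].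
    move: ij; rewrite neq_ltn => /orP[h|h].
      have : i.+1%:R * e <= j%:R * e by rewrite ler_pM2r// ler_nat.
      by move=> /(lt_le_trans h2)/lt_le_trans/(_ h3); rewrite ltxx.
    have : j.+1%:R * e <= i%:R * e by rewrite ler_pM2r// ler_nat.
    by move=> /(lt_le_trans h4)/lt_le_trans/(_ h1); rewrite ltxx.
  have mge : measurable_fun `[a, b]%classic (fun x => (g x + e)%:E).
    by apply/measurable_EFinP; apply: measurable_funD.
  have ge0 x : `[a, b]%classic x -> (0 <= (g x + e)%:E)%E.
    by rewrite /= in_itv/= lee_fin => /andP[ax xb]; rewrite addr_ge0 ?g0// ltW.
  apply: (@le_trans _ _ (\int[lebesgue_measure]_(x in `[a, b]) (g x + e)%:E)%E).
    apply: ge0_subset_integral => //; first exact: (bigcupT_measurable _ mE).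
    by apply: bigcup_sub => j _; exact: subIsetl.
  under eq_integral do rewrite EFinD.
  rewrite ge0_integralD//=; last 3 first.
  - by move=> x; rewrite /= in_itv/= lee_fin => /andP[ax xb]; exact: g0.
  - exact/measurable_EFinP.
  - by move=> x _; rewrite lee_fin ltW.
  rewrite leeD2l// integral_cst//= lebesgue_measure_itv/= lte_fin.
  case: ltP => [_|ba]; first by rewrite -EFinB -EFinM.
  by rewrite mule0 lee_fin mulr_ge0 ?(ltW e_gt0)// subr_ge0.
(* On [E j] the level (j + 1) e is at most g + e; the part of [U j] outside [E j] accounts for e /
   2^(j+1). *)
apply: (@le_trans _ _ (\sum_(0 <= j <oo) (\int[lebesgue_measure]_(x in E j) (g x + e)%:E + (e / (2 ^ j.+1)%:R)%:E))%E).
  rewrite /I /phi integral_nneseries//; last by move=> j; exact: (measurable_funTS (mt j)).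
  apply: lee_nneseries => //.
    by move=> j _ _; apply: integral_ge0 => x _; exact: t0.
  move=> j _.
  have je0 : 0 <= j.+1%:R * e by rewrite mulr_ge0// ltW.
  apply: (@le_trans _ _ ((j.+1%:R * e)%:E * lebesgue_measure (U j))%E).
    have -> : ((j.+1%:R * e)%:E * lebesgue_measure (U j) =
        \int[lebesgue_measure]_(x in [set: R]) t j x)%E.
      under eq_integral do rewrite /t EFinM.
      rewrite ge0_integralZl//.
      - by rewrite integral_indic; [|exact: measurableT|exact: mU]; rewrite (_ : U j `&` _ = U j)//; exact: setIT.
      - by apply/measurable_EFinP; apply: measurable_indic; exact: mU.
    by apply: ge0_subset_integral => //; exact: mt.
  have [_ EU UE] := HU j.
  apply: (@le_trans _ _ ((j.+1%:R * e)%:E * (lebesgue_measure (E j) + (eta j)%:E))%E).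
    have je1 : 0 < j.+1%:R * e by rewrite mulr_gt0.
    rewrite lee_pmul2l ?lte_fin//.
    have h : (lebesgue_measure (U j) <=
        lebesgue_measure (U j `\` E j) + lebesgue_measure (E j))%E.
      rewrite -{1}(setDKU EU); apply: measureU2; last exact: mE.
      by apply: measurableD; [exact: mU|exact: mE].
    by rewrite (le_trans h)// addeC leeD2l// ltW.
  rewrite ge0_muleDr// ?lee_fin ?(ltW (eta0 j))//; apply: leeD.
    rewrite -(@integral_cst _ _ _ lebesgue_measure (E j)); last exact: mE.
    apply: ge0_le_integral => //.
    - exact: mE.
    - apply/measurable_EFinP; apply: measurable_funD => //; apply: measurable_funS mg => //; exact: subIsetl.
    move=> x [_ /andP[h1 _]]; rewrite lee_fin -natr1 mulrDl mul1r lerD2r//.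
  rewrite -EFinM lee_fin /eta invfM mulrACA -mulrA [e * _]mulrC mulrA divff ?mul1r//.
apply: (le_trans (epsilon_trick _ _ (ltW e_gt0))).
  move=> j; apply: integral_ge0 => x [xab _]; rewrite lee_fin addr_ge0 ?(ltW e_gt0)//.
  by move: xab; rewrite /= in_itv/= => /andP[ax xb]; exact: g0.
apply: (le_trans (leeD2r _ sumE)).
rewrite -addeA -EFinD leeD2l// lee_fin.
by rewrite -[X in _ + X]mulr1 -mulrDr [b - a + 1]addrC /e divfK ?gt_eqF.
Qed.

(** * The weight and its derivative *)

(** The complex difference quotient of [Omega] is restricted to real increments and its real part
    taken. The disc around x contains real points on both sides, so the derivative is two-sided even
    at x = 0. *)
Lemma omega_derive (R : realType) (omega : R -> R) : analytic_near_halfline omega ->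
  forall x, 0 <= x -> forall e, 0 < e -> exists2 d : R, 0 < d &
    forall y, `|y - x| < d ->
      `|omega y - omega x - derive1 omega x * (y - x)| <= e * `|y - x|.
Proof.
move=> [Om HO] x x0; have [r r0 [Od Oo]] := HO x x0.
have [l Hl] := Od (RtoC x) (ltac:(by rewrite subrr cabs0)).
have key e : 0 < e -> exists2 d : R, 0 < d & forall h : R, h != 0 -> `|h| < d ->
    `|h^-1 * (omega (h + x) - omega x) - complex.Re l| < e.
  move=> e0; have [d d0 hd] := Hl e e0; exists (Num.min d r); first by rewrite lt_min d0.
  move=> h h0; rewrite lt_min => /andP[hd' hr].
  have h0' : RtoC h != 0 by rewrite eq_complex /= negb_and h0.
  have := hd (RtoC h) h0'; rewrite cabs_real => /(_ hd').
  have -> : RtoC x + RtoC h = RtoC (h + x).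
    by apply/eqP; rewrite eq_complex /= addrC addr0 !eqxx.
  rewrite !Oo ?subrr ?normr0// ?addrK//; apply: le_lt_trans.
  apply: le_trans (Re_le_cabs _); rewrite le_eqVlt; apply/orP; left; apply/eqP.
  congr (`| _ |); have -> : (RtoC (omega (h + x)) - RtoC (omega x)) / RtoC h =
      RtoC (h^-1 * (omega (h + x) - omega x)).
    by rewrite -![RtoC _]/(real_complex R _) -rmorphB -fmorphV -rmorphM mulrC.
  by case: l {Hl hd}.
have dE : derive1 omega x = complex.Re l.
  rewrite /derive1; apply: cvg_lim => //; apply/cvgrPdist_lt => e e0.
  have [d d0 hd] := key e e0.
  near=> h; rewrite distrC; apply: hd; first by near: h; exact: nbhs_dnbhs_neq.
  by near: h; apply: dnbhs0_lt.
move=> e e0; have [d d0 hd] := key e e0; exists d => // y yx.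
have [->|yNx] := eqVneq y x; first by rewrite !subrr mulr0 normr0 subr0 normr0 mulr0.
have yx0 : y - x != 0 by rewrite subr_eq0.
have := hd (y - x) yx0 yx; rewrite subrK dE => /ltW h.
have -> : omega y - omega x - complex.Re l * (y - x) =
    ((y - x)^-1 * (omega y - omega x) - complex.Re l) * (y - x) by field.
by rewrite normrM ler_wpM2r.
Unshelve. all: by end_near. Qed.

(* Truncated because nothing is assumed about omega on the negative axis. *)
Definition dpos (R : realType) (omega : R -> R) (s : R) : R := derive1 omega (Num.max s 0).

Lemma dposE (R : realType) (omega : R -> R) (s : R) : 0 <= s -> dpos omega s = derive1 omega s.
Proof. by move=> s0; rewrite /dpos max_l. Qed.

Section weight.
Context {R : realType} {omega : R -> R}.
Hypothesis an : analytic_near_halfline omega.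
Hypothesis omega_gt0 : forall x, 0 <= x -> 0 < omega x.
Hypothesis omega_ni : forall x y, 0 <= x -> x <= y -> omega y <= omega x.

Lemma dpos_le0 s : dpos omega s <= 0.
Proof.
have x0 : 0 <= Num.max s 0 by rewrite le_max lexx orbT.
rewrite /dpos; set x := Num.max s 0 in x0 *; apply/ler_addgt0Pr => e e0; rewrite add0r.
have [d d0 hd] := omega_derive an x0 e0.
have d2 : 0 < d / 2 by rewrite divr_gt0.
have := hd (x + d / 2); rewrite [x + _]addrC addrK gtr0_norm// => /(_ (ltac:(lra))).
rewrite ler_norml => /andP[h _].
have : omega (d / 2 + x) <= omega x by apply: omega_ni => //; rewrite lerDr ltW.
move=> h2; rewrite -(ler_pM2r d2); lra.
Qed.

(** The first-order expansions at x of both endpoints are subtracted; since x lies between u and v,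
    their errors add up to a multiple of v - u and not merely of d. *)
Lemma omega_straddle x e : 0 <= x -> 0 < e -> exists2 d : R, 0 < d & forall u v,
  u <= x -> x <= v -> x - d < u -> v < x + d ->
  `|omega u - omega v - (- dpos omega x) * (v - u)| <= e * (v - u).
Proof.
move=> x0 e0; have [d d0 hd] := omega_derive an x0 e0; exists d => // u v ux xv xu vx.
have hu : `|u - x| < d by rewrite ltr_norml; apply/andP; split; lra.
have hv : `|v - x| < d by rewrite ltr_norml; apply/andP; split; lra.
have := hd u hu; rewrite [X in _ <= e * X]distrC [X in _ <= e * X]ger0_norm ?subr_ge0// => h1.
have := hd v hv; rewrite [X in _ <= e * X]ger0_norm ?subr_ge0// => h2.
rewrite dposE//; have -> : omega u - omega v - - derive1 omega x * (v - u) =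
  (omega u - omega x - derive1 omega x * (u - x)) - (omega v - omega x - derive1 omega x * (v - x)) by ring.
rewrite (le_trans (ler_normB _ _))// (le_trans (lerD h1 h2))//.
by rewrite -mulrDr ler_pM2l//; lra.
Qed.

Lemma measurable_omega_shift (c : R) : 0 <= c ->
  measurable_fun [set: R] (fun s => omega (Num.max s 0 + c)).
Proof.
move=> c0; apply: nonincreasing_measurable => // x y xy; apply: omega_ni.
  by rewrite addr_ge0// le_max lexx orbT.
by rewrite lerD2r ge_max !le_max xy lexx orbT.
Qed.

(** The derivative is a pointwise limit of difference quotients with step 1 / (n + 1), each
    measurable because omega is monotone. *)
Lemma measurable_dpos : measurable_fun [set: R] (dpos omega).
Proof.
pose hn (n : nat) (s : R) : R := n.+1%:R * (omega (Num.max s 0 + n.+1%:R^-1) - omega (Num.max s 0 + 0)).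
apply: (@measurable_fun_cvg _ _ R setT hn).
  move=> n; apply: measurable_funM => //; apply: measurable_funB; exact: measurable_omega_shift.
move=> s _; rewrite /hn; set x := Num.max s 0; have x0 : 0 <= x by rewrite le_max lexx orbT.
rewrite addr0; apply/cvgrPdist_le => e e0.
have [d d0 hd] := omega_derive an x0 e0.
have := near_infty_natSinv_lt (PosNum d0); apply: filterS => n /= nd.
have i0 : 0 < n.+1%:R^-1 :> R by rewrite invr_gt0.
have := hd (x + n.+1%:R^-1); rewrite [x + _]addrC addrK gtr0_norm// => /(_ nd) h.
rewrite distrC /dpos -/x [_ + x]addrC in h *.
have -> : derive1 omega x - n.+1%:R * (omega (x + n.+1%:R^-1) - omega x) =
  n.+1%:R * (derive1 omega x / n.+1%:R - (omega (x + n.+1%:R^-1) - omega x)) by field.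
by rewrite normrM ger0_norm// mulrC -ler_pdivlMr.
Qed.

Lemma increment_le_integral_dpos (t u : R) : 0 <= t -> 1 <= u ->
  ((omega t - omega (u * t))%:E <=
    \int[lebesgue_measure]_(v in `[1%R, u]) (- (t * dpos omega (v * t)))%:E)%E.
Proof.
move=> t0 u1.
have := @increment_le_integral_derivative R 1 u (fun v => - omega (v * t)) (fun v => - (t * dpos omega (v * t))) u1.
rewrite mul1r opprK addrC; apply.
- apply: measurable_funTS; apply: measurable_funN; apply: measurable_funM => //.
  by apply: (measurableT_comp measurable_dpos); exact: measurable_funM.
- by move=> v v1 _; rewrite oppr_ge0 mulr_ge0_le0// dpos_le0.
move=> v v1 vu e e0; have vt0 : 0 <= v * t by rewrite mulr_ge0// (le_trans ler01).
have t1 : 0 < t + 1 by rewrite ltr_pwDr.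
(* The increment of v t is t times that of v; dividing by t + 1 instead of t spares a separate case
   t = 0. *)
have [d d0 hd] := omega_derive an vt0 (ltac:(by rewrite divr_gt0) : 0 < e / (t + 1)).
exists (d / (t + 1)); first by rewrite divr_gt0.
move=> y; rewrite ltr_pdivlMr// => yv.
have yvt : `|y * t - v * t| = `|y - v| * t by rewrite -mulrBl normrM [`|t|]ger0_norm.
have := hd (y * t); rewrite yvt => /(_ (ltac:(apply: le_lt_trans yv; rewrite ler_wpM2l//; lra))).
rewrite dposE// => h.
have -> : - omega (y * t) - - omega (v * t) - - (t * derive1 omega (v * t)) * (y - v) =
  - (omega (y * t) - omega (v * t) - derive1 omega (v * t) * (y * t - v * t)) by ring.
rewrite normrN (le_trans h)//.
have -> : e / (t + 1) * (`|y - v| * t) = (e * `|y - v|) * (t / (t + 1)) by field; rewrite gt_eqF.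
by rewrite ler_piMr ?mulr_ge0 ?(ltW e0)// ler_pdivrMr// mul1r lerDl.
Qed.

End weight.

Section weight_integrals.
Context {R : realType} {omega : R -> R}.
Hypothesis an : analytic_near_halfline omega.
Hypothesis omega_gt0 : forall x, 0 <= x -> 0 < omega x.
Hypothesis omega_ni : forall x y, 0 <= x -> x <= y -> omega y <= omega x.

(** This is the density of D_p^p, written with [dpos], which is harmless because |z|^2 is never
    negative. Adding it to [nu_p] gives [nu_q]. *)
Definition wder (R : realType) (omega : R -> R) (z : R[i]) : R :=
  - (csq z * dpos omega (csq z)).

Lemma csq_rot (u z : R[i]) : cabs u = 1 -> csq (u * z) = csq z.
Proof. by move=> u1; rewrite csqM csqE u1 expr1n mul1r. Qed.

Lemma measR_csq_id : measR (@csq R).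
Proof. by apply: measR_csq; apply: measC_entire; exact: entire_id. Qed.

Lemma measR_comp (h : R -> R) : measurable_fun [set: R] h -> measR (fun z : R[i] => h (csq z)).
Proof. by move=> mh; exact: (measurableT_comp mh measR_csq_id). Qed.

Lemma measR_omega (c : R) : 0 <= c -> measR (fun z => omega (c * csq z)).
Proof.
move=> c0; rewrite (_ : (fun z => _) = (fun z => omega (Num.max (c * csq z) 0 + 0))).
  apply: (@measR_comp (fun s => omega (Num.max (c * s) 0 + 0))).
  apply: (measurableT_comp (measurable_omega_shift omega_ni (lexx 0))).
  exact: measurable_funM.
by apply/funext => z; rewrite addr0 max_l// mulr_ge0 ?csq_ge0.
Qed.

Lemma measR_nu_p : measR (nu_p omega).
Proof.
rewrite (_ : nu_p omega = (fun z => omega (1 * csq z))); first exact: measR_omega.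
by apply/funext => z; rewrite mul1r.
Qed.

Lemma nu_p_ge0 z : 0 <= nu_p omega z.
Proof. by rewrite ltW// omega_gt0// csq_ge0. Qed.

Lemma nu_p_rot u z : cabs u = 1 -> nu_p omega (u * z) = nu_p omega z.
Proof. by move=> u1; rewrite /nu_p csq_rot. Qed.

Lemma measR_wder_scaled (v : R) : measR (fun z => - (csq z * dpos omega (v * csq z))).
Proof.
apply: (@measR_comp (fun s => - (s * dpos omega (v * s)))).
apply: measurable_funN; apply: measurable_funM => //.
by apply: (measurableT_comp (measurable_dpos an omega_ni)); exact: measurable_funM.
Qed.

Lemma measR_wder : measR (wder omega).
Proof.
rewrite (_ : wder omega = (fun z => - (csq z * dpos omega (1 * csq z)))).
  exact: measR_wder_scaled.
by apply/funext => z; rewrite mul1r.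
Qed.

Lemma wder_scaled_ge0 (v : R) (z : R[i]) : 0 <= - (csq z * dpos omega (v * csq z)).
Proof. by rewrite oppr_ge0 mulr_ge0_le0 ?csq_ge0// dpos_le0. Qed.

Lemma wder_ge0 z : 0 <= wder omega z.
Proof. by rewrite /wder oppr_ge0 mulr_ge0_le0 ?csq_ge0// dpos_le0. Qed.

Lemma wder_rot u z : cabs u = 1 -> wder omega (u * z) = wder omega z.
Proof. by move=> u1; rewrite /wder csq_rot. Qed.

Lemma omega_diff_ge0 (u : R) (z : R[i]) : 1 <= u -> 0 <= omega (csq z) - omega (u * csq z).
Proof. by move=> u1; rewrite subr_ge0 omega_ni ?csq_ge0// ler_peMl ?csq_ge0. Qed.

(** A linear substitution moves the dilation from the weight onto P, with Jacobian rho^2; what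
    remains is the decrease of polynomial norms under dilation. *)
Lemma pint_dilated_weight (r rho : R) (W : R[i] -> R) (P : {poly R[i]}) : 1 < r ->
  0 < rho -> rho < 1 -> measR W -> (forall z, 0 <= W z) ->
  (forall u z, cabs u = 1 -> W (u * z) = W z) ->
  (pint r (fun z => W ((RtoC rho)^-1 * z)%R) (horner P) <= (rho ^+ 2)%:E * pint r W (horner P))%E.
Proof.
move=> r1 rho0 rho1 mW W0 Wu.
have rC0 : RtoC rho != 0 by rewrite eq_complex /= negb_and gt_eqF.
have mP : measC (horner P) by apply: measC_entire; exact: entire_poly.
have mPr : measC (fun z => P.[RtoC rho * z]) by exact: measC_cmul.
have := @aint_cmul _ (RtoC rho)^-1 (fun z => cabs P.[RtoC rho * z] `^ r * W z)
  (invr_neq0 rC0) (measR_pint r mPr mW) (cabs_pow_ge0 _ _ W0).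
under eq_aint => z do rewrite mulVKf//.
rewrite /pint => ->.
have -> : (csq (RtoC rho)^-1)^-1 = rho ^+ 2.
  have : csq (RtoC rho * (RtoC rho)^-1) = 1 by rewrite divff// csqE cabs1 expr1n.
  rewrite csqM [csq (RtoC rho)]csqE cabs_real gtr0_norm// => h.
  by rewrite -[LHS]mul1r -h mulfK//; apply/eqP => h0; move/eqP: h; rewrite h0 mulr0 eq_sym oner_eq0.
apply: lee_wpmul2l; first by rewrite lee_fin exprn_ge0 // ltW.
exact: (pint_dilation_poly P r1 rho0 rho1 mW W0 Wu).
Qed.

Lemma wder_dilation (v : R) (z : R[i]) : 0 < v ->
  - (csq z * dpos omega (v * csq z)) = v^-1 * wder omega (RtoC (Num.sqrt v) * z).
Proof.
move=> v0; rewrite /wder csqM [csq (RtoC _)]csqE cabs_real ger0_norm ?sqrtr_ge0// sqr_sqrtr ?(ltW v0)//.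
by field; rewrite gt_eqF.
Qed.

Lemma integral_indicator (D : set R) (c : R -> R) : measurable D ->
  (\int[lebesgue_measure]_(v in D) (c v)%:E = \int[lebesgue_measure]_(v in [set: R]) (c v * \1_D v)%:E)%E.
Proof.
move=> mD; rewrite integral_mkcond; apply: eq_integral => v _.
by rewrite patchE indicE; case: ifP => _; rewrite ?mulr1 ?mulr0.
Qed.

Lemma measurable_wder_joint (F : R[i] -> R) : measR F ->
  measurable_fun [set: (R * R) * measurableTypeR R]
    (fun y => F (toC y.1) * - (csq (toC y.1) * dpos omega (y.2 * csq (toC y.1)))).
Proof.
move=> mF.
have m1 : measurable_fun [set: (R * R) * measurableTypeR R] (fun y => F (toC y.1)).
  exact: (measurableT_comp mF measurable_fst).
have m2 : measurable_fun [set: (R * R) * measurableTypeR R] (fun y => csq (toC y.1)).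
  exact: (measurableT_comp measR_csq_id measurable_fst).
have m3 : measurable_fun [set: (R * R) * measurableTypeR R] (fun y => y.2 : R).
  exact: measurable_snd.
apply: measurable_funM => //; apply: measurable_funN; apply: measurable_funM => //.
by apply: (measurableT_comp (measurable_dpos an omega_ni)); exact: measurable_funM.
Qed.

Lemma measurable_aint_wder (F : R[i] -> R) : measR F -> (forall z, 0 <= F z) ->
  measurable_fun [set: R] (fun v => aint (fun z => F z * - (csq z * dpos omega (v * csq z)))).
Proof.
move=> mF F0; have mH : measurable_fun [set: (R * R) * measurableTypeR R]
    (fun y => (F (toC y.1) * - (csq (toC y.1) * dpos omega (y.2 * csq (toC y.1))))%:E).
  by apply/measurable_EFinP; exact: measurable_wder_joint.
apply: (@measurable_fun_fubini_tonelli_G _ _ _ _ _ (@area R) _ mH) => y.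
by rewrite lee_fin mulr_ge0// wder_scaled_ge0.
Qed.

(** The pointwise bound on increments of omega along the ray v |-> v t is integrated against F, and
    Tonelli exchanges the integrals over v and over the plane. *)
Lemma aint_omega_diff (F : R[i] -> R) (u : R) : measR F -> (forall z, 0 <= F z) -> 1 <= u ->
  (aint (fun z => F z * (omega (csq z) - omega (u * csq z)))%R <=
   \int[lebesgue_measure]_(v in `[1%R, u]) aint (fun z => F z * - (csq z * dpos omega (v * csq z)))%R)%E.
Proof.
move=> mF F0 u1.
pose D : set R := `[1, u]%classic.
have mD : measurable D by exact: measurable_itv.
pose H (y : (R * R) * measurableTypeR R) : \bar R :=
  (F (toC y.1) * - (csq (toC y.1) * dpos omega (y.2 * csq (toC y.1))) * \1_D y.2)%:E.
have mH : measurable_fun [set: (R * R) * measurableTypeR R] H.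
  apply/measurable_EFinP.
  apply: measurable_funM; first exact: measurable_wder_joint.
  exact: (measurableT_comp (measurable_indic mD) measurable_snd).
have H0 y : (0 <= H y)%E by rewrite lee_fin !mulr_ge0 ?wder_scaled_ge0// indicE.
have := @fubini_tonelli _ _ _ _ _ (@area R) (@lebesgue_measure R) H mH H0.
have -> : (\int[lebesgue_measure]_y \int[area]_x H (x, y) =
   \int[lebesgue_measure]_(v in D) aint (fun z => F z * - (csq z * dpos omega (v * csq z)))%R)%E.
  rewrite [RHS]integral_mkcond; apply: eq_integral => v _; rewrite patchE.
  case: ifPn => vD.
    by apply: eq_integral => x _; rewrite /H /= indicE vD mulr1.
  by apply: integral0_eq => x _; rewrite /H /= indicE (negbTE vD) mulr0.
move=> <-; rewrite /aint; apply: ge0_le_integral => //.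
- by move=> x _; rewrite lee_fin mulr_ge0// omega_diff_ge0.
- apply/measurable_EFinP; apply: (measRM mF (measRB measR_nu_p (measR_omega _))).
  exact: le_trans u1.
- exact: (@measurable_fun_fubini_tonelli_F _ _ _ _ _ (@lebesgue_measure R) _ mH H0).
move=> x _; set z := toC x.
have -> : (\int[lebesgue_measure]_v H (x, v) =
    \int[lebesgue_measure]_(v in D) (F z * - (csq z * dpos omega (v * csq z)))%:E)%E.
  by rewrite [RHS]integral_indicator.
have mg : measurable_fun D (fun v : measurableTypeR R => (- (csq z * dpos omega (v * csq z)))%:E).
  apply/measurable_EFinP; apply: measurable_funTS; apply: measurable_funN; apply: measurable_funM => //.
  by apply: (measurableT_comp (measurable_dpos an omega_ni)); exact: measurable_funM.
under eq_integral do rewrite EFinM.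
apply: (@le_trans _ _ ((F z)%:E * \int[lebesgue_measure]_(v in D) (- (csq z * dpos omega (v * csq z)))%:E)%E).
  rewrite EFinM lee_wpmul2l ?lee_fin//.
  by apply: increment_le_integral_dpos => //; exact: csq_ge0.
by rewrite -ge0_integralZl ?lee_fin// => v _; rewrite lee_fin wder_scaled_ge0.
Qed.

(** The slice at v is 1 / v times an integral against [wder] dilated by sqrt v, and
    [pint_dilated_weight] gains another 1 / v. Every slice is therefore at most the slice at v = 1,
    and v runs over an interval of length u - 1. *)
Lemma aint_omega_diff_poly (r u : R) (P : {poly R[i]}) : 1 < r -> 1 <= u ->
  (pint r (fun z => omega (csq z) - omega (u * csq z))%R (horner P) <=
   (u - 1)%:E * pint r (wder omega) (horner P))%E.
Proof.
move=> r1 u1; have mP : measC (horner P) by apply: measC_entire; exact: entire_poly.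
have mF : measR (fun z => cabs P.[z] `^ r) by apply: measR_powR; exact: measR_cabs.
apply: (le_trans (@aint_omega_diff (fun z => cabs P.[z] `^ r) u mF (fun z => powR_ge0 _ _) u1)).
have step v : 1 <= v -> (aint (fun z => cabs P.[z] `^ r * - (csq z * dpos omega (v * csq z)))%R <=
    pint r (wder omega) (horner P))%E.
  rewrite le_eqVlt => /predU1P[<-|v1].
    by rewrite le_eqVlt; apply/orP; left; apply/eqP; apply: eq_aint => z; rewrite mul1r.
  have v0 : 0 < v by exact: lt_trans v1.
  have s1 : 1 < Num.sqrt v by rewrite -sqrtr1 ltr_sqrt.
  have s0 : 0 < Num.sqrt v by exact: lt_trans s1.
  have i0 : 0 < (Num.sqrt v)^-1 by rewrite invr_gt0.
  have i1 : (Num.sqrt v)^-1 < 1 by rewrite invf_lt1.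
  have := @pint_dilated_weight r (Num.sqrt v)^-1 (wder omega) P r1 i0 i1 measR_wder wder_ge0 wder_rot.
  have -> : RtoC (Num.sqrt v)^-1 = (RtoC (Num.sqrt v))^-1.
    by rewrite -![RtoC _]/(real_complex R _) fmorphV.
  rewrite (invrK (RtoC _)) => h.
  under eq_aint => z do rewrite wder_dilation// mulrCA.
  rewrite aintZ ?invr_ge0 ?(ltW v0)//; last 2 first.
  - by apply: measR_pint => //; apply: measR_cmul; exact: measR_wder.
  - by move=> z; rewrite mulr_ge0 ?powR_ge0// wder_ge0.
  apply: (@le_trans _ _ (v^-1%:E * (((Num.sqrt v)^-1 ^+ 2)%:E * pint r (wder omega) (horner P))))%E.
    by rewrite lee_wpmul2l// lee_fin invr_ge0 ltW.
  rewrite muleA -EFinM -[leRHS]mul1e lee_wpmul2r ?pint_ge0//; first exact: wder_ge0.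
  rewrite lee_fin mulr_ile1 ?invr_ge0 ?(ltW v0) ?exprn_ge0 ?invr_ge0 ?(ltW s0)//.
    by rewrite invf_le1// ltW.
  by rewrite exprn_ile1 ?invr_ge0 ?(ltW s0)// invf_le1// ltW.
apply: (@le_trans _ _ (\int[lebesgue_measure]_(v in `[1%R, u]) cst (pint r (wder omega) (horner P)) v)%E).
  have mD : measurable (`[1, u]%classic : set (measurableTypeR R)) by exact: measurable_itv.
  have mg : measurable_fun (`[1, u]%classic : set (measurableTypeR R))
      (fun v : measurableTypeR R => aint (fun z => cabs P.[z] `^ r * - (csq z * dpos omega (v * csq z)))).
    apply: measurable_funTS.
    by apply: (@measurable_aint_wder (fun z => cabs P.[z] `^ r) mF) => z; exact: powR_ge0.
  have mc : measurable_fun (`[1, u]%classic : set (measurableTypeR R)) (cst (pint r (wder omega) (horner P))).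
    exact: measurable_cst.
  refine (@ge0_le_integral _ (measurableTypeR R) R lebesgue_measure _ mD _ _ _ mg mc _).
    by move=> v _; apply: aint_ge0 => z; rewrite mulr_ge0 ?powR_ge0// wder_scaled_ge0.
  by move=> v; rewrite /= in_itv/= => /andP[v1 _]; exact: step.
rewrite integral_cst//= lebesgue_measure_itv/= lte_fin.
case: ltP => uu; first by rewrite -EFinB muleC.
have -> : u = 1 by apply/eqP; rewrite eq_le u1 uu.
by rewrite subrr mule0 mul0e.
Qed.

End weight_integrals.

(** * Extension of weighted inequalities from polynomials by density *)

Lemma poly_dense_pint (R : realType) (r : R) (V : R[i] -> R) g (d : R) : 0 < r -> (forall z, 0 <= V z) ->
  poly_dense r V -> Ap r V g -> 0 < d ->
  exists P : {poly R[i]}, (pint r V (fun z => g z - P.[z])%R <= d%:E)%E.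
Proof.
move=> r0 V0 dV gV d0.
have [P [Pfin PN]] := dV g gV (d `^ r^-1) (ltac:(by rewrite powR_gt0)).
exists P; rewrite -[leLHS]fineK ?lee_fin; last by rewrite ge0_fin_numE// pint_ge0.
rewrite leNgt; apply/negP => /ltW h; move: PN; rewrite /Anorm ltNge.
by rewrite ge0_ler_powR// ?nnegrE ?invr_ge0 ?(ltW r0) ?(ltW d0)// fine_ge0// pint_ge0.
Qed.

Lemma pint_sub_sym (R : realType) (r : R) (V : R[i] -> R) f g :
  pint r V (fun z => f z - g z) = pint r V (fun z => g z - f z).
Proof. by apply: eq_aint => z; rewrite -cabsN opprB. Qed.

(** Domination of both weights by C V lets one polynomial, close to g in the norm of V, serve on
    both sides; Minkowski's inequality then transfers the polynomial case up to an arbitrary e. *)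
Lemma le_pint_poly_dense (R : realType) (r C : R) (V W1 W2 : R[i] -> R) g : 1 <= r -> 0 < C ->
  measR V -> measR W1 -> measR W2 -> (forall z, 0 <= V z) -> (forall z, 0 <= W1 z) -> (forall z, 0 <= W2 z) ->
  (forall z, W1 z <= C * V z) -> (forall z, W2 z <= C * V z) ->
  poly_dense r V -> Ap r V g ->
  (forall P : {poly R[i]}, (pint r W1 (horner P) <= pint r W2 (horner P))%E) ->
  (pint r W1 g <= pint r W2 g)%E.
Proof.
move=> r1 C0 mV mW1 mW2 V0 W10 W20 W1C W2C dV gV WP.
have r0 : 0 < r by exact: lt_le_trans r1.
have ri0 : 0 <= r^-1 by rewrite invr_ge0 ltW.
have mg : measC g by apply: measC_entire; case: gV.
suff h : (wnorm r W1 g <= wnorm r W2 g)%E.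
  have E W : (forall z, 0 <= W z) -> pint r W g = poweR (wnorm r W g) r.
    by move=> W0; rewrite /wnorm -poweRrM mulVf ?gt_eqF// poweRe1// pint_ge0.
  rewrite (E W1)// (E W2)// gt0_ler_poweR ?in_itv/= ?leey ?andbT ?poweR_ge0// ltW//.
apply/lee_addgt0Pr => e e0.
(* An error of at most d for V is at most (e / 2)^r for every weight below C V. *)
pose d := (e / 2) `^ r / C.
have e2 : 0 < e / 2 by rewrite divr_gt0.
have d0 : 0 < d by rewrite divr_gt0// powR_gt0.
have [P Pd] := poly_dense_pint r0 V0 dV gV d0.
have mP : measC (horner P) by apply: measC_entire; exact: entire_poly.
have mgP : measC (fun z => g z - P.[z]) by exact: measCB.
have small W : measR W -> (forall z, 0 <= W z) -> (forall z, W z <= C * V z) ->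
    (wnorm r W (fun z => g z - P.[z])%R <= (e / 2)%:E)%E.
  move=> mW W0 WC.
  have -> : (e / 2)%:E = poweR ((e / 2) `^ r)%:E r^-1.
    by rewrite poweR_EFin -powRrM divff ?gt_eqF// powRr1// ltW.
  apply: gt0_ler_poweR => //; rewrite ?in_itv/= ?leey ?andbT ?pint_ge0 ?lee_fin ?powR_ge0//.
  apply: (@le_trans _ _ (C%:E * pint r V (fun z => g z - P.[z])%R)%E).
    rewrite -aintZ ?(ltW C0)//; [|exact: measR_pint|by move=> z; rewrite mulr_ge0 ?powR_ge0].
    apply: le_aint; [exact: measR_pint| |by move=> z; rewrite mulr_ge0 ?powR_ge0|].
      exact: (@measRM _ (fun=> C) _ (measurable_cst _) (measR_pint r mgP mV)).
    by move=> z; rewrite mulrCA ler_wpM2l ?powR_ge0.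
  apply: (le_trans (lee_wpmul2l _ Pd)); first by rewrite lee_fin ltW.
  by rewrite -EFinM /d mulrCA divff ?gt_eqF// mulr1.
have s1 : (wnorm r W1 g <= wnorm r W1 (horner P) + (e / 2)%:E)%E.
  have := wnormD r1 W10 mP mgP mW1.
  have -> : (fun z => P.[z] + (g z - P.[z])) = g by apply/funext => z; rewrite addrC subrK.
  by move=> /le_trans; apply; rewrite leeD2l// small.
have s2 : (wnorm r W1 (horner P) <= wnorm r W2 (horner P))%E.
  by apply: gt0_ler_poweR => //; rewrite ?in_itv/= ?leey ?andbT ?pint_ge0.
have s3 : (wnorm r W2 (horner P) <= wnorm r W2 g + (e / 2)%:E)%E.
  have := wnormD r1 W20 mg (measCB mP mg) mW2.
  have -> : (fun z => g z + (P.[z] - g z)) = horner P by apply/funext => z; rewrite addrC subrK.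
  move=> /le_trans; apply; rewrite leeD2l//.
  by rewrite /wnorm pint_sub_sym; exact: small.
apply: (le_trans s1); rewrite [e in leRHS](splitr e) EFinD addeA leeD2r//.
exact: le_trans s2 s3.
Qed.

Lemma pint_weightB (R : realType) (r : R) (W V : R[i] -> R) g : measC g -> measR W -> measR V ->
  (forall z, 0 <= V z) -> (forall z, V z <= W z) -> (pint r W g < +oo)%E ->
  pint r (fun z => W z - V z) g = (fine (pint r W g) - fine (pint r V g))%:E.
Proof.
move=> mg mW mV V0 VW Wfin.
have W0 z : 0 <= W z by exact: le_trans (V0 z) (VW z).
have Vfin : (pint r V g < +oo)%E by apply: le_lt_trans Wfin; exact: le_pint.
have : pint r W g = (pint r (fun z => W z - V z)%R g + pint r V g)%E.
  rewrite /pint -aintD.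
  - by apply: eq_aint => z; rewrite -mulrDr subrK.
  - by apply: measR_pint => //; exact: measRB.
  - exact: measR_pint.
  - by move=> z; rewrite mulr_ge0 ?powR_ge0// subr_ge0.
  - by move=> z; rewrite mulr_ge0 ?powR_ge0.
have VE : pint r V g = (fine (pint r V g))%:E by rewrite fineK// ge0_fin_numE// pint_ge0.
have WE : pint r W g = (fine (pint r W g))%:E by rewrite fineK// ge0_fin_numE// pint_ge0.
by rewrite EFinB -WE -VE => ->; rewrite VE -addeA -EFinN -EFinD subrr adde0.
Qed.

(** * Dilated weights and their difference quotients on the spaces A^r *)

Section weight_bounds.
Context {R : realType} {omega : R -> R}.
Hypothesis an : analytic_near_halfline omega.
Hypothesis omega_gt0 : forall x, 0 <= x -> 0 < omega x.
Hypothesis omega_ni : forall x y, 0 <= x -> x <= y -> omega y <= omega x.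

Let mom c c0 := @measR_omega R omega omega_ni c c0.

Lemma nu_qE z : nu_q omega z = nu_p omega z + wder omega z.
Proof. by rewrite /nu_q /wder dposE// csq_ge0. Qed.

Lemma omega_scaled_ge0 (c : R) (z : R[i]) : 0 <= c -> 0 <= omega (c * csq z).
Proof. by move=> c0; rewrite ltW// omega_gt0// mulr_ge0 ?csq_ge0. Qed.

Lemma measR_omega_diff (u v : R) : 0 <= u -> 0 <= v ->
  measR (fun z => omega (u * csq z) - omega (v * csq z)).
Proof. by move=> u0 v0; exact: measRB (mom u0) (mom v0). Qed.

Lemma omega_scaled_diff_ge0 (u v : R) (z : R[i]) : 0 <= u -> u <= v ->
  0 <= omega (u * csq z) - omega (v * csq z).
Proof.
by move=> u0 uv; rewrite subr_ge0 omega_ni ?mulr_ge0 ?csq_ge0// ler_wpM2r ?csq_ge0.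
Qed.

Lemma Ap_nu_q (r : R) g : Ap r (nu_p omega) g -> (pint r (wder omega) g < +oo)%E ->
  Ap r (nu_q omega) g.
Proof.
move=> [eg gfin] gder; split=> //; have mg := measC_entire eg.
rewrite /pint; under eq_aint => z do rewrite nu_qE mulrDr.
rewrite aintD; first exact: lte_add_pinfty.
- exact: (measR_pint r mg (measR_nu_p omega_ni)).
- exact: (measR_pint r mg (measR_wder an omega_ni)).
- by move=> z; rewrite mulr_ge0 ?powR_ge0 ?(nu_p_ge0 omega_gt0).
- by move=> z; rewrite mulr_ge0 ?powR_ge0 ?(wder_ge0 an omega_ni).
Qed.

(** Finiteness of the [wder] integral puts g in the space of [nu_q], where polynomials are dense.
    Both weights involved are at most u times [nu_q], so the polynomial case passes to g. *)
Lemma pint_omega_diff_le (r u : R) g : 1 < r -> 1 <= u -> Ap r (nu_p omega) g ->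
  (pint r (wder omega) g < +oo)%E -> poly_dense r (nu_q omega) ->
  (pint r (fun z => omega (csq z) - omega (u * csq z))%R g <=
   (u - 1)%:E * pint r (wder omega) g)%E.
Proof.
move=> r1 u1 Ag gder dens.
have u0 : 0 < u by exact: lt_le_trans u1.
have mg : measC g by apply: measC_entire; case: Ag.
have mW := measR_wder an omega_ni; have W0 := wder_ge0 an omega_ni.
have mN := measR_nu_p omega_ni; have N0 := nu_p_ge0 omega_gt0.
have EW h : measC h -> pint r (fun z => (u - 1) * wder omega z) h = ((u - 1)%:E * pint r (wder omega) h)%E.
  move=> mh; rewrite /pint -aintZ ?subr_ge0//.
  - by apply: eq_aint => z; rewrite mulrCA.
  - exact: measR_pint.
  - by move=> z; rewrite mulr_ge0 ?powR_ge0.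
rewrite -EW//; apply: (@le_pint_poly_dense _ r u (nu_q omega)) => //.
- exact: ltW.
- rewrite (_ : nu_q omega = (fun z => nu_p omega z + wder omega z)); first exact: measRD.
  by apply/funext => z; exact: nu_qE.
- exact: measRB mN (mom (ltW u0)).
- exact: (@measRM _ (fun=> u - 1) _ (measurable_cst _) mW).
- by move=> z; rewrite nu_qE addr_ge0.
- by move=> z; exact: omega_diff_ge0.
- by move=> z; rewrite mulr_ge0 ?subr_ge0.
- move=> z; rewrite nu_qE [leRHS]mulrDr; apply: (@le_trans _ _ (nu_p omega z)).
    by rewrite lerBlDr lerDl omega_scaled_ge0// ltW.
  by rewrite (@le_trans _ _ (u * nu_p omega z)) ?ler_peMl// lerDl mulr_ge0// ltW.
- move=> z; rewrite nu_qE [leRHS]mulrDr (@le_trans _ _ (u * wder omega z))//.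
    by rewrite ler_wpM2r// gerDl oppr_le0.
  by rewrite lerDr mulr_ge0// ltW.
- exact: Ap_nu_q.
by move=> P; rewrite EW ?aint_omega_diff_poly//; apply: measC_entire; exact: entire_poly.
Qed.

(** After a change of variable this says that g(z / s) has norm at most that of g; applied to f it
    is N <= 1. Both weights lie below [nu_p], so density there suffices. *)
Lemma pint_dilation_le (r s : R) g : 1 < r -> 1 < s -> Ap r (nu_p omega) g ->
  poly_dense r (nu_p omega) ->
  (pint r (fun z => omega (s ^+ 2 * csq z)) g <= (s ^- 2)%:E * pint r (nu_p omega) g)%E.
Proof.
move=> r1 s1 Ag dens.
have s0 : 0 < s by exact: lt_trans s1.
have i0 : 0 < s^-1 by rewrite invr_gt0.
have i1 : s^-1 < 1 by rewrite invf_lt1.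
have i2 : 0 <= s ^- 2 by rewrite invr_ge0 exprn_ge0// ltW.
have mg : measC g by apply: measC_entire; case: Ag.
have mN := measR_nu_p omega_ni; have N0 := nu_p_ge0 omega_gt0.
have EW h : measC h -> pint r (fun z => s ^- 2 * nu_p omega z) h = ((s ^- 2)%:E * pint r (nu_p omega) h)%E.
  move=> mh; rewrite /pint -aintZ//.
  - by apply: eq_aint => z; rewrite mulrCA.
  - exact: measR_pint.
  - by move=> z; rewrite mulr_ge0 ?powR_ge0.
rewrite -EW//; apply: (@le_pint_poly_dense _ r 1 (nu_p omega)) => //.
- exact: ltW.
- by apply: mom; rewrite exprn_ge0// ltW.
- exact: (@measRM _ (fun=> s ^- 2) _ (measurable_cst _) mN).
- by move=> z; rewrite omega_scaled_ge0// exprn_ge0// ltW.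
- by move=> z; rewrite mulr_ge0.
- move=> z; rewrite mul1r omega_ni ?csq_ge0//.
  by apply: ler_peMl; [exact: csq_ge0|rewrite exprn_ege1// ltW].
- by move=> z; rewrite ler_wpM2r// invf_le1 ?exprn_gt0// exprn_ege1 ?ltW.
move=> P; rewrite EW; last by apply: measC_entire; exact: entire_poly.
have := pint_dilated_weight P r1 i0 i1 mN N0 (@nu_p_rot _ _).
rewrite exprVn; congr (_ <= _)%E; apply: eq_aint => z; congr (_ * _).
rewrite /nu_p; congr omega.
rewrite csqM csqE.
have -> : RtoC s^-1 = (RtoC s)^-1 by rewrite -![RtoC _]/(real_complex R _) fmorphV.
by rewrite (invrK (RtoC s)) cabs_real ger0_norm// ltW.
Qed.

Lemma pint_nu_dilate (r s : R) (g : R[i] -> R[i]) : 0 < s -> measC g ->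
  pint r (nu_p omega) (fun z => g ((RtoC s)^-1 * z)) =
  ((s ^+ 2)%:E * pint r (fun z => omega (s ^+ 2 * csq z))%R g)%E.
Proof.
move=> s0 mg.
have sC0 : RtoC s != 0 by rewrite eq_complex /= negb_and gt_eqF.
have s2 : 0 <= s ^+ 2 by rewrite exprn_ge0// ltW.
have mO2 : measR (fun z => omega (s ^+ 2 * csq z)) by exact: mom.
have O2 z : 0 <= omega (s ^+ 2 * csq z) by exact: omega_scaled_ge0.
have := aint_cmul (invr_neq0 sC0) (measR_pint r mg mO2) (cabs_pow_ge0 r g O2).
have csV : csq (RtoC s)^-1 = s ^- 2.
  by rewrite csqE -[RtoC s]/(real_complex R s) -fmorphV cabs_real ger0_norm ?invr_ge0 ?(ltW s0)// exprVn.
rewrite csV invrK => <-; apply: eq_aint => z; rewrite csqM csV /nu_p mulrA divff ?mul1r//.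
by rewrite expf_neq0// gt_eqF.
Qed.

(** Over shrinking intervals around x the quotients (w(ut) - w(vt)) / (v - u) tend to -t w'(xt), and
    Fatou's lemma applies. Asking for just one good interval at each scale, with x anywhere in it,
    fits both uses: intervals starting at x = 1, and the negation of a local property at x. *)
Lemma pint_derivative_fatou (r x M : R) g : measC g -> 0 <= x ->
  (forall d, 0 < d -> exists u v, [/\ 0 <= u, u <= x, x <= v, x - d < u & v < x + d] /\
     u < v /\ (pint r (fun z => omega (u * csq z) - omega (v * csq z))%R g <= (M * (v - u))%:E)%E) ->
  (pint r (fun z => - (csq z * dpos omega (x * csq z)))%R g <= M%:E)%E.
Proof.
move=> mg x0 H.
have /choice[uv Huv] : forall n : nat, exists w : R * R,
    [/\ 0 <= w.1, w.1 <= x, x <= w.2, x - n.+1%:R^-1 < w.1 & w.2 < x + n.+1%:R^-1] /\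
    w.1 < w.2 /\ (pint r (fun z => omega (w.1 * csq z) - omega (w.2 * csq z))%R g <= (M * (w.2 - w.1))%:E)%E.
  by move=> n; have [u [v h]] := H n.+1%:R^-1 (ltac:(by rewrite invr_gt0)); exists (u, v).
pose D n z := omega ((uv n).1 * csq z) - omega ((uv n).2 * csq z).
have mD n : measR (D n).
  by have [[u0 ux xv _ _] _] := Huv n; apply: measR_omega_diff => //; exact: le_trans xv.
have D0 n z : 0 <= D n z.
  by have [[u0 ux xv _ _] _] := Huv n; apply: omega_scaled_diff_ge0 => //; exact: le_trans xv.
have c0 n : 0 <= ((uv n).2 - (uv n).1)^-1.
  by have [_ [h _]] := Huv n; rewrite invr_ge0 subr_ge0 ltW.
have F0 n z : 0 <= cabs (g z) `^ r * D n z by rewrite mulr_ge0 ?powR_ge0.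
apply: (@aint_fatou _ (fun n z => ((uv n).2 - (uv n).1)^-1 * (cabs (g z) `^ r * D n z))).
- move=> n; exact: (@measRM _ (fun=> _) _ (measurable_cst _) (measR_pint r mg (mD n))).
- by move=> n z; rewrite mulr_ge0.
- move=> z; under eq_fun do rewrite mulrCA; apply: cvgMl_tmp.
  apply/cvgrPdist_le => e e0.
  have t0 := csq_ge0 z; have t1 : 0 < csq z + 1 by rewrite ltr_pwDr.
  have [d d0 hd] := omega_straddle an (mulr_ge0 x0 t0) (ltac:(by rewrite divr_gt0) : 0 < e / (csq z + 1)).
  have dt : 0 < d / (csq z + 1) by rewrite divr_gt0.
  have := near_infty_natSinv_lt (PosNum dt); apply: filterS => n /=.
  rewrite ltr_pdivlMr// => nd.
  have [[u0 ux xv xu vx] [uv0 _]] := Huv n.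
  rewrite /D; move: (uv n).1 (uv n).2 u0 ux xv xu vx uv0 => u v u0 ux xv xu vx uv0.
  move: (n.+1%:R^-1) nd xu vx => i nd xu vx.
  have b : i * csq z < d by nra.
  have := hd (u * csq z) (v * csq z); rewrite !ler_wpM2r// => /(_ isT isT).
  move=> /(_ (ltac:(nra)) (ltac:(nra))) h.
  have vu0 : 0 < v - u by rewrite subr_gt0.
  rewrite distrC; set w := dpos _ _ in h *; set a := omega _ in h *; set b' := omega _ in h *.
  have -> : (v - u)^-1 * (a - b') - - (csq z * w) = (a - b' - - w * (v * csq z - u * csq z)) / (v - u).
    by field; rewrite gt_eqF.
  rewrite normrM [`|(v - u)^-1|]gtr0_norm ?invr_gt0// ler_pdivrMr// (le_trans h)//.
  have -> : e / (csq z + 1) * (v * csq z - u * csq z) = e * (v - u) * (csq z / (csq z + 1)).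
    by field; rewrite gt_eqF.
  by rewrite ler_piMr ?mulr_ge0 ?(ltW e0) ?(ltW vu0)// ler_pdivrMr// mul1r lerDl.
move=> n; rewrite aintZ//; last exact: measR_pint.
have [_ [h hM]] := Huv n.
apply: (le_trans (lee_wpmul2l _ hM)); first by rewrite lee_fin.
by rewrite -EFinM lee_fin mulrCA mulVf ?mulr1// subr_eq0 gt_eqF.
Qed.

(* Otherwise the finite monotone function v |-> int |g|^r w(vt) dA would have infinite
   slope at every point of [1, 2]. *)
Lemma exists_scaled_derivative_finite (r : R) g : Ap r (nu_p omega) g ->
  exists v : R, [/\ 1 <= v, v <= 2 &
    (pint r (fun z => - (csq z * dpos omega (v * csq z)))%R g < +oo)%E].
Proof.
move=> [eg gfin]; have mg := measC_entire eg.
apply/not_existsP => nex.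
pose K v := fine (pint r (fun z => omega (v * csq z)) g).
have Kfin v : 1 <= v -> (pint r (fun z => omega (v * csq z)) g < +oo)%E.
  move=> v1; have v0 : 0 <= v by exact: le_trans v1.
  apply: le_lt_trans gfin; apply: le_pint => //; [exact: mom|exact: measR_nu_p| |].
    by move=> z; exact: omega_scaled_ge0.
  by move=> z; rewrite omega_ni ?csq_ge0// ler_peMl ?csq_ge0.
have Kge0 v : 0 <= v -> (0 <= pint r (fun z => omega (v * csq z)) g)%E.
  by move=> v0; apply: pint_ge0 => z; exact: omega_scaled_ge0.
have KE v : 1 <= v -> pint r (fun z => omega (v * csq z)) g = (K v)%:E.
  by move=> v1; rewrite fineK// ge0_fin_numE ?Kfin// Kge0// (le_trans _ v1).
have KB u v : 1 <= u -> u <= v ->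
    pint r (fun z => omega (u * csq z) - omega (v * csq z)) g = (K u - K v)%:E.
  move=> u1 uv; have v1 := le_trans u1 uv.
  have u0 : 0 <= u by exact: le_trans u1.
  have v0 : 0 <= v by exact: le_trans v1.
  rewrite pint_weightB//; [exact: mom|exact: mom|by move=> z; exact: omega_scaled_ge0| |exact: Kfin].
  by move=> z; rewrite omega_ni ?mulr_ge0 ?csq_ge0// ler_wpM2r ?csq_ge0.
(* A slope this steep along all of [1, 2] would bring [K 2] down to at most -1. *)
pose M := K 1 + 1.
have : K 2 + M * (2 - 1) <= K 1.
  apply: (@cousin_interval _ 1 2 (fun u v => K v + M * (v - u) <= K u)); first by rewrite ler1n.
    by move=> u v w _ _ _ _; lra.
  (* If the local property fails at x, there are arbitrarily short intervals around x on which K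
     falls by less than M (v - u); the Fatou bound then makes the derivative integral at x finite,
     which was excluded. *)
  move=> x x1 x2; apply: contrapT => nd; apply: (nex x); split=> //.
  apply: (@le_lt_trans _ _ M%:E); last exact: ltry.
  apply: pint_derivative_fatou => //; first exact: le_trans x1.
  move=> d d0; apply: contrapT => nuv; apply: nd; exists d => // u v u1 v2 xu ux xv vx.
  rewrite leNgt; apply/negP => Kuv; apply: nuv; exists u, v.
  have uv : u < v.
    rewrite lt_neqAle (le_trans ux xv) andbT; apply/negP => /eqP e.
    by move: Kuv; rewrite e subrr mulr0 addr0 ltxx.
  split; first by split => //; exact: le_trans u1.
  split => //; rewrite KB// ?lee_fin ?ltW//; lra.
have : 0 <= K 2 by rewrite fine_ge0// Kge0.
rewrite /M; lra.
Qed.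

End weight_bounds.

Lemma entire_bounded (R : realType) (g : R[i] -> R[i]) (T : R) : entire g ->
  exists2 M : R, 0 <= M & forall z, csq z <= T -> cabs (g z) <= M.
Proof.
(* Since B^2 >= T, the compact square [-B, B]^2 contains the disc |z|^2 <= T. *)
move=> eg; pose B := 1 + `|T|.
have B0 : 0 <= B by rewrite addr_ge0.
pose A : set (R * R) := `[- B, B]%classic `*` `[- B, B]%classic.
have cA : compact A by apply: compact_setX; exact: segment_compact.
have A0 : A !=set0 by exists (0, 0); split; rewrite /= in_itv /= oppr_le0 B0.
have cg : {within A, continuous (fun x => cabs (g (toC x)))}.
  apply: continuous_subspaceT => x; apply/cvgrPdist_lt => e e0.
  have [d d0 gd] := cdiff_cont (eg (toC x)) e0.
  have d2 : 0 < d / 2 by rewrite divr_gt0.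
  exists (ball x.1 (d / 2), ball x.2 (d / 2)); first by split; exact: nbhsx_ballx.
  move=> y [/= y1 y2]; apply: le_lt_trans (cabs_dist _ _) _.
  have -> : toC y = toC x + (toC y - toC x) by rewrite addrC subrK.
  apply: gd; apply: (@le_lt_trans _ _ (`|x.1 - y.1| + `|x.2 - y.2|)); last by rewrite (splitr d) ltrD.
  rewrite -(@ler_pXn2r _ 2) ?nnegrE ?cabs_ge0 ?addr_ge0// -csqE /csq /= [leRHS]sqrrD !real_normK ?num_real//.
  by rewrite -sqrrN opprB -[X in _ + X]sqrrN opprB addrAC lerDl mulrn_wge0// mulr_ge0.
have [c _ hc] := compact_EVT_max A0 cA cg.
exists (cabs (g (toC c))); first exact: cabs_ge0.
move=> z zT; have -> : z = toC (complex.Re z, complex.Im z) by case: z {zT}.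
apply: hc; rewrite inE.
have TB : csq z <= B ^+ 2.
  rewrite (le_trans zT)// (le_trans (ler_norm _))// /B.
  by move: `|T| (normr_ge0 T) => t t0; nra.
have coord a : a ^+ 2 <= B ^+ 2 -> - B <= a <= B.
  by rewrite -ler_norml -(@ler_pXn2r _ 2 _ `|a|)// ?nnegrE ?normr_ge0// real_normK ?num_real.
by split; rewrite /= in_itv /=; apply: coord; apply: le_trans TB; rewrite /csq ?lerDl ?lerDr sqr_ge0.
Qed.

(** * Complex integrals *)

Definition cintegrable (R : realType) (F : R[i] -> R[i]) : Prop :=
  measC F /\ (aint (fun z => cabs (F z)) < +oo)%E.

Lemma cintegrable_Re (R : realType) (F : R[i] -> R[i]) : cintegrable F ->
  area.-integrable setT (EFin \o ((fun z => complex.Re (F z)) \o toC)).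
Proof.
move=> [[mr mi] Ffin]; apply/integrableP; split; first exact/measurable_EFinP.
apply: le_lt_trans Ffin; apply: ge0_le_integral => //.
- by apply/measurable_EFinP; apply: measurableT_comp => //.
- by apply/measurable_EFinP; apply: measR_cabs.
by move=> x _; rewrite /= lee_fin Re_le_cabs.
Qed.

Lemma cintegrable_Im (R : realType) (F : R[i] -> R[i]) : cintegrable F ->
  area.-integrable setT (EFin \o ((fun z => complex.Im (F z)) \o toC)).
Proof.
move=> [[mr mi] Ffin]; apply/integrableP; split; first exact/measurable_EFinP.
apply: le_lt_trans Ffin; apply: ge0_le_integral => //.
- by apply/measurable_EFinP; apply: measurableT_comp => //.
- by apply/measurable_EFinP; apply: measR_cabs.
by move=> x _; rewrite /= lee_fin Im_le_cabs.
Qed.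

Lemma cintegrable_le (R : realType) (F : R[i] -> R[i]) (G : R[i] -> R) : measC F -> measR G ->
  (forall z, cabs (F z) <= G z) -> (aint G < +oo)%E -> cintegrable F.
Proof.
move=> mF mG FG Gfin; split=> //; apply: le_lt_trans Gfin.
by apply: le_aint => //; [exact: measR_cabs|move=> z; exact: cabs_ge0].
Qed.

Lemma eq_cint (R : realType) (F G : R[i] -> R[i]) : (forall z, F z = G z) -> cint F = cint G.
Proof. by move=> FG; congr cint; exact/funext. Qed.

Lemma cintegrableD (R : realType) (F G : R[i] -> R[i]) : cintegrable F -> cintegrable G ->
  cintegrable (fun z => F z + G z).
Proof.
move=> [mF Ff] [mG Gf]; apply: (@cintegrable_le _ _ (fun z => cabs (F z) + cabs (G z))).
- exact: measCD.
- exact: measRD (measR_cabs mF) (measR_cabs mG).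
- by move=> z; exact: cabsD.
rewrite aintD; first exact: lte_add_pinfty.
- exact: measR_cabs.
- exact: measR_cabs.
- by move=> z; exact: cabs_ge0.
- by move=> z; exact: cabs_ge0.
Qed.

Lemma cintegrableZ (R : realType) (c : R[i]) (F : R[i] -> R[i]) : cintegrable F ->
  cintegrable (fun z => c * F z).
Proof.
move=> [mF Ff]; split; first by apply: measCM => //; exact: measC_cst.
under eq_aint do rewrite cabsM.
rewrite aintZ ?cabs_ge0//; [|exact: measR_cabs|by move=> z; exact: cabs_ge0].
by rewrite lte_mul_pinfty ?lee_fin ?cabs_ge0.
Qed.

Lemma rintE (R : realType) (F : R[i] -> R) : measR F -> rint F = fine (aint F).
Proof.
move=> mF; rewrite /rint /aint /Rintegral; congr fine.
have mE : measurable_fun [set: R * R] (fun x : R * R => (F (toC x))%:E) by exact/measurable_EFinP.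
rewrite integralE [RHS]integralE; congr (_ - _)%E; symmetry.
  by apply: area_prod => //; exact: measurable_funepos.
by apply: area_prod => //; exact: measurable_funeneg.
Qed.

Lemma rintD (R : realType) (F G : R[i] -> R) :
  area.-integrable setT (EFin \o (F \o toC)) -> area.-integrable setT (EFin \o (G \o toC)) ->
  rint (fun z => F z + G z) = rint F + rint G.
Proof.
move=> iF iG.
have mF : measR F by apply/measurable_EFinP; exact: measurable_int iF.
have mG : measR G by apply/measurable_EFinP; exact: measurable_int iG.
rewrite rintE ?rintE//; last exact: measRD.
by rewrite /aint integralD_EFin// fineD//; exact: integrable_fin_num.
Qed.

Lemma rintZ (R : realType) (c : R) (F : R[i] -> R) :
  area.-integrable setT (EFin \o (F \o toC)) -> rint (fun z => c * F z) = c * rint F.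
Proof.
move=> iF; have mF : measR F by apply/measurable_EFinP; exact: measurable_int iF.
rewrite rintE ?rintE//; last exact: (@measRM _ (fun=> c) _ (measurable_cst _)).
by rewrite /aint; under eq_integral do rewrite EFinM; rewrite integralZl// fineM//; exact: integrable_fin_num.
Qed.

Lemma eq_rint (R : realType) (F G : R[i] -> R) : (forall z, F z = G z) -> rint F = rint G.
Proof. by move=> FG; congr rint; exact/funext. Qed.

Lemma cintD (R : realType) (F G : R[i] -> R[i]) : cintegrable F -> cintegrable G ->
  cint (fun z => F z + G z) = cint F + cint G.
Proof.
move=> iF iG; apply/eqP; rewrite eq_complex /=; apply/andP; split; apply/eqP.
  by rewrite -rintD; [apply: eq_rint => z; case: (F _) (G _) => [a b] [c d]|exact: cintegrable_Re|exact: cintegrable_Re].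
by rewrite -rintD; [apply: eq_rint => z; case: (F _) (G _) => [a b] [c d]|exact: cintegrable_Im|exact: cintegrable_Im].
Qed.

Lemma cintZ (R : realType) (c : R[i]) (F : R[i] -> R[i]) : cintegrable F ->
  cint (fun z => c * F z) = c * cint F.
Proof.
move=> iF; have iR := cintegrable_Re iF; have iI := cintegrable_Im iF.
case: c => a b; apply/eqP; rewrite eq_complex /=; apply/andP; split; apply/eqP.
  rewrite -mulNr -!rintZ// -rintD; last 2 first.
  - exact: (integrableZl measurableT a iR).
  - exact: (integrableZl measurableT (- b) iI).
  by apply: eq_rint => z; case: (F _) => x y /=; rewrite mulNr.
rewrite -!rintZ// -rintD; last 2 first.
- exact: (integrableZl measurableT a iI).
- exact: (integrableZl measurableT b iR).
by apply: eq_rint => z; case: (F _).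
Qed.

Lemma cintB (R : realType) (F G : R[i] -> R[i]) : cintegrable F -> cintegrable G ->
  cint (fun z => F z - G z) = cint F - cint G.
Proof.
move=> iF iG; under eq_cint do rewrite -mulN1r.
by rewrite cintD ?cintZ ?mulN1r//; exact: cintegrableZ.
Qed.

Lemma exists_unit_mul (R : realType) (c : R[i]) : exists2 u : R[i], cabs u = 1 & u * c = RtoC (cabs c).
Proof.
have [->|c0] := eqVneq c 0; first by exists 1; rewrite ?cabs1// mul1r cabs0.
have a0 : cabs c != 0 by rewrite cabs_eq0.
exists (cconj c * RtoC (cabs c)^-1).
  by rewrite cabsM cabs_conj cabs_real ger0_norm ?invr_ge0 ?cabs_ge0// divff.
rewrite mulrAC [_ * c]mulrC mul_conj_csq csqE -![RtoC _]/(real_complex R _) -rmorphM; congr (real_complex R _).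
by rewrite expr2 mulfK.
Qed.

(** Multiplying F by a unit that makes its integral real and nonnegative turns the modulus of the
    integral into the integral of a real part. *)
Lemma cabs_cint_le (R : realType) (F : R[i] -> R[i]) : cintegrable F ->
  ((cabs (cint F))%:E <= aint (fun z => cabs (F z)))%E.
Proof.
move=> iF; have [u u1 uE] := exists_unit_mul (cint F).
have -> : cabs (cint F) = complex.Re (cint (fun z => u * F z)) by rewrite cintZ// uE.
have iuF := cintegrableZ u iF; have iR := cintegrable_Re iuF.
have mR0 : measR (fun z => complex.Re (u * F z)) by case: iuF => -[].
rewrite /= rintE// fineK; last exact: integrable_fin_num.
apply: le_trans (_ : (_ <= \int[area]_(x in [set: R * R]) `|(complex.Re (u * F (toC x)))%:E|))%E _.
  apply: le_trans (le_abse_integral _ _ _) => //; first exact: lee_abs.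
  exact: measurable_int iR.
apply: ge0_le_integral => //.
- by apply/measurable_EFinP; apply: measurableT_comp.
- by apply/measurable_EFinP; apply: measR_cabs; case: iF.
by move=> x _; rewrite /= lee_fin (le_trans (Re_le_cabs _))// cabsM u1 mul1r.
Qed.

Lemma rint_cmul (R : realType) (w : R[i]) (F : R[i] -> R) : w != 0 ->
  area.-integrable setT (EFin \o (F \o toC)) ->
  rint (fun z => F (w * z)) = (csq w)^-1 * rint F.
Proof.
move=> w0 iF; have mF : measR F by apply/measurable_EFinP; exact: measurable_int iF.
rewrite rintE; last exact: measR_cmul.
by rewrite rintE// integral_area_cmul// fineM//; exact: integrable_fin_num.
Qed.

Lemma cint_cmul (R : realType) (w : R[i]) (F : R[i] -> R[i]) : w != 0 -> cintegrable F ->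
  cint (fun z => F (w * z)) = RtoC (csq w)^-1 * cint F.
Proof.
move=> w0 iF.
have := rint_cmul w0 (cintegrable_Re iF); have := rint_cmul w0 (cintegrable_Im iF).
rewrite /cint => -> ->.
by apply/eqP; rewrite eq_complex /= !mul0r subr0 addr0 !eqxx.
Qed.

(** * Tails of integrals and moments of the weight *)

Lemma measR_le_csq (R : realType) (T : R) : measR (fun z : R[i] => (csq z <= T)%R%:R : R).
Proof.
apply: (@measR_comp _ (fun s => (s <= T)%R%:R)); apply: nonincreasing_measurable => // x y xy.
by rewrite ler_nat; case: (leP y T) => // /(le_trans xy) ->.
Qed.

Lemma measR_lt_csq (R : realType) (T : R) : measR (fun z : R[i] => (T < csq z)%R%:R : R).
Proof.
apply: (@measR_comp _ (fun s => (T < s)%R%:R)); apply: nondecreasing_measurable => // x y xy.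
by rewrite ler_nat; case: (ltP T x) => // /lt_le_trans ->.
Qed.

(** If every tail exceeded e, all truncated integrals would be at most [aint F - e], and Fatou's
    lemma would give this bound for [aint F] itself. *)
Lemma aint_tail (R : realType) (F : R[i] -> R) (e : R) : measR F -> (forall z, 0 <= F z) ->
  (aint F < +oo)%E -> 0 < e ->
  exists2 T : R, 0 < T & (aint (fun z => F z * (T < csq z)%R%:R)%R <= e%:E)%E.
Proof.
move=> mF F0 Ffin e0; apply: contrapT => nT.
have AE : aint F = (fine (aint F))%:E by rewrite fineK// ge0_fin_numE// aint_ge0.
have ind0 (b : bool) z : 0 <= F z * b%:R by rewrite mulr_ge0.
have : (aint F <= aint F - e%:E)%E.
  apply: (@aint_fatou _ (fun (n : nat) z => F z * (csq z <= n.+1%:R)%R%:R)) => //.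
  - by move=> n; exact: (measRM mF (measR_le_csq _)).
  - move=> z; apply: cvg_near_cst; near=> n.
    have -> : csq z <= n.+1%:R; last by rewrite mulr1.
    rewrite (@le_trans _ _ n%:R)// ?ler_nat//; near: n; exact: nbhs_infty_ger.
  move=> n; rewrite leeBrDr//.
  have -> : aint F = (aint (fun z => F z * (csq z <= n.+1%:R)%R%:R)%R + aint (fun z => F z * (n.+1%:R < csq z)%R%:R)%R)%E.
    rewrite -aintD//; [|exact: (measRM mF (measR_le_csq _))|exact: (measRM mF (measR_lt_csq _))].
    by apply: eq_aint => z; rewrite -mulrDr ltNge; case: (_ <= _); rewrite /= ?addr0 ?add0r mulr1.
  rewrite leeD2l// leNgt; apply/negP => /ltW h; apply: nT; exists n.+1%:R => //.
rewrite AE -EFinB lee_fin; lra.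
Unshelve. all: by end_near. Qed.

Lemma integral_oneDsqrV (R : realType) :
  (\int[lebesgue_measure]_(x in [set: R]) ((1 + x ^+ 2)^-1)%:E = pi%:E :> \bar R)%E.
Proof.
have := @ge0_symfun_integralT R (fun x => (1 + x ^+ 2)^-1).
rewrite -set_itvcy => ->.
- by have /= -> := @integral0y_oneDsqr R; rewrite -EFinM mulrCA divff ?mulr1.
- by move=> x; rewrite invr_ge0 addr_ge0 ?sqr_ge0.
- exact: continuous_oneDsqrV.
- by move=> x /=; rewrite sqrrN.
Qed.

(** The product form reduces the integral by Tonelli to two arctangent integrals, of total value
    pi^2. The function is the integrable majorant used for the moments of the weight. *)
Lemma aint_inv_quadratic (R : realType) :
  (aint (fun z : R[i] => ((1 + complex.Re z ^+ 2)^-1 * (1 + complex.Im z ^+ 2)^-1)%R) < +oo)%E.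
Proof.
have d0 (x : R) : 0 <= (1 + x ^+ 2)^-1 by rewrite invr_ge0 addr_ge0 ?sqr_ge0.
have m0 : measurable_fun [set: R] (fun x => (1 + x ^+ 2)^-1).
  by apply: continuous_measurable_fun; exact: continuous_oneDsqrV.
rewrite /aint area_tonelli1; last 2 first.
- apply/measurable_EFinP; apply: measurable_funM.
    exact: (measurableT_comp m0 measurable_fst).
  exact: (measurableT_comp m0 measurable_snd).
- by move=> x; rewrite lee_fin mulr_ge0.
have mE : measurable_fun [set: measurableTypeR R] (fun y : measurableTypeR R => ((1 + y ^+ 2)^-1)%:E).
  exact/measurable_EFinP.
have inner (x : R) : (\int[lebesgue_measure]_(y in [set: measurableTypeR R]) ((1 + x ^+ 2)^-1 * (1 + y ^+ 2)^-1)%:E =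
    pi%:E * ((1 + x ^+ 2)^-1)%:E)%E.
  under eq_integral do rewrite EFinM.
  rewrite (@ge0_integralZl _ (measurableTypeR R) R lebesgue_measure setT measurableT _ mE) ?lee_fin//.
    by rewrite integral_oneDsqrV muleC.
  by move=> y _; rewrite lee_fin.
under eq_integral => x _ do rewrite inner.
rewrite (@ge0_integralZl _ (measurableTypeR R) R lebesgue_measure setT measurableT _ mE) ?lee_fin ?pi_ge0//.
  by rewrite integral_oneDsqrV -EFinM ltry.
by move=> y _; rewrite lee_fin.
Qed.

Section weight_moments.
Context {R : realType} {omega : R -> R}.
Hypothesis omega_gt0 : forall x, 0 <= x -> 0 < omega x.
Hypothesis omega_ni : forall x y, 0 <= x -> x <= y -> omega y <= omega x.
Hypothesis omega_decay : forall n : int, (r ^ n * omega (r ^+ 2)) @[r --> +oo] --> (0 : R).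

(** The factor (1 + r^2)^2 pays for comparison with the majorant 1 / ((1 + x^2)(1 + y^2)), as (1 +
    x^2)(1 + y^2) <= (1 + |z|^2)^2. *)
Lemma omega_decay_bound (n : nat) : exists2 C : R, 0 < C & forall r : R, 0 <= r ->
  r ^+ n * omega (r ^+ 2) * (1 + r ^+ 2) ^+ 2 <= C.
Proof.
(* The four extra powers absorb (1 + r^2)^2 <= 4 r^4, valid for r >= 1; on [0, r1] the monotonicity
   of omega gives the bound [A]. *)
have /cvgrPdist_le/(_ 1 ltr01) [r0 [_ hr0]] := omega_decay (n + 4)%N%:Z.
pose r1 := Num.max 1 (r0 + 1).
have r11 : 1 <= r1 by rewrite le_max lexx.
have r10 : r0 < r1 by rewrite lt_max ltrDl ltr01 orbT.
have w0 : 0 < omega 0 by exact: omega_gt0.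
pose A := r1 ^+ n * omega 0 * (1 + r1 ^+ 2) ^+ 2.
have A0 : 0 <= A by rewrite !mulr_ge0 ?exprn_ge0 ?addr_ge0 ?sqr_ge0 ?(ltW w0)// (le_trans ler01).
exists (4 + A); first by rewrite ltr_pwDl.
move=> r r_ge0; have wr : 0 <= omega (r ^+ 2) by rewrite ltW// omega_gt0// sqr_ge0.
case: (leP r r1) => rr1.
  rewrite (@le_trans _ _ A)// ?lerDr// /A.
  rewrite ler_pM ?mulr_ge0 ?exprn_ge0 ?addr_ge0 ?sqr_ge0//.
    rewrite ler_pM ?exprn_ge0// ?lerXn2r ?nnegrE ?(le_trans ler01 r11)//.
    by apply: omega_ni => //; exact: sqr_ge0.
  by rewrite !lerXn2r ?nnegrE ?addr_ge0 ?sqr_ge0// ?lerD2l ?lerXn2r ?nnegrE ?(le_trans ler01 r11).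
have r1' : 1 <= r by rewrite (le_trans r11)// ltW.
have := hr0 r (lt_trans r10 rr1); rewrite sub0r normrN => /(le_trans (ler_norm _)).
rewrite -exprnP exprD => h.
have rr : 1 <= r ^+ 2 by rewrite exprn_ege1.
have h2 : (1 + r ^+ 2) ^+ 2 <= 4 * r ^+ 4.
  have -> : r ^+ 4 = r ^+ 2 * r ^+ 2 by rewrite -exprD.
  by rewrite expr2; nra.
have rn : 0 <= r ^+ n * omega (r ^+ 2) by rewrite mulr_ge0// exprn_ge0.
apply: (@le_trans _ _ 4); last by rewrite lerDl.
apply: (le_trans (ler_wpM2l rn h2)).
have -> : r ^+ n * omega (r ^+ 2) * (4 * r ^+ 4) = 4 * (r ^+ n * r ^+ 4 * omega (r ^+ 2)) by ring.
by rewrite ler_piMr.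
Qed.

Lemma aint_moment_lty (n : nat) : (aint (fun z => cabs z ^+ n * nu_p omega z)%R < +oo)%E.
Proof.
have [C C0 hC] := omega_decay_bound n.
have mcabs : measR (@cabs R) by apply: measR_cabs; apply: measC_entire; exact: entire_id.
pose q (z : R[i]) := (1 + complex.Re z ^+ 2)^-1 * (1 + complex.Im z ^+ 2)^-1.
have q0 z : 0 <= q z by rewrite mulr_ge0// invr_ge0 addr_ge0 ?sqr_ge0.
have mq : measR q.
  have m0 : measurable_fun [set: R] (fun x => (1 + x ^+ 2)^-1).
    by apply: continuous_measurable_fun; exact: continuous_oneDsqrV.
  apply: measurable_funM.
    exact: (measurableT_comp m0 measurable_fst).
  exact: (measurableT_comp m0 measurable_snd).
apply: (@le_lt_trans _ _ (aint (fun z => C * q z))).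
  apply: le_aint.
  - by apply: measRM; [exact: measurable_funX|exact: measR_nu_p].
  - exact: (@measRM _ (fun=> C) _ (measurable_cst _) mq).
  - by move=> z; rewrite mulr_ge0 ?exprn_ge0 ?cabs_ge0 ?(nu_p_ge0 omega_gt0).
  move=> z; have := hC (cabs z) (cabs_ge0 z); rewrite -csqE => h.
  have a1 : 0 < 1 + complex.Re z ^+ 2 by rewrite ltr_pwDl ?sqr_ge0.
  have b1 : 0 < 1 + complex.Im z ^+ 2 by rewrite ltr_pwDl ?sqr_ge0.
  rewrite /q -invfM ler_pdivlMr ?mulr_gt0//; apply: le_trans h.
  rewrite ler_wpM2l ?mulr_ge0 ?exprn_ge0 ?cabs_ge0 ?(nu_p_ge0 omega_gt0)//.
  rewrite /csq expr2; have := sqr_ge0 (complex.Re z); have := sqr_ge0 (complex.Im z).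
  by move: (_ ^+ 2) (_ ^+ 2) => a b; nra.
by rewrite aintZ ?(ltW C0)// lte_mul_pinfty ?lee_fin ?(ltW C0)// aint_inv_quadratic.
Qed.

Lemma pint_monomial_lty (r : R) (n : nat) : 1 <= r -> (pint r (nu_p omega) (fun z => z ^+ n)%R < +oo)%E.
Proof.
move=> r1; have r0 : 0 <= r by exact: le_trans r1.
(* An integer at least n r: |z|^(n r) is at most 1 in the unit disc and at most |z|^m outside it. *)
pose m := (n * (Num.truncn r).+1)%N.
have mcabs : measR (@cabs R) by apply: measR_cabs; apply: measC_entire; exact: entire_id.
have N0 := nu_p_ge0 omega_gt0; have mN := measR_nu_p omega_ni.
apply: (@le_lt_trans _ _ (aint (fun z => cabs z ^+ 0 * nu_p omega z + cabs z ^+ m * nu_p omega z)%R)).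
  have mX k : measR (fun z => cabs z ^+ k * nu_p omega z).
    by apply: measRM => //; exact: measurable_funX.
  apply: le_aint.
  - by apply: measR_pint => //; apply: measC_entire; exact: entireX.
  - exact: measRD.
  - by move=> z; rewrite mulr_ge0 ?powR_ge0.
  move=> z; rewrite -mulrDl ler_wpM2r// cabsX; set c := cabs z.
  have c0 : 0 <= c by exact: cabs_ge0.
  rewrite -powR_mulrn// -powRrM expr0.
  have [c1|c1] := leP c 1.
    rewrite (@le_trans _ _ 1)// ?lerDl ?exprn_ge0//.
    have := @ge0_ler_powR R (n%:R * r); rewrite mulr_ge0// => /(_ isT c 1).
    by rewrite !nnegrE powR1 => /(_ c0 ler01 c1).
  rewrite (@le_trans _ _ (c ^+ m))// ?lerDr// -powR_mulrn// ler_powR ?(ltW c1)//.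
  rewrite /m natrM ler_wpM2l//.
  have /andP[_ /ltW] := truncn_itv r0; exact.
rewrite aintD.
- by apply: lte_add_pinfty; exact: aint_moment_lty.
- by apply: measRM => //; exact: measurable_funX.
- by apply: measRM => //; exact: measurable_funX.
- by move=> z; rewrite mulr_ge0 ?exprn_ge0 ?cabs_ge0.
- by move=> z; rewrite mulr_ge0 ?exprn_ge0 ?cabs_ge0.
Qed.

End weight_moments.

Lemma cconj_expi (R : realType) (x : R) : cconj (expi x) = expi (- x).
Proof. by rewrite /expi /cconj /= cosN sinN. Qed.

Lemma cconjM (R : realType) (x y : R[i]) : cconj (x * y) = cconj x * cconj y.
Proof. by case: x y => [a b] [c d]; apply/eqP; rewrite eq_complex /=; apply/andP; split; apply/eqP; ring. Qed.

Lemma cconjD (R : realType) (x y : R[i]) : cconj (x + y) = cconj x + cconj y.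
Proof. by case: x y => [a b] [c d]; apply/eqP; rewrite eq_complex /= opprD !eqxx. Qed.

Lemma cconjN (R : realType) (x : R[i]) : cconj (- x) = - cconj x.
Proof. by case: x => [a b]; apply/eqP; rewrite eq_complex /= !eqxx. Qed.

Lemma cconjX (R : realType) (x : R[i]) n : cconj (x ^+ n) = cconj x ^+ n.
Proof.
elim: n => [|n IH]; last by rewrite !exprS cconjM IH.
by rewrite !expr0; apply/eqP; rewrite eq_complex /= oppr0 !eqxx.
Qed.

Lemma cint_real (R : realType) (G : R[i] -> R) : cint (fun z => RtoC (G z)) = RtoC (rint G).
Proof.
apply/eqP; rewrite eq_complex /= eqxx /=.
by rewrite rintE; [rewrite /aint integral0|exact: measurable_cst].
Qed.

Lemma cint_sum (R : realType) n (F : 'I_n -> R[i] -> R[i]) : (forall i, cintegrable (F i)) ->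
  cintegrable (fun z => \sum_i F i z) /\ cint (fun z => \sum_i F i z) = \sum_i cint (F i).
Proof.
elim: n F => [|n IH] F iF.
  have E (z : R[i]) : \sum_(i < 0) F i z = 0 by rewrite big_ord0.
  split.
    rewrite (_ : (fun z => _) = (fun=> 0)); last by apply/funext.
    split; first exact: measC_cst.
    by rewrite /aint integral0_eq// => x _; rewrite cabs0.
  rewrite big_ord0 (eq_cint E) -[0]/(RtoC 0) (@cint_real R (fun=> 0)).
  by rewrite rintE; [rewrite /aint integral0|exact: measurable_cst].
have E z : \sum_(i < n.+1) F i z = F ord0 z + \sum_(i < n) F (lift ord0 i) z by rewrite big_ord_recl.
have [i1 e1] := IH (fun i => F (lift ord0 i)) (fun i => iF _).
split.
  rewrite (_ : (fun z => _) = (fun z => F ord0 z + \sum_(i < n) F (lift ord0 i) z)); last exact/funext.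
  exact: cintegrableD.
by rewrite (eq_cint E) cintD// e1 big_ord_recl.
Qed.

Lemma aint_gt0 (R : realType) (G : R[i] -> R) (c r : R) (z0 : R[i]) : measR G -> (forall z, 0 <= G z) ->
  0 < c -> 0 < r ->
  (forall z, `|complex.Re z - complex.Re z0| < r -> `|complex.Im z - complex.Im z0| < r -> c <= G z) ->
  (0 < aint G)%E.
Proof.
move=> mG G0 c0 r0 Gc.
pose A : set R := `](complex.Re z0 - r), (complex.Re z0 + r)[%classic.
pose B : set R := `](complex.Im z0 - r), (complex.Im z0 + r)[%classic.
have mAB : measurable (A `*` B) by apply: measurableX; exact: measurable_itv.
have E : (\int[area]_(x in [set: R * R]) (c * \1_(A `*` B) x)%:E = c%:E * area (A `*` B))%E.
  under eq_integral do rewrite EFinM.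
  rewrite ge0_integralZl ?lee_fin ?(ltW c0)//; last first.
    by apply/measurable_EFinP; exact: measurable_indic.
  by rewrite integral_indic// setIT.
apply: (@lt_le_trans _ _ (c%:E * area (A `*` B))%E).
  rewrite mule_gt0 ?lte_fin//.
  have -> : area (A `*` B) = (lebesgue_measure A * lebesgue_measure B)%E.
    by rewrite /area product_measure1E//; exact: measurable_itv.
  have lt2 x : x - r < x + r by lra.
  rewrite /A /B !lebesgue_measure_itv/= !lte_fin !lt2 -!EFinB -EFinM lte_fin.
  by rewrite mulr_gt0//; lra.
rewrite -E; apply: ge0_le_integral => //.
- by move=> x _; rewrite lee_fin mulr_ge0 ?(ltW c0)// indicE.
- apply/measurable_EFinP; apply: measurable_funM => //; exact: measurable_indic.
- exact/measurable_EFinP.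
move=> [x y] _; rewrite lee_fin indicE; case: (boolP (_ \in _)) => [|_]; last by rewrite mulr0.
rewrite inE /A /B => -[] /=; rewrite !in_itv /= => /andP[h1 h2] /andP[h3 h4]; rewrite mulr1.
by apply: Gc => /=; rewrite ltr_norml; apply/andP; split; lra.
Qed.

Lemma le0_of_small (R : realType) (x B : R) : 0 <= B -> (forall e, 0 < e -> x <= B * e) -> x <= 0.
Proof.
move=> B0 h; rewrite leNgt; apply/negP => x0.
have B1 : 0 < B + 1 by rewrite ltr_pwDr.
have := h (x / (B + 1)) (ltac:(by rewrite divr_gt0)).
by rewrite mulrCA -ler_pdivrMl// mulVf ?gt_eqF// ler_pdivlMr// mul1r gerDl ler10.
Qed.

Lemma cconj_sum (R : realType) n (F : 'I_n -> R[i]) : cconj (\sum_i F i) = \sum_i cconj (F i).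
Proof.
elim/big_ind2 : _ => [|x a y b <- <-|//]; last by rewrite cconjD.
by apply/eqP; rewrite eq_complex /= oppr0 !eqxx.
Qed.

(** * Moments of the kernel *)

Section kernel_moments.
Context {R : realType} {omega : R -> R} {p q : R} {k : R[i] -> R[i]}.
Hypothesis an : analytic_near_halfline omega.
Hypothesis omega_gt0 : forall x, 0 <= x -> 0 < omega x.
Hypothesis omega_ni : forall x y, 0 <= x -> x <= y -> omega y <= omega x.
Hypothesis omega_decay : forall n : int, (r ^ n * omega (r ^+ 2)) @[r --> +oo] --> (0 : R).
Hypothesis p1 : 1 < p.
Hypothesis q1 : 1 < q.
Hypothesis pq : p^-1 + q^-1 = 1.
Hypothesis Ak : Ap q (nu_p omega) k.
Hypothesis dens : poly_dense q (nu_q omega).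

Let p0 : 0 < p := lt_trans ltr01 p1.
Let q0 : 0 < q := lt_trans ltr01 q1.
Let mN : measR (nu_p omega) := measR_nu_p omega_ni.
Let N0 := nu_p_ge0 omega_gt0.
Let mk : measC k := measC_entire (proj1 Ak).
Let mcabs : measR (@cabs R) := measR_cabs (measC_entire (@entire_id R)).
Let mX n : measC (fun z : R[i] => z ^+ n) := measC_entire (@entireX R n).

Lemma wnorm_lty (r : R) W g : (pint r W g < +oo)%E -> (wnorm r W g < +oo)%E.
Proof. exact: poweR_lty. Qed.

Lemma pairing_integrable (g : R[i] -> R[i]) (psi : R[i] -> R) (C : R) : measC g ->
  (pint p (nu_p omega) g < +oo)%E -> measR psi -> 0 <= C ->
  (forall z, `|psi z| <= C * nu_p omega z) ->
  cintegrable (fun z => g z * cconj (k z) * RtoC (psi z)).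
Proof.
move=> mg gfin mpsi C0 psiC.
have mG : measR (fun z => cabs (g z) * cabs (k z) * nu_p omega z).
  by apply: measRM => //; apply: measRM; exact: measR_cabs.
have G0 z : 0 <= cabs (g z) * cabs (k z) * nu_p omega z by rewrite !mulr_ge0 ?cabs_ge0.
apply: (@cintegrable_le _ _ (fun z => C * (cabs (g z) * cabs (k z) * nu_p omega z))).
- by apply: measCM; [apply: measCM => //; exact: measC_conj|exact: measC_real].
- exact: (@measRM _ (fun=> C) _ (measurable_cst _) mG).
- move=> z; rewrite !cabsM cabs_conj cabs_real mulrCA ler_wpM2l//.
  by rewrite mulr_ge0 ?cabs_ge0.
rewrite aintZ// lte_mul_pinfty ?lee_fin//.
apply: le_lt_trans (aint_hoelder p0 q0 pq N0 mg mk mN) _.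
apply: lte_mul_pinfty; [exact: poweR_ge0| |by apply: wnorm_lty; case: Ak].
by rewrite ge0_fin_numE ?poweR_ge0//; exact: wnorm_lty.
Qed.

Lemma monomials_integrable (i j : nat) (psi : R[i] -> R) (C : R) : measR psi -> 0 <= C ->
  (forall z, `|psi z| <= C * nu_p omega z) ->
  cintegrable (fun z => z ^+ j * cconj (z ^+ i) * RtoC (psi z)).
Proof.
move=> mpsi C0 psiC.
have mG n : measR (fun z => cabs z ^+ n * nu_p omega z).
  by apply: measRM => //; exact: measurable_funX.
apply: (@cintegrable_le _ _ (fun z => C * (cabs z ^+ (j + i) * nu_p omega z))).
- by apply: measCM; [apply: measCM => //; exact: measC_conj|exact: measC_real].
- exact: (@measRM _ (fun=> C) _ (measurable_cst _) (mG _)).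
- move=> z; rewrite !cabsM cabs_conj cabs_real !cabsX exprD mulrCA ler_wpM2l//.
  by rewrite mulr_ge0 ?exprn_ge0 ?cabs_ge0.
rewrite aintZ//; last by move=> z; rewrite mulr_ge0 ?exprn_ge0 ?cabs_ge0.
by rewrite lte_mul_pinfty ?lee_fin// aint_moment_lty.
Qed.

(** A rotation by the angle pi / (j - i) leaves the integral unchanged but multiplies the integrand
    by exp(i pi) = -1. *)
Lemma monomials_orthogonal (i j : nat) (psi : R[i] -> R) (C : R) : measR psi -> 0 <= C ->
  (forall z, `|psi z| <= C * nu_p omega z) ->
  (forall u z, cabs u = 1 -> psi (u * z) = psi z) -> i != j ->
  cint (fun z => z ^+ j * cconj (z ^+ i) * RtoC (psi z)) = 0.
Proof.
move=> mpsi C0 psiC psi_rot ij.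
have iF := monomials_integrable i j mpsi C0 psiC.
pose x : R := pi / (j%:R - i%:R).
have d0 : j%:R - i%:R != 0 :> R by rewrite subr_eq0 eqr_nat eq_sym.
have u1 : cabs (expi x) = 1 by exact: expi_cabs.
have E z : (expi x * z) ^+ j * cconj ((expi x * z) ^+ i) * RtoC (psi (expi x * z)) =
    -1 * (z ^+ j * cconj (z ^+ i) * RtoC (psi z)).
  rewrite psi_rot// !exprMn cconjM [cconj (expi x ^+ i)]cconjX cconj_expi mulrACA !expiX -expiD.
  have -> : x * j%:R + - x * i%:R = pi by rewrite /x; field.
  by rewrite expi_pi; ring.
have := cint_cmul (expi_neq0 x) iF; rewrite (eq_cint E) cintZ// expi_csq invr1.
rewrite -[RtoC 1]/(1 : R[i]) mul1r mulN1r => /eqP; rewrite eq_sym -subr_eq0 opprK -mulr2n.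
by rewrite mulrn_eq0 => /eqP.
Qed.

Lemma monomial_diagonal (j : nat) (psi : R[i] -> R) :
  cint (fun z => z ^+ j * cconj (z ^+ j) * RtoC (psi z)) = RtoC (rint (fun z => csq z ^+ j * psi z)).
Proof.
rewrite -cint_real; apply: eq_cint => z.
rewrite cconjX -exprMn mul_conj_csq -[RtoC (csq z)]/(real_complex R _) -rmorphXn.
by rewrite -[RHS]/(real_complex R _) rmorphM.
Qed.

Lemma cint_monomial_poly (j : nat) (P : {poly R[i]}) (psi : R[i] -> R) (C : R) : measR psi -> 0 <= C ->
  (forall z, `|psi z| <= C * nu_p omega z) ->
  (forall u z, cabs u = 1 -> psi (u * z) = psi z) ->
  rint (fun z => csq z ^+ j * psi z) = 0 ->
  cintegrable (fun z => z ^+ j * cconj P.[z] * RtoC (psi z)) /\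
  cint (fun z => z ^+ j * cconj P.[z] * RtoC (psi z)) = 0.
Proof.
move=> mpsi C0 psiC psi_rot psi0.
have iF (i : 'I_(size P)) := cintegrableZ (cconj P`_i) (monomials_integrable i j mpsi C0 psiC).
have E z : z ^+ j * cconj P.[z] * RtoC (psi z) =
    \sum_(i < size P) cconj P`_i * (z ^+ j * cconj (z ^+ i) * RtoC (psi z)).
  rewrite horner_coef cconj_sum mulr_sumr mulr_suml; apply: eq_bigr => i _.
  by rewrite cconjM mulrCA -!mulrA.
have [i1 e1] := cint_sum iF; split.
  by have -> : (fun z => z ^+ j * cconj P.[z] * RtoC (psi z)) =
    (fun z => \sum_(i < size P) cconj P`_i * (z ^+ j * cconj (z ^+ i) * RtoC (psi z))) by apply/funext.
rewrite (eq_cint E) e1 big1// => i _; rewrite cintZ; last exact: (monomials_integrable i j mpsi C0 psiC).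
have [ij|ij] := eqVneq (i : nat) j; last by rewrite (monomials_orthogonal mpsi C0 psiC psi_rot ij) mulr0.
by rewrite ij monomial_diagonal psi0 mulr0.
Qed.

(* The dilation k(z / sqrt v) lies in A^q(nu_q), although k itself may not. *)
Lemma scaled_poly_approx (v e : R) : 1 <= v ->
  (pint q (fun z => - (csq z * dpos omega (v * csq z)))%R k < +oo)%E -> 0 < e ->
  exists Q : {poly R[i]}, (pint q (fun z => omega (v * csq z)) (fun z => k z - Q.[z])%R <= e%:E)%E.
Proof.
move=> v1 kv e0; have v0 : 0 < v by exact: lt_le_trans v1.
pose c := RtoC (Num.sqrt v).
have cE : csq c = v by rewrite csqE cabs_real ger0_norm ?sqrtr_ge0// sqr_sqrtr// ltW.
have c0 : c != 0 by rewrite -cabs_gt0 cabs_real normr_gt0 gt_eqF// sqrtr_gt0.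
have mD := measR_wder_scaled an omega_ni v.
have D0 := wder_scaled_ge0 an omega_ni v.
have mO : measR (fun z => omega (v * csq z)) by apply: (measR_omega omega_ni); exact: ltW.
have O0 z : 0 <= omega (v * csq z) by apply: (omega_scaled_ge0 omega_gt0); exact: ltW.
have vi0 : 0 <= v^-1 by rewrite invr_ge0 ltW.
pose kd z := k (c^-1 * z).
have mkd : measC kd by exact: measC_cmul.
have Q0 z : 0 <= nu_q omega z by rewrite nu_qE addr_ge0// (wder_ge0 an omega_ni).
have mQ : measR (nu_q omega).
  rewrite (_ : nu_q omega = (fun z => nu_p omega z + wder omega z)); first exact: (measRD mN (measR_wder an omega_ni)).
  by apply/funext => z; exact: nu_qE.
have Akd : Ap q (nu_q omega) kd.
  split; first by apply: entire_dil; [exact: invr_neq0|case: Ak].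
  have mF : measR (fun z => cabs (k z) `^ q * (omega (v * csq z) + v * - (csq z * dpos omega (v * csq z)))).
    by apply: measR_pint => //; apply: measRD => //; exact: (@measRM _ (fun=> v) _ (measurable_cst _) mD).
  have F0 z : 0 <= cabs (k z) `^ q * (omega (v * csq z) + v * - (csq z * dpos omega (v * csq z))).
    by rewrite mulr_ge0 ?powR_ge0 ?addr_ge0// mulr_ge0// ltW.
  have := aint_cmul (invr_neq0 c0) mF F0.
  have -> : aint (fun z => cabs (k (c^-1 * z)) `^ q * (omega (v * csq (c^-1 * z)) +
      v * - (csq (c^-1 * z) * dpos omega (v * csq (c^-1 * z))))) = pint q (nu_q omega) kd.
    apply: eq_aint => z; congr (_ * _); rewrite nu_qE /nu_p /wder.
    have -> : csq (c^-1 * z) = v^-1 * csq z.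
      rewrite csqM; congr (_ * _); apply: (mulfI (_ : v != 0)); first by rewrite gt_eqF.
      by rewrite divff ?gt_eqF// -cE -csqM divff// csqE cabs1 expr1n.
    by rewrite !mulrN !mulrA divff ?gt_eqF// mul1r.
  move=> ->; rewrite lte_mul_pinfty ?lee_fin ?invr_ge0 ?csq_ge0//.
  under eq_aint do rewrite mulrDr.
  rewrite aintD; [|exact: measR_pint| | |]; last 3 first.
  - by apply: measR_pint => //; exact: (@measRM _ (fun=> v) _ (measurable_cst _) mD).
  - by move=> z; rewrite mulr_ge0 ?powR_ge0.
  - by move=> z; rewrite mulr_ge0 ?powR_ge0// mulr_ge0// ltW.
  apply: lte_add_pinfty.
    apply: (@le_lt_trans _ _ (pint q (nu_p omega) k)); last by case: Ak.
    apply: (@le_pint _ q (fun z => omega (v * csq z)) (nu_p omega) k mk mO mN O0) => z.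
    by rewrite omega_ni ?csq_ge0// ler_peMl ?csq_ge0.
  under eq_aint do rewrite mulrCA.
  rewrite aintZ ?(ltW v0)//; [|exact: measR_pint|by move=> z; rewrite mulr_ge0 ?powR_ge0].
  by rewrite lte_mul_pinfty ?lee_fin ?(ltW v0).
have [P Pe] := poly_dense_pint q0 Q0 dens Akd e0.
(* Dilating P back to the scale of k turns the weight [nu_p] into w(v t); the Jacobian 1 / v <= 1
   and [nu_p <= nu_q] keep the error below that of P. *)
exists (P \Po (c *: 'X)); apply: le_trans Pe.
have mkP : measC (fun z => kd z - P.[z]) by apply: measCB => //; apply: measC_entire; exact: entire_poly.
have := aint_cmul c0 (measR_pint q mkP mN) (cabs_pow_ge0 q (fun z => kd z - P.[z]) N0).
have -> : aint (fun z => cabs (kd (c * z) - P.[c * z]) `^ q * nu_p omega (c * z)) =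
    pint q (fun z => omega (v * csq z)) (fun z => k z - (P \Po (c *: 'X)).[z]).
  apply: eq_aint => z; rewrite /kd mulKf// horner_comp hornerZ hornerX.
  by rewrite /nu_p csqM cE.
move=> ->; apply: (@le_trans _ _ (1 * pint q (nu_p omega) (fun z => kd z - P.[z])%R)%E).
  apply: lee_wpmul2r; first by apply: aint_ge0; exact: cabs_pow_ge0.
  by rewrite lee_fin cE invf_le1.
rewrite mul1e; apply: le_pint => // z; rewrite nu_qE lerDl (wder_ge0 an omega_ni)//.
Qed.

(** With a polynomial in place of k, orthogonality leaves only the j-th moment of psi, which is 0.
    The approximation of k by polynomials is available for the weight w(v t), hence the domination
    of psi by that weight rather than by [nu_p]. *)
Lemma scaled_weight_moment_vanish (v C : R) (j : nat) (psi : R[i] -> R) : 1 <= v ->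
  (pint q (fun z => - (csq z * dpos omega (v * csq z)))%R k < +oo)%E -> measR psi -> 0 <= C ->
  (forall z, `|psi z| <= C * omega (v * csq z)) ->
  (forall u z, cabs u = 1 -> psi (u * z) = psi z) ->
  rint (fun z => csq z ^+ j * psi z) = 0 ->
  cint (fun z => z ^+ j * cconj (k z) * RtoC (psi z)) = 0.
Proof.
move=> v1 kv mpsi C0 psiC psi_rot psi0; have v0 : 0 < v by exact: lt_le_trans v1.
have mO : measR (fun z => omega (v * csq z)) by apply: (measR_omega omega_ni); exact: ltW.
have O0 z : 0 <= omega (v * csq z) by apply: (omega_scaled_ge0 omega_gt0); exact: ltW.
have ON z : omega (v * csq z) <= nu_p omega z by rewrite omega_ni ?csq_ge0// ler_peMl ?csq_ge0.
have psiN z : `|psi z| <= C * nu_p omega z by rewrite (le_trans (psiC z))// ler_wpM2l.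
have jfin : (pint p (nu_p omega) (fun z => z ^+ j)%R < +oo)%E.
  by apply: pint_monomial_lty => //; exact: ltW.
have ik := pairing_integrable (mX j) jfin mpsi C0 psiN.
have Ofin : (wnorm p (fun z => omega (v * csq z)) (fun z => z ^+ j)%R < +oo)%E.
  by apply: wnorm_lty; apply: le_lt_trans jfin; exact: le_pint.
have O1 : (0 <= wnorm p (fun z => omega (v * csq z)) (fun z => z ^+ j)%R)%E by exact: poweR_ge0.
set A := wnorm p _ _ in Ofin O1.
have AE : A = (fine A)%:E by rewrite fineK// ge0_fin_numE.
have A0 : 0 <= fine A by rewrite fine_ge0.
apply/eqP; rewrite -cabs_eq0 eq_le cabs_ge0 andbT.
apply: (@le0_of_small _ _ (C * fine A)) => [|e e0]; first by rewrite mulr_ge0.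
have [Q Qe] := scaled_poly_approx v1 kv (powR_gt0 q e0).
have [iQ cQ] := @cint_monomial_poly j Q _ _ mpsi C0 psiN psi_rot psi0.
have mkQ : measC (fun z => k z - Q.[z]) by apply: measCB => //; apply: measC_entire; exact: entire_poly.
have E z : z ^+ j * cconj (k z) * RtoC (psi z) - z ^+ j * cconj Q.[z] * RtoC (psi z) =
    z ^+ j * cconj (k z - Q.[z]) * RtoC (psi z).
  by rewrite cconjD cconjN; ring.
have iN := cintegrableZ (-1) iQ.
have i3 : cintegrable (fun z => z ^+ j * cconj (k z - Q.[z]) * RtoC (psi z)).
  have -> : (fun z => z ^+ j * cconj (k z - Q.[z]) * RtoC (psi z)) =
     (fun z => z ^+ j * cconj (k z) * RtoC (psi z) + -1 * (z ^+ j * cconj Q.[z] * RtoC (psi z))).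
    by apply/funext => z; rewrite -E mulN1r.
  exact: cintegrableD.
have := cintB ik iQ; rewrite (eq_cint E) cQ subr0 => <-.
rewrite -lee_fin; apply: (le_trans (cabs_cint_le i3)).
have mG : measR (fun z => cabs (z ^+ j) * cabs (k z - Q.[z]) * omega (v * csq z)).
  by apply: measRM => //; apply: measRM; exact: measR_cabs.
have G0 z : 0 <= cabs (z ^+ j) * cabs (k z - Q.[z]) * omega (v * csq z) by rewrite !mulr_ge0 ?cabs_ge0.
apply: (@le_trans _ _ (aint (fun z => C * (cabs (z ^+ j) * cabs (k z - Q.[z]) * omega (v * csq z))))).
  apply: le_aint.
  - by apply: measR_cabs; case: i3.
  - exact: (@measRM _ (fun=> C) _ (measurable_cst _) mG).
  - by move=> z; exact: cabs_ge0.
  move=> z; rewrite !cabsM cabs_conj cabs_real mulrCA ler_wpM2l//.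
  by rewrite mulr_ge0 ?cabs_ge0.
rewrite aintZ// -mulrA EFinM; apply: lee_wpmul2l; first by rewrite lee_fin.
apply: (le_trans (aint_hoelder p0 q0 pq O0 (mX j) mkQ mO)).
rewrite EFinM -AE; apply: lee_wpmul2l => //.
have -> : e%:E = poweR (e `^ q)%:E q^-1.
  by rewrite poweR_EFin -powRrM divff ?gt_eqF// powRr1// ltW.
apply: gt0_ler_poweR => //; rewrite ?in_itv/= ?leey ?andbT ?pint_ge0 ?lee_fin ?powR_ge0//.
by rewrite invr_ge0 ltW.
Qed.

Lemma cint_combine (g : R[i] -> R[i]) (psi phi : R[i] -> R) (a : R) :
  cintegrable (fun z => g z * RtoC (psi z)) -> cintegrable (fun z => g z * RtoC (phi z)) ->
  cint (fun z => g z * RtoC (psi z + a * phi z)) =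
  cint (fun z => g z * RtoC (psi z)) + RtoC a * cint (fun z => g z * RtoC (phi z)).
Proof.
move=> i1 i2; rewrite -cintZ// -cintD//; last exact: cintegrableZ.
apply: eq_cint => z.
have -> : RtoC (psi z + a * phi z) = RtoC (psi z) + RtoC a * RtoC (phi z).
  by rewrite -![RtoC _]/(real_complex R _) rmorphD rmorphM.
by ring.
Qed.

Lemma rint_moment_gt0 (v : R) (j : nat) : 1 <= v -> 0 < rint (fun z => csq z ^+ j * omega (v * csq z)).
Proof.
move=> v1; have v0 : 0 < v by exact: lt_le_trans v1.
have mO : measR (fun z => omega (v * csq z)) by apply: (measR_omega omega_ni); exact: ltW.
have O0 z : 0 <= omega (v * csq z) by apply: (omega_scaled_ge0 omega_gt0); exact: ltW.
have mJ : measR (fun z => csq z ^+ j * omega (v * csq z)).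
  by apply: measRM => //; apply: measurable_funX; exact: measR_csq_id.
have J0 z : 0 <= csq z ^+ j * omega (v * csq z) by rewrite mulr_ge0 ?exprn_ge0 ?csq_ge0.
rewrite rintE// fine_gt0//; apply/andP; split.
  (* On the square of half-width 1 around the point 2 one has 1 <= |z|^2 < 10, so 13 is a convenient
     upper bound there. *)
  have w0 : 0 < omega (v * 13) by apply: omega_gt0; rewrite mulr_ge0// ltW.
  apply: (@aint_gt0 _ _ _ 1 (Complex 2 0) mJ J0 w0 ltr01) => z /=.
  rewrite subr0 !ltr_norml => /andP[a1 a2] /andP[b1 b2].
  have t1 : 1 <= csq z by rewrite /csq; nra.
  have t2 : csq z <= 13 by rewrite /csq; nra.
  rewrite -[leLHS]mul1r ler_pM ?(ltW w0)// ?exprn_ege1//.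
  by rewrite omega_ni ?mulr_ge0 ?csq_ge0 ?(ltW v0)// ler_wpM2l// ltW.
apply: le_lt_trans (aint_moment_lty omega_gt0 omega_ni omega_decay (2 * j)).
apply: le_aint => // [|z].
  by apply: measRM => //; exact: measurable_funX.
rewrite exprM -csqE ler_wpM2l ?exprn_ge0 ?csq_ge0//.
by rewrite omega_ni ?csq_ge0// ler_peMl ?csq_ge0.
Qed.

(* psi is cut off at t <= T, where w(t) is bounded by a multiple of w(vt), and corrected
   by a multiple of w(vt) to keep its moment zero. *)
Lemma weight_moment_vanish (C : R) (j : nat) (psi : R[i] -> R) : measR psi -> 0 <= C ->
  (forall z, `|psi z| <= C * nu_p omega z) ->
  (forall u z, cabs u = 1 -> psi (u * z) = psi z) ->
  rint (fun z => csq z ^+ j * psi z) = 0 ->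
  cint (fun z => z ^+ j * cconj (k z) * RtoC (psi z)) = 0.
Proof.
move=> mpsi C0 psiC psi_rot psi0.
have [v [v1 _ kv]] := exists_scaled_derivative_finite an omega_gt0 omega_ni Ak.
have v0 : 0 < v by exact: lt_le_trans v1.
pose phi z := omega (v * csq z).
have mphi : measR phi by apply: (measR_omega omega_ni); exact: ltW.
have phi0 z : 0 <= phi z by apply: (omega_scaled_ge0 omega_gt0); exact: ltW.
have phiN z : `|phi z| <= 1 * nu_p omega z.
  by rewrite ger0_norm// mul1r omega_ni ?csq_ge0// ler_peMl ?csq_ge0.
have phi_rot u z : cabs u = 1 -> phi (u * z) = phi z by move=> u1; rewrite /phi csq_rot.
have m0 := rint_moment_gt0 j v1; set m := rint _ in m0.
have jfin : (pint p (nu_p omega) (fun z => z ^+ j)%R < +oo)%E.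
  by apply: pint_monomial_lty => //; exact: ltW.
pose Y := cint (fun z => z ^+ j * cconj (k z) * RtoC (phi z)).
have iX := pairing_integrable (mX j) jfin mpsi C0 psiC.
have iD := monomials_integrable j j mpsi C0 psiC.
(* The two integrands are added so that a single radius makes both tails small: that of the pairing
   with k and that of the j-th moment. *)
pose F z := cabs (z ^+ j * cconj (k z) * RtoC (psi z)) + cabs (z ^+ j * cconj (z ^+ j) * RtoC (psi z)).
have mF1 := measR_cabs (proj1 iX); have mF2 := measR_cabs (proj1 iD).
have mF : measR F by exact: measRD.
have F0 z : 0 <= F z by rewrite addr_ge0 ?cabs_ge0.
have Ffin : (aint F < +oo)%E.
  rewrite aintD//; [apply: lte_add_pinfty; [exact: iX.2|exact: iD.2]| |].
    by move=> z; exact: cabs_ge0.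
  by move=> z; exact: cabs_ge0.
apply/eqP; rewrite -cabs_eq0 eq_le cabs_ge0 andbT.
apply: (@le0_of_small _ _ (cabs Y / m + 1)) => [|e e0].
  by rewrite addr_ge0// divr_ge0 ?cabs_ge0// ltW.
have [T T0 Te] := aint_tail mF F0 Ffin e0.
pose psi1 z := psi z * (csq z <= T)%R%:R; pose psi2 z := psi z * (T < csq z)%R%:R.
have mpsi1 : measR psi1 by exact: (measRM mpsi (measR_le_csq T)).
have mpsi2 : measR psi2 by exact: (measRM mpsi (measR_lt_csq T)).
have psiE z : psi z = psi1 z + 1 * psi2 z.
  by rewrite /psi1 /psi2 ltNge; case: (_ <= _); rewrite /= ?mulr0 ?mulr1 ?addr0 ?mul1r ?add0r.
have bool_le (b : bool) x : `|x * b%:R| <= `|x| :> R by case: b; rewrite ?mulr1// mulr0 normr0.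
have psi1C z : `|psi1 z| <= C * nu_p omega z by apply: le_trans (psiC z); exact: bool_le.
have psi2C z : `|psi2 z| <= C * nu_p omega z by apply: le_trans (psiC z); exact: bool_le.
have iX1 := pairing_integrable (mX j) jfin mpsi1 C0 psi1C.
have iX2 := pairing_integrable (mX j) jfin mpsi2 C0 psi2C.
have iD1 := monomials_integrable j j mpsi1 C0 psi1C.
have iD2 := monomials_integrable j j mpsi2 C0 psi2C.
have iXp := pairing_integrable (mX j) jfin mphi ler01 phiN.
have iDp := monomials_integrable j j mphi ler01 phiN.
have small (g : R[i] -> R[i]) : cintegrable (fun z => g z * RtoC (psi2 z)) ->
    (forall z, cabs (g z * RtoC (psi z)) <= F z) -> cabs (cint (fun z => g z * RtoC (psi2 z))) <= e.
  move=> ig gF; rewrite -lee_fin; apply: (le_trans (cabs_cint_le ig)); apply: le_trans Te.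
  apply: le_aint.
  - by apply: measR_cabs; exact: ig.1.
  - exact: (measRM mF (measR_lt_csq T)).
  - by move=> z; exact: cabs_ge0.
  move=> z; rewrite /psi2; case: (T < csq z); rewrite ?mulr1// mulr0.
  by rewrite cabsM cabs_real normr0 !mulr0.
have X2e := small _ iX2 (fun z => ltac:(by rewrite lerDl cabs_ge0)).
have D2e := small _ iD2 (fun z => ltac:(by rewrite lerDr cabs_ge0)).
(* This multiple of [phi] restores the zero moment after truncation. The whole moment of psi being
   0, the truncated one is minus the tail, so |c| is at most e / m. *)
pose c := rint (fun z => csq z ^+ j * psi1 z) / m.
have ce : `|c| <= e / m.
  rewrite /c normrM [`|m^-1|]gtr0_norm ?invr_gt0// ler_wpM2r ?invr_ge0 ?(ltW m0)//.
  have := monomial_diagonal j psi; rewrite psi0.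
  under eq_cint do rewrite psiE.
  rewrite cint_combine// -[RtoC 1]/(1 : R[i]) mul1r monomial_diagonal => /(canRL (addrK _)).
  rewrite -[RtoC 0]/(0 : R[i]) add0r -cabs_real => ->; by rewrite cabsN.
pose psi3 z := psi1 z + (- c) * phi z.
have X3 : cint (fun z => z ^+ j * cconj (k z) * RtoC (psi3 z)) = 0.
  have wT : 0 < omega (v * T) by apply: omega_gt0; rewrite mulr_ge0// ltW.
  have w0 : 0 < omega 0 by exact: omega_gt0.
  have r0 : 0 <= omega 0 / omega (v * T) by rewrite divr_ge0 ?ltW.
  (* The constant comes from |z|^2 <= T, where w(t) <= w(0) and w(v t) >= w(v T), plus |c| for the
     correction. *)
  apply: (@scaled_weight_moment_vanish v (C * (omega 0 / omega (v * T)) + `|c|)) => //.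
  - by apply: measRD => //; exact: (@measRM _ (fun=> - c) _ (measurable_cst _) mphi).
  - by apply: addr_ge0 => //; exact: mulr_ge0.
  - move=> z; rewrite (le_trans (ler_normD _ _))// mulrDl lerD//; last first.
      by rewrite normrM normrN ler_wpM2l// ger0_norm.
    rewrite /psi1; case: (leP (csq z) T) => zT; last first.
      by rewrite mulr0 normr0; apply: mulr_ge0; [exact: mulr_ge0|exact: phi0].
    rewrite mulr1 (le_trans (psiC z))// -mulrA ler_wpM2l//.
    rewrite (@le_trans _ _ (omega 0))//; first by rewrite /nu_p omega_ni ?csq_ge0.
    rewrite -mulrA ler_peMr ?(ltW w0)// mulrC ler_pdivlMr// mul1r.
    by rewrite omega_ni ?mulr_ge0 ?csq_ge0 ?(ltW v0)// ler_wpM2l// ltW.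
  - by move=> u z u1; rewrite /psi3 phi_rot// /psi1 psi_rot// csq_rot.
  have : RtoC (rint (fun z => csq z ^+ j * psi3 z)) = 0.
    rewrite -monomial_diagonal cint_combine// !monomial_diagonal -/m.
    rewrite -![RtoC _]/(real_complex R _) -rmorphM -rmorphD mulNr /c divfK ?gt_eqF//.
    by rewrite subrr rmorph0.
  by case.
(* Here psi = psi3 + c phi + psi2, and psi3 pairs to 0; the two remaining terms are of order e. *)
have -> : cint (fun z => z ^+ j * cconj (k z) * RtoC (psi z)) =
    RtoC c * Y + cint (fun z => z ^+ j * cconj (k z) * RtoC (psi2 z)).
  under eq_cint do rewrite psiE.
  rewrite cint_combine// -[RtoC 1]/(1 : R[i]) mul1r; congr (_ + _).
  move: X3; rewrite cint_combine// => /(canRL (addrK _)) ->; rewrite sub0r.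
  by rewrite -![RtoC _]/(real_complex R _) rmorphN mulNr opprK.
rewrite (le_trans (cabsD _ _))// mulrDl mul1r lerD// cabsM cabs_real.
rewrite (le_trans (ler_wpM2r (cabs_ge0 _) ce))//.
by rewrite [leLHS]mulrC mulrA [leLHS]mulrAC.
Qed.

(** * Pairing the kernel with dilated functions *)

Lemma wnorm_le (r A : R) W f : 0 < r -> 0 <= A -> (forall z, 0 <= W z) ->
  (pint r W f <= (A `^ r)%:E)%E -> (wnorm r W f <= A%:E)%E.
Proof.
move=> r0 A0 W0 fA; have -> : A%:E = poweR (A `^ r)%:E r^-1.
  by rewrite poweR_EFin -powRrM divff ?gt_eqF// powRr1.
apply: gt0_ler_poweR => //; rewrite ?in_itv/= ?leey ?andbT ?pint_ge0 ?lee_fin ?powR_ge0//.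
by rewrite invr_ge0 ltW.
Qed.

Lemma hoelder_le (g h : R[i] -> R[i]) (W : R[i] -> R) (B K : R) : measC g -> measC h -> measR W ->
  (forall z, 0 <= W z) -> 0 <= B -> 0 <= K -> (pint p W g <= (B `^ p)%:E)%E ->
  (pint q W h <= (K `^ q)%:E)%E ->
  (aint (fun z => cabs (g z) * cabs (h z) * W z)%R <= (B * K)%:E)%E.
Proof.
move=> mg mh mW W0 B0 K0 gB hK; apply: (le_trans (aint_hoelder p0 q0 pq W0 mg mh mW)).
by rewrite EFinM; apply: lee_pmul; [exact: poweR_ge0|exact: poweR_ge0|exact: wnorm_le|exact: wnorm_le].
Qed.

Lemma pairing_abs_le (g : R[i] -> R[i]) (W psi : R[i] -> R) (C B K : R) : measC g -> measR W -> measR psi ->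
  (forall z, 0 <= W z) -> 0 <= B -> 0 <= C -> 0 <= K -> (forall z, `|psi z| <= C * W z) ->
  (pint p W g <= (B `^ p)%:E)%E -> forall h, measC h -> (pint q W h <= (K `^ q)%:E)%E ->
  (aint (fun z => cabs (g z * cconj (h z) * RtoC (psi z)))%R <= (C * (B * K))%:E)%E.
Proof.
move=> mg mW mpsi W0 B0 C0 K0 psiC gB h mh hK.
have mG : measR (fun z => cabs (g z) * cabs (h z) * W z).
  by apply: measRM => //; apply: measRM; exact: measR_cabs.
have G0 z : 0 <= cabs (g z) * cabs (h z) * W z by rewrite !mulr_ge0 ?cabs_ge0.
apply: (@le_trans _ _ (aint (fun z => C * (cabs (g z) * cabs (h z) * W z))%R)).
  apply: le_aint.
  - by apply: measR_cabs; apply: measCM; [apply: measCM => //; exact: measC_conj|exact: measC_real].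
  - exact: (@measRM _ (fun=> C) _ (measurable_cst _) mG).
  - by move=> z; exact: cabs_ge0.
  move=> z; rewrite !cabsM cabs_conj cabs_real mulrCA ler_wpM2l//.
  by rewrite mulr_ge0 ?cabs_ge0.
rewrite aintZ// [leRHS]EFinM; apply: lee_wpmul2l; first by rewrite lee_fin.
exact: hoelder_le.
Qed.

(** By the substitution z -> sqrt(s) z, the weight w(t) - s^(j+1) w(s t) has zero j-th moment, so
    its pairing with z^j vanishes. *)
Lemma monomial_dilation_pairing (s : R) (j : nat) : 1 < s ->
  cint (fun z => z ^+ j * cconj (k z) * RtoC (nu_p omega z)) =
  RtoC (s ^+ j.+1) * cint (fun z => z ^+ j * cconj (k z) * RtoC (omega (s * csq z))).
Proof.
move=> s1; have s0 : 0 < s by exact: lt_trans s1.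
have mO : measR (fun z => omega (s * csq z)) by apply: (measR_omega omega_ni); exact: ltW.
have O0 z : 0 <= omega (s * csq z) by apply: (omega_scaled_ge0 omega_gt0); exact: ltW.
have ON z : `|omega (s * csq z)| <= 1 * nu_p omega z.
  by rewrite ger0_norm// mul1r omega_ni ?csq_ge0// ler_peMl ?csq_ge0// ltW.
have NN z : `|nu_p omega z| <= 1 * nu_p omega z by rewrite ger0_norm// mul1r.
have jfin : (pint p (nu_p omega) (fun z => z ^+ j)%R < +oo)%E.
  by apply: pint_monomial_lty => //; exact: ltW.
have iN := pairing_integrable (mX j) jfin mN ler01 NN.
have iO := pairing_integrable (mX j) jfin mO ler01 ON.
have jN := monomials_integrable j j mN ler01 NN.
have jO := monomials_integrable j j mO ler01 ON.
pose a := - s ^+ j.+1.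
have main : cint (fun z => z ^+ j * cconj (k z) * RtoC (nu_p omega z + a * omega (s * csq z))) = 0.
  apply: (@weight_moment_vanish (1 + `|a|)) => //.
  - by apply: measRD => //; exact: (@measRM _ (fun=> a) _ (measurable_cst _) mO).
  - move=> z; rewrite (le_trans (ler_normD _ _))// mulrDl lerD// normrM ler_wpM2l//.
    by rewrite (le_trans (ON z))// mul1r.
  - by move=> u z u1; rewrite /nu_p csq_rot.
  have : RtoC (rint (fun z => csq z ^+ j * (nu_p omega z + a * omega (s * csq z)))) = 0.
    rewrite -monomial_diagonal cint_combine//.
    pose c := RtoC (Num.sqrt s).
    have cE : csq c = s by rewrite csqE cabs_real ger0_norm ?sqrtr_ge0// sqr_sqrtr// ltW.
    have c0 : c != 0 by rewrite -cabs_gt0 cabs_real normr_gt0 gt_eqF// sqrtr_gt0.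
    have := cint_cmul c0 jN; rewrite cE => h.
    have -> : cint (fun z => z ^+ j * cconj (z ^+ j) * RtoC (nu_p omega z)) =
        RtoC s * cint (fun z => (c * z) ^+ j * cconj ((c * z) ^+ j) * RtoC (nu_p omega (c * z))).
      rewrite h mulrA -![RtoC _]/(real_complex R _) -rmorphM divff ?gt_eqF//.
      by rewrite rmorph1 mul1r.
    have -> : cint (fun z => (c * z) ^+ j * cconj ((c * z) ^+ j) * RtoC (nu_p omega (c * z))) =
        RtoC (s ^+ j) * cint (fun z => z ^+ j * cconj (z ^+ j) * RtoC (omega (s * csq z))).
      rewrite -cintZ//; apply: eq_cint => z.
      rewrite !exprMn cconjM mulrACA [c ^+ j * _](_ : _ = RtoC (s ^+ j)).
        rewrite /nu_p csqM cE.
        by ring.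
      by rewrite cconjX -exprMn mul_conj_csq cE -[RtoC s]/(real_complex R _) -rmorphXn.
    rewrite mulrA -![RtoC _]/(real_complex R _) -rmorphM -exprS -mulrDl -rmorphD /a subrr.
    by rewrite rmorph0 mul0r.
  by case.
move: main; rewrite cint_combine// => /(canRL (addrK _)) ->.
by rewrite sub0r /a -![RtoC _]/(real_complex R _) rmorphN mulNr opprK.
Qed.

(** The dilation of z^i brings s^(-i) and the moment identity brings s^(i+1). Their product s is the
    same in every degree, which is what lets the identity extend by linearity and then by
    density. *)
Lemma poly_dilation_pairing (s : R) (P : {poly R[i]}) : 1 < s ->
  cint (fun z => P.[(RtoC s)^-1 * z] * cconj (k z) * RtoC (nu_p omega z)) =
  RtoC s * cint (fun z => P.[z] * cconj (k z) * RtoC (omega (s * csq z))).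
Proof.
move=> s1; have s0 : 0 < s by exact: lt_trans s1.
have sC0 : RtoC s != 0 by rewrite eq_complex /= negb_and gt_eqF.
have mO : measR (fun z => omega (s * csq z)) by apply: (measR_omega omega_ni); exact: ltW.
have ON z : `|omega (s * csq z)| <= 1 * nu_p omega z.
  rewrite ger0_norm ?mul1r ?omega_ni ?csq_ge0// ?ler_peMl ?csq_ge0 ?ltW//.
  by apply: omega_gt0; rewrite mulr_ge0 ?csq_ge0// ltW.
have NN z : `|nu_p omega z| <= 1 * nu_p omega z by rewrite ger0_norm// mul1r.
have jfin j : (pint p (nu_p omega) (fun z => z ^+ j)%R < +oo)%E.
  by apply: pint_monomial_lty => //; exact: ltW.
have iN j := pairing_integrable (mX j) (jfin j) mN ler01 NN.
have iO j := pairing_integrable (mX j) (jfin j) mO ler01 ON.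
have E1 z : P.[(RtoC s)^-1 * z] * cconj (k z) * RtoC (nu_p omega z) =
    \sum_(i < size P) (P`_i * (RtoC s)^-1 ^+ i) * (z ^+ i * cconj (k z) * RtoC (nu_p omega z)).
  by rewrite horner_coef !mulr_suml; apply: eq_bigr => i _; rewrite exprMn; ring.
have E2 z : P.[z] * cconj (k z) * RtoC (omega (s * csq z)) =
    \sum_(i < size P) P`_i * (z ^+ i * cconj (k z) * RtoC (omega (s * csq z))).
  by rewrite horner_coef !mulr_suml; apply: eq_bigr => i _; ring.
rewrite (eq_cint E1) (eq_cint E2).
rewrite (proj2 (cint_sum (fun i : 'I_(size P) => cintegrableZ (P`_i * (RtoC s)^-1 ^+ i) (iN i)))).
rewrite (proj2 (cint_sum (fun i : 'I_(size P) => cintegrableZ P`_i (iO i)))).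
rewrite mulr_sumr; apply: eq_bigr => i _; rewrite !cintZ// (monomial_dilation_pairing i s1).
have -> : RtoC (s ^+ i.+1) = RtoC s * RtoC s ^+ i.
  by rewrite -![RtoC _]/(real_complex R _) -rmorphXn -rmorphM exprS.
by rewrite exprVn; field; rewrite expf_neq0.
Qed.

(** Both sides depend continuously on f in the norm of A^p(w), by Hoelder's inequality and because
    dilation multiplies the norm by at most s^(2/p), and they agree on polynomials. *)
Lemma dilation_pairing (s : R) (f : R[i] -> R[i]) : 1 < s -> Ap p (nu_p omega) f ->
  poly_dense p (nu_p omega) ->
  Phi (nu_p omega) k (fun z => f ((RtoC s)^-1 * z)) =
  RtoC s * cint (fun z => f z * cconj (k z) * RtoC (omega (s * csq z))).
Proof.
move=> s1 Af densp; have s0 : 0 < s by exact: lt_trans s1.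
have sC0 : RtoC s != 0 by rewrite eq_complex /= negb_and gt_eqF.
have mO : measR (fun z => omega (s * csq z)) by apply: (measR_omega omega_ni); exact: ltW.
have ON z : `|omega (s * csq z)| <= 1 * nu_p omega z.
  rewrite ger0_norm ?mul1r ?omega_ni ?csq_ge0// ?ler_peMl ?csq_ge0 ?ltW//.
  by apply: omega_gt0; rewrite mulr_ge0 ?csq_ge0// ltW.
have NN z : `|nu_p omega z| <= 1 * nu_p omega z by rewrite ger0_norm// mul1r.
have mf : measC f by apply: measC_entire; case: Af.
have dil_le g : measC g -> (pint p (nu_p omega) (fun z => g ((RtoC s)^-1 * z))%R <=
    (s ^+ 2)%:E * pint p (nu_p omega) g)%E.
  move=> mg; rewrite (pint_nu_dilate omega_gt0 omega_ni p s0 mg); apply: lee_wpmul2l; first by rewrite lee_fin exprn_ge0// ltW.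
  apply: le_pint => //.
  - by apply: (measR_omega omega_ni); rewrite exprn_ge0// ltW.
  - by move=> z; apply: (omega_scaled_ge0 omega_gt0); rewrite exprn_ge0// ltW.
  move=> z; rewrite omega_ni ?csq_ge0//; apply: ler_peMl; first exact: csq_ge0.
  by rewrite exprn_ege1// ltW.
have i1 g : measC g -> (pint p (nu_p omega) g < +oo)%E ->
    cintegrable (fun z => g ((RtoC s)^-1 * z) * cconj (k z) * RtoC (nu_p omega z)).
  move=> mg gfin; have mgs : measC (fun z => g ((RtoC s)^-1 * z)) by exact: measC_cmul.
  have gsfin : (pint p (nu_p omega) (fun z => g ((RtoC s)^-1 * z))%R < +oo)%E.
    apply: le_lt_trans (dil_le g mg) _.
    by rewrite lte_mul_pinfty ?lee_fin ?exprn_ge0// ltW.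
  exact: (pairing_integrable mgs gsfin mN ler01 NN).
have i2 g : measC g -> (pint p (nu_p omega) g < +oo)%E ->
    cintegrable (fun z => g z * cconj (k z) * RtoC (omega (s * csq z))).
  by move=> mg gfin; exact: (pairing_integrable mg gfin mO ler01 ON).
pose D g := cint (fun z => g ((RtoC s)^-1 * z) * cconj (k z) * RtoC (nu_p omega z)) -
  RtoC s * cint (fun z => g z * cconj (k z) * RtoC (omega (s * csq z))).
suff D0 : D f = 0 by apply/eqP; rewrite -subr_eq0; apply/eqP.
pose K := fine (wnorm q (nu_p omega) k).
have KE : (pint q (nu_p omega) k <= (K `^ q)%:E)%E.
  have fin : wnorm q (nu_p omega) k \is a fin_num.
    by rewrite ge0_fin_numE ?poweR_ge0// wnorm_lty//; case: Ak.
  rewrite -poweR_EFin /K fineK// /wnorm -poweRrM mulVf ?gt_eqF// poweRe1//.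
  exact: pint_ge0.
have K0 : 0 <= K by rewrite fine_ge0// poweR_ge0.
pose c := (s ^+ 2) `^ p^-1.
have c0 : 0 <= c by exact: powR_ge0.
apply/eqP; rewrite -cabs_eq0 eq_le cabs_ge0 andbT.
apply: (@le0_of_small _ _ (c * K + s * K)) => [|e e0].
  by rewrite addr_ge0// mulr_ge0// ltW.
have [P Pe] := poly_dense_pint p0 N0 densp Af (powR_gt0 p e0).
have mP : measC (horner P) by apply: measC_entire; exact: entire_poly.
pose g z := f z - P.[z].
have mg : measC g by exact: measCB.
have gfin : (pint p (nu_p omega) g < +oo)%E by apply: (le_lt_trans Pe); exact: ltry.
have ffin : (pint p (nu_p omega) f < +oo)%E by case: Af.
have iP1 : cintegrable (fun z => P.[(RtoC s)^-1 * z] * cconj (k z) * RtoC (nu_p omega z)).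
  have -> : (fun z => P.[(RtoC s)^-1 * z] * cconj (k z) * RtoC (nu_p omega z)) =
    (fun z => f ((RtoC s)^-1 * z) * cconj (k z) * RtoC (nu_p omega z) +
      -1 * (g ((RtoC s)^-1 * z) * cconj (k z) * RtoC (nu_p omega z))).
    by apply/funext => z; rewrite /g; ring.
  by apply: cintegrableD; [exact: i1|apply: cintegrableZ; exact: i1].
have iP2 : cintegrable (fun z => P.[z] * cconj (k z) * RtoC (omega (s * csq z))).
  have -> : (fun z => P.[z] * cconj (k z) * RtoC (omega (s * csq z))) =
    (fun z => f z * cconj (k z) * RtoC (omega (s * csq z)) +
      -1 * (g z * cconj (k z) * RtoC (omega (s * csq z)))).
    by apply/funext => z; rewrite /g; ring.
  by apply: cintegrableD; [exact: i2|apply: cintegrableZ; exact: i2].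
have -> : D f = D g.
  have fE1 z : f ((RtoC s)^-1 * z) * cconj (k z) * RtoC (nu_p omega z) =
    g ((RtoC s)^-1 * z) * cconj (k z) * RtoC (nu_p omega z) +
    P.[(RtoC s)^-1 * z] * cconj (k z) * RtoC (nu_p omega z) by rewrite /g; ring.
  have fE2 z : f z * cconj (k z) * RtoC (omega (s * csq z)) =
    g z * cconj (k z) * RtoC (omega (s * csq z)) +
    P.[z] * cconj (k z) * RtoC (omega (s * csq z)) by rewrite /g; ring.
  rewrite /D (eq_cint fE1) (eq_cint fE2) cintD ?cintD//; [|exact: i2|exact: i1].
  by rewrite poly_dilation_pairing// mulrDr opprD addrACA subrr addr0.
rewrite /D (le_trans (cabsD _ _))// cabsN cabsM cabs_real gtr0_norm// mulrDl lerD//.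
  rewrite -lee_fin; apply: (le_trans (cabs_cint_le (i1 g mg gfin))).
  have -> : (c * K * e)%:E = (1 * ((c * e) * K))%:E by rewrite mul1r mulrAC.
  apply: (pairing_abs_le _ mN mN N0 _ ler01 K0 NN _ mk KE); first exact: measC_cmul.
    by rewrite mulr_ge0// ltW.
  apply: (le_trans (dil_le g mg)).
  rewrite powRM ?(ltW e0)// /c -powRrM mulVf ?gt_eqF// powRr1 ?exprn_ge0 ?(ltW s0)// [leRHS]EFinM.
  by apply: lee_wpmul2l => //; rewrite lee_fin exprn_ge0// ltW.
rewrite -mulrA ler_wpM2l ?(ltW s0)// -lee_fin; apply: (le_trans (cabs_cint_le (i2 g mg gfin))).
have -> : (K * e)%:E = (1 * (e * K))%:E by rewrite mul1r mulrC.
exact: (pairing_abs_le mg mN mO N0 (ltW e0) ler01 K0 ON Pe mk KE).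
Qed.

(* If all moments of k vanish for w, they vanish for every radial weight below w; taking
   w(vt) cut off at t <= T, where k is bounded, and polynomials tending to k, one gets
   int |k|^2 = 0 on a disc. *)
Lemma exists_pairing_neq0 : (exists z, k z != 0) ->
  exists j : nat, Phi (nu_p omega) k (fun z => z ^+ j) != 0.
Proof.
move=> [z0 kz0]; apply: contrapT => nj.
have pair0 j : cint (fun z => z ^+ j * cconj (k z) * RtoC (nu_p omega z)) = 0.
  by apply/eqP; apply: contra_notT nj => h; exists j.
have [v [v1 _ kv]] := exists_scaled_derivative_finite an omega_gt0 omega_ni Ak.
have v0 : 0 < v by exact: lt_le_trans v1.
have ek : entire k by case: Ak.
have a0 : 0 < cabs (k z0) by rewrite cabs_gt0.
have [d d0 kd] := cdiff_cont (ek z0) (ltac:(by rewrite divr_gt0) : 0 < cabs (k z0) / 2).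
(* The disc |z|^2 <= T contains the ball of radius d around z0, in which |k| stays above |k(z0)| /
   2. On the disc w(v t) is bounded below, and k is bounded by [M]. *)
pose T := (cabs z0 + d) ^+ 2.
have T0 : 0 <= T by exact: sqr_ge0.
have [M M0 kM] := entire_bounded T ek.
have mO : measR (fun z => omega (v * csq z)) by apply: (measR_omega omega_ni); exact: ltW.
have O0 z : 0 <= omega (v * csq z) by apply: (omega_scaled_ge0 omega_gt0); exact: ltW.
have ON z : omega (v * csq z) <= nu_p omega z by rewrite omega_ni ?csq_ge0// ler_peMl ?csq_ge0.
pose phi z := omega (v * csq z) * (csq z <= T)%R%:R.
have mphi : measR phi by exact: (measRM mO (measR_le_csq T)).
have phi0 z : 0 <= phi z by rewrite /phi mulr_ge0.
have phiO z : phi z <= omega (v * csq z) by rewrite /phi; case: (_ <= T); rewrite ?mulr1// mulr0.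
have phiN z : `|phi z| <= 1 * nu_p omega z by rewrite ger0_norm// mul1r (le_trans (phiO z)).
have NN z : `|nu_p omega z| <= 1 * nu_p omega z by rewrite ger0_norm// mul1r.
have jfin j : (pint p (nu_p omega) (fun z => z ^+ j)%R < +oo)%E.
  by apply: pint_monomial_lty => //; exact: ltW.
have iN j := pairing_integrable (mX j) (jfin j) mN ler01 NN.
have iphi j := pairing_integrable (mX j) (jfin j) mphi ler01 phiN.
have jN j := monomials_integrable j j mN ler01 NN.
have jphi j := monomials_integrable j j mphi ler01 phiN.
have phi_pair0 j : cint (fun z => z ^+ j * cconj (k z) * RtoC (phi z)) = 0.
  have m0 := rint_moment_gt0 j (lexx 1).
  pose m := rint (fun z => csq z ^+ j * nu_p omega z).
  have mE : 0 < m.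
    by move: m0; congr (0 < _); apply: eq_rint => z; rewrite mul1r.
  (* Subtracting the multiple of w with the same j-th moment leaves a weight of zero moment; as w
     itself pairs to 0 with z^j, so does [phi]. *)
  pose a := - (rint (fun z => csq z ^+ j * phi z) / m).
  have := @weight_moment_vanish (1 + `|a|) j (fun z => phi z + a * nu_p omega z).
  rewrite cint_combine// pair0 mulr0 addr0; apply.
  - by apply: measRD => //; exact: (@measRM _ (fun=> a) _ (measurable_cst _) mN).
  - by rewrite addr_ge0.
  - move=> z; rewrite (le_trans (ler_normD _ _))// mulrDl lerD// normrM ler_wpM2l//.
    by rewrite (le_trans (NN z))// mul1r.
  - by move=> u z u1; rewrite /phi /nu_p csq_rot.
  have : RtoC (rint (fun z => csq z ^+ j * (phi z + a * nu_p omega z))) = 0.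
    rewrite -monomial_diagonal cint_combine// !monomial_diagonal -/m.
    rewrite -![RtoC _]/(real_complex R _) -rmorphM -rmorphD /a mulNr divfK ?gt_eqF//.
    by rewrite subrr rmorph0.
  by case.
have poly0 (P : {poly R[i]}) : cintegrable (fun z => P.[z] * cconj (k z) * RtoC (phi z)) /\
    cint (fun z => P.[z] * cconj (k z) * RtoC (phi z)) = 0.
  have E z : P.[z] * cconj (k z) * RtoC (phi z) =
      \sum_(i < size P) P`_i * (z ^+ i * cconj (k z) * RtoC (phi z)).
    by rewrite horner_coef !mulr_suml; apply: eq_bigr => i _; ring.
  have -> : (fun z => P.[z] * cconj (k z) * RtoC (phi z)) =
      (fun z => \sum_(i < size P) P`_i * (z ^+ i * cconj (k z) * RtoC (phi z))) by apply/funext.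
  have [h1 h2] := cint_sum (fun i : 'I_(size P) => cintegrableZ P`_i (iphi i)).
  split=> //; rewrite h2 big1// => i _; by rewrite cintZ// phi_pair0 mulr0.
(* On the support of [phi] the factor k is bounded by [M], so Hoelder's inequality is needed only
   for k - P against the constant 1, with the weight w(v t) for which k can be approximated. *)
have bound P z : cabs ((k z - P z) * cconj (k z) * RtoC (phi z)) <=
    M * (cabs 1 * cabs (k z - P z) * omega (v * csq z)) :> R.
  rewrite !cabsM cabs_conj cabs_real cabs1 mul1r ger0_norm// /phi.
  case: (leP (csq z) T) => zT; last by rewrite !mulr0 !mulr_ge0 ?cabs_ge0.
  by rewrite mulr1 mulrA ler_wpM2r// mulrC ler_wpM2r ?cabs_ge0// kM.
pose G z := csq (k z) * phi z.
have mG : measR G by apply: measRM => //; exact: measR_csq.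
have G0 z : 0 <= G z by rewrite mulr_ge0 ?csq_ge0.
have GE z : k z * cconj (k z) * RtoC (phi z) = RtoC (G z).
  by rewrite mul_conj_csq -![RtoC _]/(real_complex R _) -rmorphM.
have mkk : measC (fun z => k z * cconj (k z) * RtoC (phi z)).
  by apply: measCM; [apply: measCM => //; exact: measC_conj|exact: measC_real].
have m1 : measC (fun=> (1 : R[i])) by exact: measC_cst.
have fin1 : (pint p (nu_p omega) (fun=> 1%R) < +oo)%E.
  by have := jfin 0%N; congr (_ < _)%E; apply: eq_aint => z; rewrite expr0.
have ikk : cintegrable (fun z => k z * cconj (k z) * RtoC (phi z)).
  have mH : measR (fun z => cabs 1 * cabs (k z) * nu_p omega z).
    exact: (measRM (measRM (@measurable_cst _ _ _ _ _ (cabs (1 : R[i]))) (measR_cabs mk)) mN).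
  have H0 z : 0 <= cabs 1 * cabs (k z) * nu_p omega z by rewrite !mulr_ge0 ?cabs_ge0.
  apply: (@cintegrable_le _ _ (fun z => M * (cabs 1 * cabs (k z) * nu_p omega z))) => //.
  - exact: (@measRM _ (fun=> M) _ (measurable_cst _) mH).
  - move=> z; have := bound (fun=> 0) z; rewrite subr0 => /le_trans; apply.
    by rewrite ler_wpM2l// ler_wpM2l ?mulr_ge0 ?cabs_ge0.
  rewrite aintZ// lte_mul_pinfty ?lee_fin//.
  apply: le_lt_trans (aint_hoelder p0 q0 pq N0 m1 mk mN) _.
  apply: lte_mul_pinfty; [exact: poweR_ge0| |by apply: wnorm_lty; case: Ak].
  by rewrite ge0_fin_numE ?poweR_ge0//; exact: wnorm_lty.
have Gpos : (0 < aint G)%E.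
  have wT : 0 < omega (v * T) by apply: omega_gt0; rewrite mulr_ge0// ltW.
  have c0 : 0 < (cabs (k z0) / 2) ^+ 2 * omega (v * T) by rewrite mulr_gt0// exprn_gt0// divr_gt0.
  apply: (@aint_gt0 _ _ _ (d / 2) z0 mG G0 c0); first by rewrite divr_gt0.
  move=> z h1 h2.
  have zd : cabs (z - z0) < d.
    apply: (@le_lt_trans _ _ (`|complex.Re z - complex.Re z0| + `|complex.Im z - complex.Im z0|)); last first.
      by rewrite (splitr d) ltrD.
    rewrite -(@ler_pXn2r _ 2) ?nnegrE ?cabs_ge0 ?addr_ge0// -csqE [leRHS]sqrrD !real_normK ?num_real//.
    rewrite /csq addrAC; case: (z) (z0) => [a b] [a' b'] /=.
    by rewrite lerDl mulrn_wge0// mulr_ge0.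
  have := kd (z - z0) zd; rewrite [z0 + _]addrC subrK => kz.
  have kz2 : cabs (k z0) / 2 <= cabs (k z).
    have := cabs_dist (k z0) (k z); rewrite ler_norml => /andP[_ h].
    lra.
  have zT : csq z <= T.
    rewrite csqE lerXn2r ?nnegrE ?cabs_ge0 ?addr_ge0 ?cabs_ge0 ?(ltW d0)//.
    by have := cabsD (z - z0) z0; rewrite subrK; lra.
  rewrite /G /phi zT mulr1 csqE ler_pM ?exprn_ge0 ?divr_ge0 ?cabs_ge0 ?(ltW wT)//.
    by rewrite lerXn2r ?nnegrE ?divr_ge0 ?cabs_ge0.
  by rewrite omega_ni ?mulr_ge0 ?csq_ge0 ?(ltW v0)// ler_wpM2l// ltW.
have Gfin : (aint G < +oo)%E.
  case: ikk => _; congr (_ < _)%E; apply: eq_aint => z; rewrite GE cabs_real ger0_norm//.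
pose B := fine (wnorm p (nu_p omega) (fun=> 1)).
have BE : (pint p (nu_p omega) (fun=> 1%R) <= (B `^ p)%:E)%E.
  have fin : wnorm p (nu_p omega) (fun=> 1) \is a fin_num.
    by rewrite ge0_fin_numE ?poweR_ge0// wnorm_lty.
  rewrite -poweR_EFin /B fineK// /wnorm -poweRrM mulVf ?gt_eqF// poweRe1//.
  exact: pint_ge0.
have B0 : 0 <= B by rewrite fine_ge0// poweR_ge0.
have : fine (aint G) <= 0.
  apply: (@le0_of_small _ _ (M * B)) => [|e e0]; first by rewrite mulr_ge0.
  have [Q Qe] := scaled_poly_approx v1 kv (powR_gt0 q e0).
  have [iQ Q0] := poly0 Q.
  have mkQ : measC (fun z => k z - Q.[z]) by apply: measCB => //; apply: measC_entire; exact: entire_poly.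
  have E z : (k z - Q.[z]) * cconj (k z) * RtoC (phi z) =
     k z * cconj (k z) * RtoC (phi z) - Q.[z] * cconj (k z) * RtoC (phi z) by ring.
  have i3 : cintegrable (fun z => (k z - Q.[z]) * cconj (k z) * RtoC (phi z)).
    have -> : (fun z => (k z - Q.[z]) * cconj (k z) * RtoC (phi z)) =
       (fun z => k z * cconj (k z) * RtoC (phi z) + -1 * (Q.[z] * cconj (k z) * RtoC (phi z))).
      by apply/funext => z; rewrite E mulN1r.
    by apply: cintegrableD => //; exact: cintegrableZ.
  have GI : cint (fun z => (k z - Q.[z]) * cconj (k z) * RtoC (phi z)) = RtoC (fine (aint G)).
    by rewrite (eq_cint E) cintB// Q0 subr0 (eq_cint GE) cint_real rintE.
  have := cabs_cint_le i3; rewrite GI cabs_real ger0_norm ?fine_ge0 ?aint_ge0// => h.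
  rewrite -lee_fin; apply: (le_trans h).
  have mH : measR (fun z => cabs 1 * cabs (k z - Q.[z]) * omega (v * csq z)).
    exact: (measRM (measRM (@measurable_cst _ _ _ _ _ (cabs (1 : R[i]))) (measR_cabs mkQ)) mO).
  have H0 z : 0 <= cabs 1 * cabs (k z - Q.[z]) * omega (v * csq z) by rewrite !mulr_ge0 ?cabs_ge0.
  apply: (@le_trans _ _ (aint (fun z => M * (cabs 1 * cabs (k z - Q.[z]) * omega (v * csq z)))%R)).
    apply: le_aint.
    - by apply: measR_cabs; case: i3.
    - exact: (@measRM _ (fun=> M) _ (measurable_cst _) mH).
    - by move=> z; exact: cabs_ge0.
    - by move=> z; exact: (bound (horner Q)).
  rewrite aintZ// -mulrA EFinM; apply: lee_wpmul2l; first by rewrite lee_fin.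
  apply: (hoelder_le m1 mkQ mO O0 B0 (ltW e0) _ Qe).
  by apply: le_trans BE; exact: le_pint.
have : 0 < fine (aint G) by rewrite fine_gt0// Gpos.
by move=> /lt_le_trans h /h; rewrite ltxx.
Qed.

End kernel_moments.

(** * The extremal function *)

(** For a > 0 one divides by a^(1/p) and raises to the power p / (p - 1), the reciprocal of 1 -
    1/p. *)
Lemma le_powR_fixpoint (R : realType) (p a c : R) : 1 < p -> 0 <= a -> 0 <= c ->
  a <= c * a `^ p^-1 -> a <= c `^ (p / (p - 1)).
Proof.
move=> p1 a0 c0 h; have p0 : 0 < p by exact: lt_trans p1.
have pm : 0 < p - 1 by rewrite subr_gt0.
have [->|aN0] := eqVneq a 0; first exact: powR_ge0.
have a1 : 0 < a by rewrite lt_neqAle eq_sym aN0.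
have : a `^ (1 - p^-1) <= c.
  rewrite -(ler_pM2r (powR_gt0 p^-1 a1)) -powRD; last by rewrite aN0 implybT.
  by rewrite subrK powRr1.
have e : (1 - p^-1) * (p / (p - 1)) = 1 by field; rewrite !gt_eqF.
move=> h2; apply: (@le_trans _ _ ((a `^ (1 - p^-1)) `^ (p / (p - 1)))).
  by rewrite -powRrM e powRr1.
by rewrite ge0_ler_powR ?nnegrE ?powR_ge0// divr_ge0// ltW.
Qed.

(* The second recursion bounds x on (1, 4] a priori, so that the first one can be applied
   to its supremum. *)
Lemma bound_of_square_recursion (R : realType) (x : R -> R) (C p : R) : 1 < p -> 0 <= C ->
  (forall u, 1 < u -> 0 <= x u) ->
  (forall s, 1 < s -> s <= 2 -> x (s ^+ 2) <= C * x s `^ p^-1) ->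
  (forall s, 1 < s -> x s <= (s + 1) * x (s ^+ 2)) ->
  forall u, 1 < u -> u <= 2 -> x u <= C `^ (p / (p - 1)).
Proof.
move=> p1 C0 x0 xsq xmon.
have p0 : 0 < p by exact: lt_trans p1.
have pi0 : 0 <= p^-1 by rewrite invr_ge0 ltW.
have root (u : R) : 1 < u -> u <= 4 -> exists s, [/\ 1 < s, s <= 2 & s ^+ 2 = u].
  move=> u1 u4; have u0 : 0 <= u by rewrite ltW// (lt_trans ltr01).
  exists (Num.sqrt u); rewrite sqr_sqrtr//; split=> //.
    by rewrite -sqrtr1 ltr_sqrt// (lt_trans ltr01).
  rewrite -(@ler_pXn2r _ 2) ?nnegrE ?sqrtr_ge0// sqr_sqrtr//.
  by rewrite (le_trans u4)//; lra.
(* With u = s^2 and s <= 2 the second recursion gives x s <= 3 x u, so the first becomes the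
   fixed-point inequality x u <= C (3 x u)^(1/p). *)
have bnd u : 1 < u -> u <= 4 -> x u <= (C * 3 `^ p^-1) `^ (p / (p - 1)).
  move=> u1 u4; have [s [s1 s2 su]] := root u u1 u4.
  have s3 : s + 1 <= 3 by lra.
  apply: le_powR_fixpoint => //; first exact: x0.
    by rewrite mulr_ge0 ?powR_ge0.
  rewrite -mulrA -powRM ?x0// -su (le_trans (xsq s s1 s2))// ler_wpM2l//.
  have xs2 : 0 <= x (s ^+ 2) by apply: x0; rewrite su.
  rewrite ge0_ler_powR ?nnegrE ?x0 ?mulr_ge0//.
  by rewrite (le_trans (xmon s s1))// ler_wpM2r.
pose S := [set x u | u in [set u | 1 < u /\ u <= 4]].
have S4 : S (x 4) by exists 4 => //; split => //; rewrite ltr1n.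
have hS : has_sup S by split; [exists (x 4)|exists ((C * 3 `^ p^-1) `^ (p / (p - 1))) => _ [u [u1 u4] <-]; exact: bnd].
have xS u : 1 < u -> u <= 4 -> x u <= sup S by move=> u1 u4; apply: ub_le_sup; [exact: hS.2|exists u].
have S0 : 0 <= sup S by rewrite (le_trans (x0 4 _)) ?xS ?ltr1n.
(* The interval (1, 4] is stable under square roots, so the supremum satisfies the first recursion
   with itself on both sides and the auxiliary factor 3 disappears. *)
have SC : sup S <= C `^ (p / (p - 1)).
  apply: le_powR_fixpoint => //; apply: ge_sup; first by exists (x 4).
  move=> _ [u [u1 u4] <-]; have [s [s1 s2 su]] := root u u1 u4.
  rewrite -su (le_trans (xsq s s1 s2))// ler_wpM2l// ge0_ler_powR ?nnegrE ?x0//.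
  by apply: xS => //; rewrite (le_trans s2)// ler_nat.
by move=> u u1 u2; apply: le_trans SC; apply: xS => //; rewrite (le_trans u2)// ler_nat.
Qed.

(* N is the p-th power of the norm of the dilated extremal function, and
   y = (s^2 - N) / (s^2 - 1). *)
Lemma dilation_norm_gap (R : realType) (p s N y : R) : 1 < p -> 1 < s -> 0 <= N -> N <= 1 ->
  N = s ^+ 2 - (s ^+ 2 - 1) * y ->
  (s - 1) * y <= Num.max (p - 1) 1 * (s - N `^ p^-1).
Proof.
move=> p1 s1 N0 N1 NE; have p0 : 0 < p by exact: lt_trans p1.
(* Bernoulli's inequality is taken at the base N^(1/p), that is N >= 1 + p (N^(1/p) - 1). *)
have bern : N `^ p^-1 <= 1 + (N - 1) / p.
  have := powR_tangent p1 (powR_ge0 N p^-1).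
  rewrite -powRrM mulVf ?gt_eqF// powRr1//; move: (N `^ _) => x h.
  by rewrite -lerBlDl ler_pdivlMr// mulrC; lra.
have s21 : 0 < s ^+ 2 - 1 by rewrite expr2; nra.
have y1 : 1 <= y by rewrite -subr_ge0 -(pmulr_rge0 _ s21) mulrBr; lra.
(* Here 1 - N = (s^2 - 1)(y - 1), and s + 1 >= 2 makes the slope 2 / p independent of s. *)
have gap : (s - 1) * (1 + 2 / p * (y - 1)) <= s - N `^ p^-1.
  have e : (N - 1) / p = - ((s - 1) * ((s + 1) * (y - 1) / p)).
    by rewrite NE; field; rewrite gt_eqF.
  rewrite e in bern.
  have h : 2 / p * (y - 1) <= (s + 1) * (y - 1) / p.
    rewrite mulrAC ler_wpM2r ?invr_ge0 ?(ltW p0)// ler_wpM2r ?subr_ge0//; lra.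
  move: bern h; move: (2 / p * (y - 1)) ((s + 1) * (y - 1) / p) (N `^ _) => a b c; nra.
have M0 : 0 <= Num.max (p - 1) 1 by rewrite le_max ler01 orbT.
apply: le_trans (ler_wpM2l M0 gap).
have p20 : 0 < 2 / p by rewrite divr_gt0.
(* This is where max(p - 1, 1) comes from. For p <= 2 the slope 2 / p is already at least 1; for p >
   2 multiplication by p - 1 gives the constant term p - 1 >= 1 and the slope 2 - 2 / p >= 1. *)
have c : y <= Num.max (p - 1) 1 * (1 + 2 / p * (y - 1)).
  case: (leP p 2) => p2.
    have h2 : 1 <= 2 / p by rewrite ler_pdivlMr// mul1r.
    apply: (@le_trans _ _ (1 * (1 + 2 / p * (y - 1)))); first by nra.
    apply: ler_wpM2r; last by rewrite le_max lexx orbT.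
    by rewrite addr_ge0// mulr_ge0 ?subr_ge0// ltW.
  apply: (@le_trans _ _ ((p - 1) * (1 + 2 / p * (y - 1)))); last first.
    apply: ler_wpM2r; last by rewrite le_max lexx.
    by rewrite addr_ge0// mulr_ge0 ?subr_ge0// ltW.
  have -> : (p - 1) * (1 + 2 / p * (y - 1)) = (p - 1) + (2 - 2 / p) * (y - 1) by field; rewrite gt_eqF.
  have h2 : 2 / p <= 1 by rewrite ler_pdivrMr// mul1r ltW.
  by nra.
have sm : 0 <= s - 1 by rewrite subr_ge0 ltW.
by rewrite mulrCA ler_wpM2l.
Qed.

Lemma pintZ (R : realType) (r : R) (W : R[i] -> R) (c : R[i]) g : measC g -> measR W -> (forall z, 0 <= W z) ->
  pint r W (fun z => c * g z) = ((cabs c `^ r)%:E * pint r W g)%E.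
Proof.
move=> mg mW W0; rewrite /pint -aintZ ?powR_ge0//; [|exact: measR_pint|by move=> z; rewrite mulr_ge0 ?powR_ge0].
by apply: eq_aint => z; rewrite cabsM powRM ?cabs_ge0// mulrA.
Qed.

Section extremal_function.
Context {R : realType} {omega : R -> R} {p : R} {k f : R[i] -> R[i]}.
Let q := p / (p - 1).
Let nu := nu_p omega.
Hypothesis an : analytic_near_halfline omega.
Hypothesis omega_gt0 : forall x, 0 <= x -> 0 < omega x.
Hypothesis omega_ni : forall x y, 0 <= x -> x <= y -> omega y <= omega x.
Hypothesis omega_decay : forall n : int, (r ^ n * omega (r ^+ 2)) @[r --> +oo] --> (0 : R).
Hypothesis p1 : 1 < p.
Hypothesis densp : poly_dense p nu.
Hypothesis densq : poly_dense q (nu_q omega).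
Hypothesis Ak : Ap q nu k.
Hypothesis k_neq0 : exists z, k z != 0.
Hypothesis extr : extremal p nu k f.

Let p0 : 0 < p := lt_trans ltr01 p1.
Let pm0 : 0 < p - 1. Proof. by rewrite subr_gt0. Qed.
Let q1 : 1 < q. Proof. by rewrite /q ltr_pdivlMr// mul1r gtrBl. Qed.
Let q0 : 0 < q := lt_trans ltr01 q1.
Let pq : p^-1 + q^-1 = 1.
Proof. by rewrite /q invf_div -[X in X + _]mul1r -mulrDl addrC subrK divff ?gt_eqF. Qed.
Let mN : measR nu := measR_nu_p omega_ni.
Let N0 : forall z, 0 <= nu z := nu_p_ge0 omega_gt0.
Let mk : measC k := measC_entire (proj1 Ak).
Let Af : Ap p nu f := extr.1.
Let mf : measC f := measC_entire (proj1 Af).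
Let NN z : `|nu z| <= 1 * nu z. Proof. by rewrite ger0_norm// mul1r. Qed.
Let L := complex.Re (Phi nu k f).

Let iPhi g : Ap p nu g -> cintegrable (fun z => g z * cconj (k z) * RtoC (nu z)).
Proof.
move=> [eg gfin].
exact: (pairing_integrable omega_gt0 omega_ni p1 q1 pq Ak (measC_entire eg) gfin mN ler01 NN).
Qed.

Let PhiZ c g : Ap p nu g -> Phi nu k (fun z => c * g z) = c * Phi nu k g.
Proof.
by move=> Ag; rewrite /Phi -cintZ; [apply: eq_cint => z; rewrite !mulrA|exact: iPhi].
Qed.

Let ApZ c g : Ap p nu g -> Ap p nu (fun z => c * g z).
Proof.
move=> [eg gfin]; split; first exact: entireZ.
by rewrite pintZ ?lte_mul_pinfty ?lee_fin ?powR_ge0//; exact: measC_entire.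
Qed.

Let AnormZ c g : Ap p nu g -> Anorm p nu (fun z => c * g z) = cabs c * Anorm p nu g.
Proof.
move=> [eg gfin]; rewrite /Anorm pintZ//; last exact: measC_entire.
rewrite fineM//; last by rewrite ge0_fin_numE// pint_ge0.
rewrite /= powRM ?powR_ge0 ?fine_ge0 ?pint_ge0//.
by rewrite -powRrM divff ?gt_eqF// powRr1// cabs_ge0.
Qed.

(** Extremality controls real parts on the unit sphere; a unit factor turns the modulus into a real
    part, and scaling removes the normalisation. *)
Lemma pairing_le_extremal g : Ap p nu g -> cabs (Phi nu k g) <= L * Anorm p nu g.
Proof.
have unit h : Ap p nu h -> Anorm p nu h = 1 -> cabs (Phi nu k h) <= L.
  move=> Ah h1; have [u u1 uE] := exists_unit_mul (Phi nu k h).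
  have := extr.2.2 (fun z => u * h z) (ApZ u Ah).
  by rewrite AnormZ// u1 h1 mulr1 PhiZ// uE; apply.
move=> Ag; have n0 : 0 <= Anorm p nu g by exact: powR_ge0.
(* A function of norm 0 cannot be normalised; Hoelder's inequality shows that its pairing is 0. *)
have [nE|nN0] := eqVneq (Anorm p nu g) 0.
  rewrite nE mulr0 -lee_fin; apply: (le_trans (cabs_cint_le (iPhi Ag))).
  have [K K0 KE] : exists2 K, 0 <= K & (pint q nu k <= (K `^ q)%:E)%E.
    exists (Anorm q nu k); first exact: powR_ge0.
    rewrite /Anorm -powRrM mulVf ?gt_eqF// powRr1 ?fine_ge0 ?pint_ge0// fineK//.
    by rewrite ge0_fin_numE ?pint_ge0//; exact: Ak.2.
  have gE : (pint p nu g <= (0 `^ p)%:E)%E.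
    rewrite powR0 ?gt_eqF// -[leLHS]fineK; last by rewrite ge0_fin_numE ?pint_ge0//; exact: Ag.2.
    move: nE; rewrite /Anorm => /eqP; rewrite powR_eq0 => /andP[/eqP -> _]; exact: lexx.
  have := pairing_abs_le p1 q1 pq (measC_entire Ag.1) mN mN N0 (lexx 0) ler01 K0 NN gE mk KE.
  by rewrite mul0r mulr0.
have n1 : 0 < Anorm p nu g by rewrite lt_neqAle eq_sym nN0.
pose c := RtoC (Anorm p nu g)^-1.
have cn : cabs c = (Anorm p nu g)^-1 by rewrite cabs_real gtr0_norm// invr_gt0.
have := unit (fun z => c * g z) (ApZ c Ag).
rewrite AnormZ// cn mulVf// PhiZ// cabsM cn => /(_ erefl).
by rewrite mulrC ler_pdivrMr.
Qed.

(** Some monomial pairs nontrivially with k, which the previous bound forbids when L <= 0.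
    Positivity matters even for infinite D_q(k), to make the right-hand side infinite. *)
Lemma extremal_value_gt0 : 0 < L.
Proof.
have [j hj] := exists_pairing_neq0 an omega_gt0 omega_ni omega_decay p1 q1 pq Ak densq k_neq0.
have Aj : Ap p nu (fun z => z ^+ j).
  by split; [exact: entireX|apply: pint_monomial_lty => //; exact: ltW].
have := pairing_le_extremal Aj; rewrite -cabs_gt0 in hj => /(lt_le_trans hj).
have : 0 <= Anorm p nu (fun z => z ^+ j) by exact: powR_ge0.
rewrite le_eqVlt => /predU1P[<-|n0]; first by rewrite mulr0 ltxx.
by rewrite pmulr_lgt0.
Qed.

Lemma dualnorm_extremal : dualnorm p nu k = L.
Proof.
have f1 : Anorm p nu f = 1 := extr.2.1.
have ub : ubound [set cabs (Phi nu k g) | g in [set g | Ap p nu g /\ Anorm p nu g = 1]] L.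
  by move=> _ [g [Ag g1] <-]; have := pairing_le_extremal Ag; rewrite g1 mulr1.
apply/eqP; rewrite eq_le; apply/andP; split.
  by apply: ge_sup => //; exists (cabs (Phi nu k f)), f.
apply: (@le_trans _ _ (cabs (Phi nu k f))).
  exact: le_trans (ler_norm _) (Re_le_cabs _).
by apply: ub_le_sup; [exists L|exists f].
Qed.

(** Since int |f|^p w dA = 1, [1 - E u] is e(u) of the overview and [x] is its quotient; [D] is
    D_q(k)^q when that is finite. *)
Let E u := fine (pint p (fun z => omega (u * csq z)) f).
Let x u := (1 - E u) / (u - 1).
Let D := fine (pint q (wder omega) k).

Let f_int1 : pint p nu f = 1%E.
Proof.
have h : (fine (pint p nu f) `^ p^-1) `^ p = 1 by rewrite -[X in X `^ _]/(Anorm p nu f) extr.2.1 powR1.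
have fin : pint p nu f \is a fin_num by rewrite ge0_fin_numE ?pint_ge0//; exact: Af.2.
rewrite -[LHS]fineK//; congr EFin.
by move: h; rewrite -powRrM mulVf ?gt_eqF// powRr1// fine_ge0// pint_ge0.
Qed.

Let mO u : 0 <= u -> measR (fun z => omega (u * csq z)).
Proof. exact: measR_omega. Qed.
Let O0 u : 0 <= u -> forall z, 0 <= omega (u * csq z).
Proof. by move=> u0 z; exact: omega_scaled_ge0. Qed.
Let ON u : 1 <= u -> forall z, omega (u * csq z) <= nu z.
Proof. by move=> u1 z; rewrite omega_ni ?csq_ge0// ler_peMl ?csq_ge0. Qed.

Let EE u : 1 <= u -> pint p (fun z => omega (u * csq z)) f = (E u)%:E.
Proof.
move=> u1; have u0 : 0 <= u by exact: le_trans u1.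
rewrite fineK// ge0_fin_numE; last by apply: pint_ge0; exact: O0.
apply: (@le_lt_trans _ _ 1%E); last exact: ltry.
by rewrite -f_int1; apply: le_pint => //; [exact: mO|exact: O0|exact: ON].
Qed.

Let pint_diff u : 1 <= u -> pint p (fun z => nu z - omega (u * csq z)) f = (1 - E u)%:E.
Proof.
move=> u1; have u0 : 0 <= u by exact: le_trans u1.
rewrite pint_weightB//; [by rewrite f_int1|exact: mO|exact: O0|exact: ON|by rewrite f_int1 ltry].
Qed.

Let E_ge0 u : 0 <= u -> 0 <= E u.
Proof. by move=> u0; rewrite fine_ge0// pint_ge0//; exact: O0. Qed.

Let E_le1 u : 1 <= u -> E u <= 1.
Proof.
move=> u1; rewrite -subr_ge0 -lee_fin -pint_diff//; apply: pint_ge0 => z.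
by rewrite subr_ge0; exact: ON.
Qed.

Let E_ni u v : 1 <= u -> u <= v -> E v <= E u.
Proof.
move=> u1 uv; have u0 : 0 <= u by exact: le_trans u1.
have v1 : 1 <= v by exact: le_trans uv.
have v0 : 0 <= v by exact: le_trans uv.
have mB w : 0 <= w -> measR (fun z => nu z - omega (w * csq z)) by move=> w0; exact: measRB mN (mO w0).
have : (pint p (fun z => nu z - omega (u * csq z))%R f <= pint p (fun z => nu z - omega (v * csq z))%R f)%E.
  apply: le_pint => //; [exact: mB|exact: mB| |].
    by move=> z; rewrite subr_ge0; exact: ON.
  by move=> z; rewrite lerD2l lerN2 omega_ni ?mulr_ge0 ?csq_ge0// ler_wpM2r ?csq_ge0.
by rewrite !pint_diff// lee_fin lerD2l lerN2.
Qed.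

Let E_sq s : 1 < s -> s ^+ 2 * E (s ^+ 2) <= 1.
Proof.
move=> s1; have s0 : 0 < s by exact: lt_trans s1.
have := pint_dilation_le omega_gt0 omega_ni p1 s1 Af densp; rewrite -/nu f_int1 mule1 => h.
have s21 : 1 <= s ^+ 2 by rewrite exprn_ege1// ltW.
move: h; rewrite (EE s21) lee_fin => h.
by rewrite mulrC -ler_pdivlMr ?exprn_gt0// mul1r.
Qed.

Let dilate_E s : 1 < s ->
  Ap p nu (fun z => f ((RtoC s)^-1 * z)) /\ Anorm p nu (fun z => f ((RtoC s)^-1 * z)) = (s ^+ 2 * E (s ^+ 2)) `^ p^-1.
Proof.
move=> s1; have s0 : 0 < s by exact: lt_trans s1.
have sC0 : RtoC s != 0 by rewrite eq_complex /= negb_and gt_eqF.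
have s21 : 1 <= s ^+ 2 by rewrite exprn_ege1// ltW.
have dE := pint_nu_dilate omega_gt0 omega_ni p s0 mf.
rewrite (EE s21) in dE.
split; last by rewrite /Anorm dE.
by split; [apply: entire_dil; [exact: invr_neq0|exact: Af.1]|rewrite dE ltry].
Qed.

(** The pairing of f(z / s) has real part s (L - Re X), where X is the pairing of f against w(t) -
    w(s t), and it is at most L times the norm of f(z / s). Hoelder's inequality for the weight w(t)
    - w(s t) bounds X, [pint_omega_diff_le] supplying the factor of k. *)
Let key_inequality s : 1 < s -> (pint q (wder omega) k < +oo)%E ->
  L * (s - (s ^+ 2 * E (s ^+ 2)) `^ p^-1) <= s * ((1 - E s) `^ p^-1 * ((s - 1) * D) `^ q^-1).
Proof.
move=> s1 kfin; have s0 : 0 < s by exact: lt_trans s1.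
have [As nAs] := dilate_E s1.
have := pairing_le_extremal As; rewrite nAs => /(le_trans (Re_le_cabs _)) /(le_trans (ler_norm _)).
rewrite (dilation_pairing an omega_gt0 omega_ni omega_decay p1 q1 pq Ak densq s1 Af densp).
set Y := cint _ => hY.
pose W z := nu z - omega (s * csq z).
have mW : measR W by exact: measRB mN (mO (ltW s0)).
have W0 z : 0 <= W z by rewrite subr_ge0; apply: ON; exact: ltW.
have WN z : `|W z| <= 1 * nu z.
  by rewrite ger0_norm// mul1r lerBlDr lerDl; apply: O0; exact: ltW.
have WW z : `|W z| <= 1 * W z by rewrite ger0_norm// mul1r.
have iW := pairing_integrable omega_gt0 omega_ni p1 q1 pq Ak mf Af.2 mW ler01 WN.
pose X := cint (fun z => f z * cconj (k z) * RtoC (W z)).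
have YE : Y = Phi nu k f - X.
  rewrite /Phi /X -cintB//; last exact: iPhi.
  apply: eq_cint => z; rewrite /W.
  have -> : RtoC (nu z - omega (s * csq z)) = RtoC (nu z) - RtoC (omega (s * csq z)).
    by rewrite -![RtoC _]/(real_complex R _) rmorphB.
  by ring.
have e0 : 0 <= 1 - E s by rewrite subr_ge0 E_le1// ltW.
have D0 : 0 <= D by rewrite fine_ge0// pint_ge0//; exact: wder_ge0.
have sD0 : 0 <= (s - 1) * D by rewrite mulr_ge0// subr_ge0 ltW.
have fB : (pint p W f <= (((1 - E s) `^ p^-1) `^ p)%:E)%E.
  by rewrite -powRrM mulVf ?gt_eqF// powRr1// pint_diff// ltW.
have kB : (pint q W k <= ((((s - 1) * D) `^ q^-1) `^ q)%:E)%E.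
  rewrite -powRrM mulVf ?gt_eqF// powRr1//.
  apply: (le_trans (pint_omega_diff_le an omega_gt0 omega_ni q1 (ltW s1) Ak kfin densq)).
  by rewrite EFinM /D fineK// ge0_fin_numE// pint_ge0//; exact: wder_ge0.
have Xle : cabs X <= (1 - E s) `^ p^-1 * ((s - 1) * D) `^ q^-1.
  rewrite -lee_fin; apply: (le_trans (cabs_cint_le iW)).
  have := pairing_abs_le p1 q1 pq mf mW mW W0 (powR_ge0 _ _) ler01 (powR_ge0 _ _) WW fB mk kB.
  by rewrite mul1r.
have XR : complex.Re X <= cabs X by exact: le_trans (ler_norm _) (Re_le_cabs _).
have LE : L * (s - (s ^+ 2 * E (s ^+ 2)) `^ p^-1) <= s * complex.Re X.
  move: hY; rewrite YE.
  have ReM (a : R) (c d : R[i]) : complex.Re (RtoC a * (c - d)) = a * (complex.Re c - complex.Re d).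
    by case: c d => [c1 c2] [d1 d2] /=; rewrite mul0r subr0.
  rewrite ReM -/L.
  move: (_ `^ p^-1) => N h; lra.
apply: (le_trans LE); apply: ler_wpM2l; first exact: ltW.
exact: le_trans XR Xle.
Qed.

Let x_ge0 u : 1 < u -> 0 <= x u.
Proof. by move=> u1; rewrite divr_ge0// subr_ge0 ?E_le1// ltW. Qed.

(** The numerator does not decrease from s to s^2, since E is nonincreasing, and the denominators
    have ratio s + 1. *)
Let x_step s : 1 < s -> x s <= (s + 1) * x (s ^+ 2).
Proof.
move=> s1; have sm : 0 < s - 1 by rewrite subr_gt0.
have sp : 0 < s + 1 by rewrite addr_gt0// (lt_trans ltr01).
have -> : (s + 1) * x (s ^+ 2) = (1 - E (s ^+ 2)) / (s - 1).
  have -> : x (s ^+ 2) = (1 - E (s ^+ 2)) / ((s - 1) * (s + 1)) by rewrite /x; congr (_ / _); ring.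
  by field; rewrite !gt_eqF.
rewrite ler_wpM2r ?invr_ge0 ?(ltW sm)// lerD2l lerN2; apply: E_ni; first exact: ltW.
by rewrite expr2 ler_peMl// ltW// (lt_trans ltr01).
Qed.

Let C := Num.max (p - 1) 1 / L * D `^ q^-1.

Let x_square s : 1 < s -> (pint q (wder omega) k < +oo)%E -> x (s ^+ 2) <= C * x s `^ p^-1.
Proof.
move=> s1 kfin; have s0 : 0 < s by exact: lt_trans s1.
have sm : 0 < s - 1 by rewrite subr_gt0.
have sp : 0 < s + 1 by rewrite addr_gt0.
have L0 := extremal_value_gt0.
have s21 : 1 < s ^+ 2 by rewrite exprn_egt1.
have x0 := x_ge0 s21.
have D0 : 0 <= D by rewrite fine_ge0// pint_ge0//; exact: wder_ge0.
pose N := s ^+ 2 * E (s ^+ 2).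
have Nge0 : 0 <= N by rewrite mulr_ge0 ?E_ge0// exprn_ge0// ltW.
(* This puts N in the form required by [dilation_norm_gap], with y = s^2 x(s^2). *)
have NE : N = s ^+ 2 - (s ^+ 2 - 1) * (s ^+ 2 * x (s ^+ 2)).
  by rewrite /N /x; field; rewrite subr_eq0 gt_eqF.
have gap := dilation_norm_gap p1 s1 Nge0 (E_sq s1) NE.
have key := key_inequality s1 kfin; rewrite -/N in key.
(* As 1/p + 1/q = 1, the two Hoelder factors combine to a full power of s - 1, which cancels the s -
   1 on the left of the gap estimate. *)
have RE : (1 - E s) `^ p^-1 * ((s - 1) * D) `^ q^-1 = (s - 1) * (x s `^ p^-1 * D `^ q^-1).
  have -> : 1 - E s = (s - 1) * x s by rewrite /x mulrC divfK// gt_eqF.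
  rewrite (powRM _ (ltW sm) (x_ge0 s1)) (powRM _ (ltW sm) D0) mulrACA -powRD ?pq ?powRr1 ?(ltW sm)//.
  by rewrite oner_eq0.
rewrite RE in key.
set M := Num.max (p - 1) 1 in gap.
have M0 : 0 <= M by rewrite le_max ler01 orbT.
have h1 : L * ((s - 1) * (s ^+ 2 * x (s ^+ 2))) <= M * (s * ((s - 1) * (x s `^ p^-1 * D `^ q^-1))).
  apply: (le_trans (ler_wpM2l (ltW L0) gap)); rewrite mulrCA; exact: ler_wpM2l.
have h2 : s * x (s ^+ 2) <= C * x s `^ p^-1.
  rewrite /C -/M -(ler_pM2l (mulr_gt0 (mulr_gt0 L0 sm) s0)).
  have -> : L * (s - 1) * s * (s * x (s ^+ 2)) = L * ((s - 1) * (s ^+ 2 * x (s ^+ 2))) by ring.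
  have -> : L * (s - 1) * s * (M / L * D `^ q^-1 * x s `^ p^-1) =
    M * (s * ((s - 1) * (x s `^ p^-1 * D `^ q^-1))) by field; rewrite gt_eqF.
  exact: h1.
(* One factor s is left over on the left after cancellation; it is at least 1 and is dropped. *)
by apply: le_trans h2; rewrite ler_peMl// ltW.
Qed.

Lemma extremal_derivative_bound : (pint q (wder omega) k < +oo)%E ->
  (pint p (wder omega) f <= (C `^ q)%:E)%E.
Proof.
move=> kfin; have L0 := extremal_value_gt0.
have M0 : 0 <= Num.max (p - 1) 1 by rewrite le_max ler01 orbT.
have C0 : 0 <= C by rewrite mulr_ge0 ?powR_ge0// divr_ge0// ltW.
have xC := bound_of_square_recursion p1 C0 x_ge0 (fun s s1 _ => x_square s1 kfin) x_step.
have -> : wder omega = (fun z => - (csq z * dpos omega (1 * csq z))).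
  by apply/funext => z; rewrite mul1r.
apply: (pint_derivative_fatou an omega_ni mf ler01) => d d0.
(* The intervals lie to the right of 1, and v <= 2 keeps them where [x] has been bounded. *)
pose v := Num.min 2 (1 + d / 2); exists 1, v.
have v1 : 1 < v by rewrite lt_min ltr1n ltrDl divr_gt0.
have vd : v < 1 + d by rewrite gt_min; apply/orP; right; lra.
split; first by split=> //; [exact: ltW|rewrite gtrBl].
split=> //; have v2 : v <= 2 by rewrite ge_min lexx.
have -> : pint p (fun z => omega (1 * csq z) - omega (v * csq z)) f = (1 - E v)%:E.
  rewrite -pint_diff ?(ltW v1)//; apply: eq_aint => z; by rewrite mul1r.
by rewrite lee_fin -ler_pdivrMr ?subr_gt0//; exact: xC.
Qed.

Lemma Dinf_pint (r : R) (g : R[i] -> R[i]) :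
  Dinf omega r g = poweR (pint r (wder omega) g) r^-1.
Proof.
rewrite /Dinf; congr poweR; apply: eq_aint => z.
by rewrite /wder dposE ?csq_ge0//; ring.
Qed.

Lemma Dinf_extremal_le :
  (Dinf omega p f <= poweR ((Num.max (p - 1) 1 / dualnorm p nu k)%:E * Dinf omega q k) (p - 1)^-1)%E.
Proof.
rewrite dualnorm_extremal !Dinf_pint; have L0 := extremal_value_gt0.
have M0 : 0 < Num.max (p - 1) 1 by rewrite lt_max ltr01 orbT.
have W0 := wder_ge0 an omega_ni.
have k0 : (0 <= pint q (wder omega) k)%E by exact: pint_ge0.
have [kfin|] := ltP (pint q (wder omega) k) (+oo)%E; last first.
  (* When D_q(k) is infinite, the factor in front of it is positive because L > 0, so the right-hand
     side is +oo. *)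
  rewrite leye_eq => /eqP ->; rewrite poweRyr ?invr_eq0 ?gt_eqF//.
  by rewrite gt0_muley ?lte_fin ?divr_gt0// poweRyr ?invr_eq0 ?gt_eqF// leey.
have kE : pint q (wder omega) k = D%:E by rewrite fineK// ge0_fin_numE.
have C0 : 0 <= C by rewrite mulr_ge0 ?powR_ge0// divr_ge0 ?(ltW M0)// ltW.
rewrite kE [(D%:E `^ _)%E]poweR_EFin -EFinM -/C poweR_EFin.
(* The exponents agree because q / p = 1 / (p - 1). *)
have -> : (C `^ (p - 1)^-1)%:E = poweR (C `^ q)%:E p^-1.
  rewrite poweR_EFin -powRrM; congr (_ `^ _)%:E; rewrite /q; field.
  by rewrite !gt_eqF.
apply: gt0_ler_poweR => //; rewrite ?in_itv/= ?leey ?andbT ?pint_ge0 ?lee_fin ?powR_ge0//.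
  by rewrite invr_ge0 ltW.
exact: extremal_derivative_bound.
Qed.

End extremal_function.

Theorem theorem3p1 (R : realType) (p : R) (omega : R -> R) (k f : R[i] -> R[i]) :
  1 < p ->
  analytic_near_halfline omega ->
  (forall x : R, 0 <= x -> 0 < omega x) ->
  (forall x y : R, 0 <= x -> x <= y -> omega y <= omega x) ->
  (exists x y : R, [/\ 0 <= x, 0 <= y & omega x != omega y]) ->
  (forall n : int, (r ^ n * omega (r ^+ 2)) @[r --> +oo] --> (0 : R)) ->
  (forall n : int, (r ^ n * derive1 omega (r ^+ 2)) @[r --> +oo] --> (0 : R)) ->
  poly_dense p (nu_p omega) ->
  poly_dense (p / (p - 1)) (nu_q omega) ->
  Ap (p / (p - 1)) (nu_p omega) k ->
  (exists z, k z != 0) ->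
  extremal p (nu_p omega) k f ->
  (Dinf omega p f <=
     poweR (((Num.max (p - 1) 1) / dualnorm p (nu_p omega) k)%:E
              * Dinf omega (p / (p - 1)) k) (p - 1)^-1)%E.
Proof.
move=> p1 an omega_gt0 omega_ni _ decay _ densp densq Ak k_neq0 extr.
exact: (Dinf_extremal_le an omega_gt0 omega_ni decay p1 densp densq Ak k_neq0 extr).
Qed.
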